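(* To every triple $\tau=(\mathfrak g,\mathfrak s,\mathfrak c)$ over $\boldsymbol k$ one can assign a right monoalternative connected non-associative Hopf algebra $U_\tau$ and a morphism of triples $\iota\colon\tau\to T(U_\tau)$, $x\mapsto\iota_x$, such that the following hold: (1) the restriction of $\iota$ to $\mathfrak c$ is a linear isomorphism $\mathfrak c\to\mathfrak c(U_\tau)$; (2) for any right monoalternative unital bialgebra $U'$ and any morphism of triples $\iota'\colon\tau\to T(U')$ there exists a unique homomorphism of bialgebras $\psi\colon U_\tau\to U'$ such that $\iota'_c(1)=\psi(\iota_c(1))$ for all $c\in\mathfrak c$; (3) $\tau$ and $T(U_\tau)$ are equivalent triples; (4) for any two triples $\tau,\tau'$, $U_\tau$ is isomorphic to $U_{\tau'}$ if and only if $\tau$ is equivalent to $\tau'$.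
   Context: $\boldsymbol k$ is a field of characteristic zero. A (unital) bialgebra is a vector space $U$ with a bilinear, not necessarily associative product with unit $1$, and a coassociative cocommutative comultiplication $\Delta(u)=u_{(1)}\otimes u_{(2)}$ (Sweedler notation, summation understood) with counit $\epsilon$, such that $\Delta,\epsilon$ are homomorphisms of unital algebras. Homomorphisms of bialgebras are unital algebra homomorphisms that are also coalgebra morphisms. $\mathrm{Prim}(U)=\{a\mid\Delta(a)=a\otimes1+1\otimes a\}$; $R_a\colon x\mapsto xa$. A non-associative Hopf algebra is a unital bialgebra with bilinear maps $\backslash,/$ satisfying $u_{(1)}\backslash(u_{(2)}v)=\epsilon(u)v=u_{(1)}(u_{(2)}\backslash v)$ and $(uv_{(1)})/v_{(2)}=\epsilon(v)u=(u/v_{(1)})v_{(2)}$. A bialgebra is connected if its coalgebra is isomorphic to the symmetric algebra $\boldsymbol k[V]$ of some vector space $V$ with its usual coalgebra structure (elements of $V$ primitive), the unit corresponding to $1$; connected unital bialgebras are automatically non-associative Hopf algebras. A bialgebra is right monoalternative if $((xy_{(1)})\cdots)y_{(n)}=x((y_{(1)}y_{(2)})\cdots y_{(n)})$ for all $x,y$ and all $n\ge0$ (products of several factors left-normed). A triple $\tau=(\mathfrak g,\mathfrak s,\mathfrak c)$ consists of a Lie algebra $\mathfrak g$, a subalgebra $\mathfrak s$ and a subspace $\mathfrak c$ with $\mathfrak g=\mathfrak s\oplus\mathfrak c$. A morphism $\tau\to\tau'$ is a Lie algebra homomorphism $\varphi\colon\mathfrak g\to\mathfrak g'$ with $\varphi(\mathfrak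 s)\subseteq\mathfrak s'$, $\varphi(\mathfrak c)\subseteq\mathfrak c'$. Put $\mathfrak g_{\rm inn}=$ the Lie subalgebra of $\mathfrak g$ generated by $\mathfrak c$, $\mathfrak s_{\rm inn}=\mathfrak g_{\rm inn}\cap\mathfrak s$, $\tau_{\rm inn}=(\mathfrak g_{\rm inn},\mathfrak s_{\rm inn},\mathfrak c)$, and let $\mathrm{core}(\mathfrak s_{\rm inn})$ be the largest ideal of $\mathfrak g_{\rm inn}$ contained in $\mathfrak s_{\rm inn}$. Put $\tau_{\rm red}=(\mathfrak g_{\rm inn}/\mathrm{core}(\mathfrak s_{\rm inn}),\mathfrak s_{\rm inn}/\mathrm{core}(\mathfrak s_{\rm inn}),\mathfrak c)$ ($\mathfrak c$ identified with its image). Triples $\tau,\tau'$ are equivalent if $\tau_{\rm red}\cong\tau'_{\rm red}$. For a unital bialgebra $U$, $T(U)=(\mathfrak g(U),\mathfrak s(U),\mathfrak c(U))$ where $\mathfrak g(U)=\{f\in\mathrm{End}_{\boldsymbol k}(U)\mid\Delta(f(u))=f(u_{(1)})\otimes u_{(2)}+u_{(1)}\otimes f(u_{(2)})\ \forall u\in U\}$ (with the commutator bracket), $\mathfrak s(U)=\{f\in\mathfrak g(U)\mid f(1)=0\}$, $\mathfrak c(U)=\{R_a\mid a\in\mathrm{Prim}(U)\}$; this is a triple. *)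

(* Defs.v *)
From HB Require Import structures.
From mathcomp Require Import all_boot all_algebra.
From mathcomp Require Import finmap monalg.
From mathcomp Require Import boolp functions.
From mathcomp Require Import ring_quotient.

Set Implicit Arguments.
Unset Strict Implicit.
Unset Printing Implicit Defensive.

Import GRing.Theory.
Local Open Scope ring_scope.
Local Open Scope quotient_scope.

Record subspace (K : fieldType) (V : lmodType K) := Subspace {
  sp_pred :> {pred V};
  sp_closed : submod_closed sp_pred
}.

Section Subspace.
Variables (K : fieldType) (V : lmodType K).

HB.instance Definition _ (S : subspace V) :=
  GRing.isSubmodClosed.Build K V (sp_pred S) (sp_closed S).

Lemma mk_submod_closed (P : V -> Prop) (P0 : P 0)
    (PL : forall a x y, P x -> P y -> P (a *: x + y)) :
  submod_closed [pred x | `[< P x >]].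
Proof.
split; first exact/asboolP.
by move=> a x y /asboolP Px /asboolP Py; apply/asboolP; exact: PL.
Qed.

Definition mk_subspace P P0 PL := Subspace (@mk_submod_closed P P0 PL).

Lemma mk_subspaceP P P0 PL x : reflect (P x) (x \in @mk_subspace P P0 PL).
Proof. exact: asboolP. Qed.

Definition in_span (A : V -> Prop) (x : V) : Prop :=
  forall S : subspace V, (forall y, A y -> y \in S) -> x \in S.

Lemma in_span0 A : in_span A 0.
Proof. by move=> S _; exact: rpred0. Qed.

Lemma in_spanL A a x y : in_span A x -> in_span A y -> in_span A (a *: x + y).
Proof. by move=> Hx Hy S AS; rewrite rpredD ?rpredZ ?Hx ?Hy. Qed.

Definition span A := mk_subspace (@in_span0 A) (@in_spanL A).

Lemma spanP A x : reflect (in_span A x) (x \in span A).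
Proof. exact: mk_subspaceP. Qed.

End Subspace.

Definition sp_type (K : fieldType) (V : lmodType K) (S : subspace V) :=
  {x : V | x \in sp_pred S}.

Section SubspaceType.
Variables (K : fieldType) (V : lmodType K) (S : subspace V).
HB.instance Definition _ :=
  [isSub of sp_type S for (@sval V (fun x => x \in sp_pred S))].
HB.instance Definition _ := [Choice of sp_type S by <:].
HB.instance Definition _ := [SubChoice_isSubLmodule of sp_type S by <:].
End SubspaceType.

(* V / S *)
Definition sp_quot (K : fieldType) (V : lmodType K) (S : subspace V) :=
  Quotient.quot (sp_pred S).

Section SubspaceQuotient.
Variables (K : fieldType) (V : lmodType K) (S : subspace V).
HB.instance Definition _ := GRing.Zmodule.on (sp_quot S).
HB.instance Definition _ := ZmodQuotient.on (sp_quot S).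

Definition sp_pi (x : V) : sp_quot S := \pi_(sp_quot S) x.

Lemma sp_piE x y : (sp_pi x = sp_pi y) <-> (x - y \in S).
Proof.
split=> [/eqP|xy].
  by rewrite /sp_pi -Quotient.idealrBE.
by apply/eqP; rewrite /sp_pi -Quotient.idealrBE.
Qed.

Definition quot_scale (a : K) (q : sp_quot S) : sp_quot S := sp_pi (a *: repr q).

Lemma sp_piK q : sp_pi (repr q) = q.
Proof. exact: reprK. Qed.

Lemma sp_piD x y : sp_pi (x + y) = sp_pi x + sp_pi y.
Proof. exact: Quotient.pi_add. Qed.

Lemma quot_scaleE a x : quot_scale a (sp_pi x) = sp_pi (a *: x).
Proof.
apply/sp_piE; rewrite -scalerBr; apply: rpredZ.
by apply/sp_piE; rewrite sp_piK.
Qed.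
End SubspaceQuotient.

Section QuotScale.
Variables (K : fieldType) (V : lmodType K) (S : subspace V).
Local Notation Q := (sp_quot S).
Let scale := @quot_scale K V S.

Let scaleA a b q : scale a (scale b q) = scale (a * b) q.
Proof. by rewrite -[q]sp_piK /scale !quot_scaleE scalerA. Qed.
Let scale1 : left_id 1 scale.
Proof. by move=> q; rewrite -[q]sp_piK /scale !quot_scaleE scale1r. Qed.
Let scaleDr : right_distributive scale +%R.
Proof.
move=> a p q; rewrite -[q]sp_piK -[p]sp_piK /scale -sp_piD !quot_scaleE.
by rewrite scalerDr sp_piD.
Qed.
Let scaleDl q : {morph scale^~ q : a b / a + b}.
Proof.
by move=> a b; rewrite -[q]sp_piK /scale !quot_scaleE scalerDl sp_piD.
Qed.

HB.instance Definition _ :=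
  GRing.Zmodule_isLmodule.Build K Q scaleA scale1 scaleDr scaleDl.

Lemma sp_pi_linear : linear (@sp_pi K V S).
Proof. by move=> a x y; rewrite sp_piD -quot_scaleE. Qed.

HB.instance Definition _ := GRing.isLinear.Build K V Q _ _ sp_pi_linear.
End QuotScale.

(* Tensor product: the free vector space on [U * V] modulo bilinearity. *)
Inductive tensor_rel (K : fieldType) (U V : lmodType K) :
    {malg K[(U * V)%type]} -> Prop :=
| Tensor_rel_l a u u' v : tensor_rel
    (<< (a *: u + u', v) >> - a *: << (u, v) >> - << (u', v) >>)
| Tensor_rel_r a u v v' : tensor_rel
    (<< (u, a *: v + v') >> - a *: << (u, v) >> - << (u, v') >>).

Definition tensor (K : fieldType) (U V : lmodType K) :=
  sp_quot (span (@tensor_rel K U V)).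

HB.instance Definition _ (K : fieldType) (U V : lmodType K) :=
  GRing.Lmodule.on (tensor U V).

Definition ptensor (K : fieldType) (U V : lmodType K) (u : U) (v : V) :
  tensor U V := sp_pi _ << (u, v) >>.

Notation "u ⊗ v" := (ptensor u v) (at level 40, left associativity).

Definition bilin (K : fieldType) (U V W : lmodType K) (f : U -> V -> W) :=
  (forall v, linear (f^~ v)) /\ (forall u, linear (f u)).

(* [tlift f] is the linear map [u ⊗ v |-> f u v]; it is only meaningful when   *)
(* [f] is bilinear (see [tliftE]). In Sweedler notation, the value of          *)
(* [tlift f] at [comul u] is [f u_(1) u_(2)].                                  *)
HB.lock Definition tlift (K : fieldType) (U V W : lmodType K) (f : U -> V -> W)
    (t : tensor U V) : W :=
  \sum_(p <- msupp (repr t)) (repr t)@_p *: f p.1 p.2.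
Canonical tlift_unlockable := Unlockable tlift.unlock.
Arguments tlift {K U V W}.

Definition tmap (K : fieldType) (U U' V V' : lmodType K)
    (f : U -> U') (g : V -> V') : tensor U V -> tensor U' V' :=
  tlift (fun u v => f u ⊗ g v).

Definition tswap (K : fieldType) (U V : lmodType K) :
    tensor U V -> tensor V U :=
  tlift (fun u v => v ⊗ u).

Definition tassoc (K : fieldType) (U V W : lmodType K) :
    tensor (tensor U V) W -> tensor U (tensor V W) :=
  tlift (fun t w => tlift (fun u v => u ⊗ (v ⊗ w)) t).

Section TensorTheory.
Variables (K : fieldType) (U V : lmodType K).

Lemma bilin_ptensor : bilin (@ptensor K U V).
Proof.
split=> [v a u u'|u a v v'].
  rewrite /ptensor -sp_pi_linear; apply/sp_piE/spanP => S; apply.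
  rewrite opprD addrA; exact: Tensor_rel_l.
rewrite /ptensor -sp_pi_linear; apply/sp_piE/spanP => S; apply.
rewrite opprD addrA; exact: Tensor_rel_r.
Qed.

Lemma ptensor_l (v : V) : linear (fun u : U => u ⊗ v).
Proof. exact: bilin_ptensor.1. Qed.

Lemma ptensor_r (u : U) : linear (fun v : V => u ⊗ v).
Proof. exact: bilin_ptensor.2. Qed.

Lemma tensor_sum (t : tensor U V) :
  t = \sum_(p <- msupp (repr t)) (repr t)@_p *: (p.1 ⊗ p.2).
Proof.
rewrite -[LHS]sp_piK {1}(monalgE (repr t)) raddf_sum /=.
apply: eq_bigr => -[u v] _; rewrite /ptensor -linearZ /=; congr sp_pi.
by apply/malgP => k; rewrite mcoeffZ !mcoeffU mulrnAr mulr1.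
Qed.

Variable W : lmodType K.

Definition malg_lift (f : U -> V -> W) (m : {malg K[(U * V)%type]}) : W :=
  \sum_(p <- msupp m) m@_p *: f p.1 p.2.

Lemma malg_lift_linear f : linear (malg_lift f).
Proof.
move=> a m m'; pose d := (msupp m `|` msupp m' `|` msupp (a *: m + m'))%fset.
have E n : (msupp n `<=` d)%fset ->
    malg_lift f n = \sum_(p <- d) n@_p *: f p.1 p.2.
  move=> nd; apply: big_fset_incl => // p _.
  by move/mcoeff_outdom=> ->; rewrite scale0r.
rewrite !E ?fsubsetUr // /d; last 2 first.
- by rewrite fsubsetU // fsubsetUr.
- by rewrite fsubsetU // fsubsetUl.
rewrite scaler_sumr -big_split /=; apply: eq_bigr => p _.
by rewrite mcoeffD mcoeffZ scalerDl scalerA.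
Qed.

HB.instance Definition _ f := GRing.isLinear.Build K _ W _ (malg_lift f)
  (malg_lift_linear f).

Lemma malg_liftU f u v : malg_lift f << (u, v) >> = f u v.
Proof.
by rewrite /malg_lift msuppU oner_eq0 big_seq_fset1 mcoeffUU scale1r.
Qed.

Lemma malg_lift_rel f m : bilin f ->
  m \in span (@tensor_rel K U V) -> malg_lift f m = 0.
Proof.
move=> [fl fr] /spanP Sm.
have P0 : malg_lift f 0 = 0 by rewrite linear0.
have PL a x y : malg_lift f x = 0 -> malg_lift f y = 0 ->
    malg_lift f (a *: x + y) = 0.
  by move=> x0 y0; rewrite malg_lift_linear x0 y0 scaler0 addr0.
apply/(mk_subspaceP P0 PL)/Sm => _ [a u u' v|a u v v']; apply/mk_subspaceP.
  by rewrite !linearB /= linearZ /= !malg_liftU fl addrAC addrK subrr.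
by rewrite !linearB /= linearZ /= !malg_liftU fr addrAC addrK subrr.
Qed.

Lemma tlift_pi (f : U -> V -> W) m : bilin f ->
  tlift f (sp_pi _ m) = malg_lift f m.
Proof.
move=> bf; apply/eqP; rewrite -subr_eq0 tlift.unlock -[X in X - _]/(malg_lift f _).
rewrite -linearB /=.
apply/eqP/(malg_lift_rel bf)/sp_piE; exact: sp_piK.
Qed.

Lemma tlift_linear (f : U -> V -> W) : bilin f -> linear (tlift f).
Proof.
move=> bf a s t; rewrite -[s]sp_piK -[t]sp_piK -sp_pi_linear !tlift_pi //.
exact: malg_lift_linear.
Qed.

Lemma tliftE (f : U -> V -> W) u v : bilin f -> tlift f (u ⊗ v) = f u v.
Proof. by move=> bf; rewrite tlift_pi // malg_liftU. Qed.

Lemma tlift_comb a (f g h : U -> V -> W) t :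
  (forall u v, h u v = a *: f u v + g u v) ->
  tlift h t = a *: tlift f t + tlift g t.
Proof.
move=> E; rewrite unlock scaler_sumr -big_split /=; apply: eq_bigr => p _.
by rewrite E scalerDr !scalerA mulrC.
Qed.

Lemma eq_tlift (f g : U -> V -> W) t :
  (forall u v, f u v = g u v) -> tlift f t = tlift g t.
Proof. by move=> E; rewrite unlock; apply: eq_bigr => p _; rewrite E. Qed.

Lemma tensor_ext (F G : tensor U V -> W) : linear F -> linear G ->
  (forall u v, F (u ⊗ v) = G (u ⊗ v)) -> forall t, F t = G t.
Proof.
move=> lF lG E t.
pose F' := HB.pack_for {linear tensor U V -> W} F
  (GRing.isLinear.Build _ _ _ _ F lF).
pose G' := HB.pack_for {linear tensor U V -> W} G
  (GRing.isLinear.Build _ _ _ _ G lG).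
rewrite -[F]/(F' : _ -> _) -[G]/(G' : _ -> _) (tensor_sum t) !linear_sum.
by apply: eq_bigr => p _; rewrite !linearZ /= E.
Qed.
End TensorTheory.

Section TmapTheory.
Variables (K : fieldType) (U U' U'' V V' V'' : lmodType K).
Variables (f : U -> U') (g : V -> V') (f' : U' -> U'') (g' : V' -> V'').
Hypotheses (lf : linear f) (lg : linear g) (lf' : linear f') (lg' : linear g').

Lemma bilin_tmap : bilin (fun u v => f u ⊗ g v).
Proof.
by split=> [v a u u'|u a v v']; rewrite ?lf ?lg ?ptensor_l ?ptensor_r.
Qed.

Lemma tmap_linear : linear (tmap f g).
Proof. exact/tlift_linear/bilin_tmap. Qed.

Lemma tmapE u v : tmap f g (u ⊗ v) = f u ⊗ g v.
Proof. exact: tliftE bilin_tmap. Qed.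
End TmapTheory.

Lemma tmap_comp (K : fieldType) (U U' U'' V V' V'' : lmodType K)
    (f : U -> U') (g : V -> V') (f' : U' -> U'') (g' : V' -> V'') t :
  linear f -> linear g -> linear f' -> linear g' ->
  tmap f' g' (tmap f g t) = tmap (f' \o f) (g' \o g) t.
Proof.
move=> lf lg lf' lg'; move: t; apply: tensor_ext.
- by move=> a s t; rewrite !tmap_linear.
- by apply: tmap_linear => a x y /=; rewrite ?lf ?lg ?lf' ?lg'.
- move=> u v; rewrite !tmapE // => a x y /=; first by rewrite lf lf'.
  by rewrite lg lg'.
Qed.

HB.mixin Record isLieAlgebra (K : fieldType) L of GRing.Lmodule K L := {
  lie : L -> L -> L;
  lie_bilin : bilin lie;
  lie_alt : forall x, lie x x = 0;
  lie_jacobi : forall x y z,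
    lie x (lie y z) + lie y (lie z x) + lie z (lie x y) = 0
}.

#[short(type="lieAlgType")]
HB.structure Definition LieAlgebra (K : fieldType) :=
  {L of GRing.Lmodule K L & isLieAlgebra K L}.

Section LieTheory.
Variables (K : fieldType) (L : lieAlgType K).
Implicit Types x y z : L.

Lemma lieDl x y z : lie (x + y) z = lie x z + lie y z.
Proof. by have := lie_bilin.1 z 1 x y; rewrite /= !scale1r. Qed.
Lemma lieDr x y z : lie z (x + y) = lie z x + lie z y.
Proof. by have := lie_bilin.2 z 1 x y; rewrite /= !scale1r. Qed.
Lemma lie0l x : lie 0 x = 0.
Proof. by apply: (@addrI _ (lie 0 x)); rewrite -lieDl !addr0. Qed.
Lemma lie0r x : lie x 0 = 0.
Proof. by apply: (@addrI _ (lie x 0)); rewrite -lieDr !addr0. Qed.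
Lemma lieNr x y : lie x (- y) = - lie x y.
Proof. by apply/eqP; rewrite -addr_eq0 -lieDr addNr lie0r. Qed.
Lemma lieC x y : lie x y = - lie y x.
Proof.
apply/eqP; rewrite -addr_eq0; apply/eqP.
by have := lie_alt (x + y); rewrite lieDl !lieDr !lie_alt add0r addr0.
Qed.
Lemma lieBr x y z : lie z (x - y) = lie z x - lie z y.
Proof. by rewrite lieDr lieNr. Qed.
Lemma lieBl x y z : lie (x - y) z = lie x z - lie y z.
Proof. by rewrite ![lie _ z]lieC lieBr opprB opprK addrC. Qed.
End LieTheory.

Record lie_subalg (K : fieldType) (L : lieAlgType K) := LieSubalg {
  lsub :> subspace L;
  lsub_lie : {in lsub &, forall x y, lie x y \in lsub}
}.

Record lie_ideal (K : fieldType) (L : lieAlgType K) := LieIdeal {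
  lideal :> subspace L;
  lideal_lie : forall x y, y \in lideal -> lie x y \in lideal
}.

Section SubLie.
Variables (K : fieldType) (L : lieAlgType K) (G : lie_subalg L).

Definition sub_lie (x y : sp_type G) : sp_type G :=
  exist _ (lie (val x) (val y)) (lsub_lie (valP x) (valP y)).

Let sub_lie_bilin : bilin sub_lie.
Proof.
by split=> [v a x y|v a x y]; apply: val_inj; rewrite /= (lie_bilin.1, lie_bilin.2).
Qed.
Let sub_lie_alt x : sub_lie x x = 0.
Proof. by apply: val_inj; rewrite /= lie_alt. Qed.
Let sub_lie_jacobi x y z : sub_lie x (sub_lie y z) + sub_lie y (sub_lie z x)
  + sub_lie z (sub_lie x y) = 0.
Proof. by apply: val_inj; rewrite /= lie_jacobi. Qed.

HB.instance Definition _ := isLieAlgebra.Build K (sp_type G)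
  sub_lie_bilin sub_lie_alt sub_lie_jacobi.
End SubLie.

Section QuotLie.
Variables (K : fieldType) (L : lieAlgType K) (I : lie_ideal L).
Local Notation Q := (sp_quot I).

Definition quot_lie (p q : Q) : Q := sp_pi I (lie (repr p) (repr q)).

Lemma quot_lieE x y : quot_lie (sp_pi I x) (sp_pi I y) = sp_pi I (lie x y).
Proof.
apply/sp_piE; set x' := repr _; set y' := repr _.
have xI : x' - x \in lideal I by apply/sp_piE; rewrite sp_piK.
have yI : y' - y \in lideal I by apply/sp_piE; rewrite sp_piK.
have -> : lie x' y' - lie x y = lie x' (y' - y) - lie y (x' - x).
  rewrite !lieBr opprB [lie y x']lieC [lie y x]lieC opprK.
  by rewrite [- lie x y + _]addrC addrA addrNK.
by apply: rpredB; apply: lideal_lie.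
Qed.

Let quot_lie_bilin : bilin quot_lie.
Proof.
split=> r a p q; rewrite -[p]sp_piK -[q]sp_piK -[r]sp_piK -sp_pi_linear /=.
  by rewrite !quot_lieE lie_bilin.1 sp_pi_linear.
by rewrite !quot_lieE lie_bilin.2 sp_pi_linear.
Qed.
Let quot_lie_alt p : quot_lie p p = 0.
Proof. by rewrite -[p]sp_piK quot_lieE lie_alt linear0. Qed.
Let quot_lie_jacobi p q r : quot_lie p (quot_lie q r)
  + quot_lie q (quot_lie r p) + quot_lie r (quot_lie p q) = 0.
Proof.
rewrite -[p]sp_piK -[q]sp_piK -[r]sp_piK !quot_lieE -!sp_piD lie_jacobi.
by rewrite linear0.
Qed.

HB.instance Definition _ := isLieAlgebra.Build K Q
  quot_lie_bilin quot_lie_alt quot_lie_jacobi.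
End QuotLie.

Record triple (K : fieldType) := Triple {
  tg :> lieAlgType K;
  ts : lie_subalg tg;
  tc : subspace tg;
  triple_cover : forall x : tg, exists a b, [/\ a \in ts, b \in tc & x = a + b];
  triple_direct : forall x : tg, x \in ts -> x \in tc -> x = 0
}.
Arguments ts {K}.
Arguments tc {K}.

Definition is_triple_hom (K : fieldType) (tau tau' : triple K)
    (phi : tau -> tau') : Prop :=
  [/\ linear phi,
      forall x y, phi (lie x y) = lie (phi x) (phi y),
      forall x, x \in ts tau -> phi x \in ts tau' &
      forall x, x \in tc tau -> phi x \in tc tau'].

Definition triple_iso (K : fieldType) (tau tau' : triple K) : Prop :=
  exists (phi : tau -> tau') (psi : tau' -> tau),
    [/\ is_triple_hom phi, is_triple_hom psi, cancel phi psi & cancel psi phi].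

Section Inner.
Variables (K : fieldType) (tau : triple K).

Definition in_g_inn (x : tau) : Prop :=
  forall G : lie_subalg tau, {subset tc tau <= G} -> x \in G.

Lemma in_g_inn0 : in_g_inn 0.
Proof. by move=> G _; exact: rpred0. Qed.

Lemma in_g_innL a x y : in_g_inn x -> in_g_inn y -> in_g_inn (a *: x + y).
Proof. by move=> Hx Hy G cG; rewrite rpredD ?rpredZ ?Hx ?Hy. Qed.

Lemma g_inn_lie :
  {in mk_subspace in_g_inn0 in_g_innL &, forall x y,
    lie x y \in mk_subspace in_g_inn0 in_g_innL}.
Proof.
move=> x y /mk_subspaceP Hx /mk_subspaceP Hy; apply/mk_subspaceP => G cG.
by apply: lsub_lie; [exact: Hx|exact: Hy].
Qed.

(* The Lie subalgebra of [g] generated by [c]. *)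
Definition g_inn : lie_subalg tau := LieSubalg g_inn_lie.

Lemma g_innP x : reflect (in_g_inn x) (x \in g_inn).
Proof. exact: mk_subspaceP. Qed.

Lemma tc_g_inn : {subset tc tau <= g_inn}.
Proof. by move=> x xc; apply/g_innP => G; apply. Qed.

(* The intersection of a subspace [S] with [g_inn]. *)
Section Trace.
Variable S : subspace tau.

Lemma trace0 : val (0 : sp_type g_inn) \in S.
Proof. by rewrite raddf0 rpred0. Qed.

Lemma traceL a (x y : sp_type g_inn) :
  val x \in S -> val y \in S -> val (a *: x + y) \in S.
Proof. by move=> Sx Sy; rewrite linearP rpredD ?rpredZ. Qed.

Definition trace : subspace (sp_type g_inn) :=
  @mk_subspace K (sp_type g_inn) (fun x => val x \in S) trace0 traceL.

Lemma traceP x : (x \in trace) = (val x \in S).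
Proof. by apply/mk_subspaceP/idP. Qed.
End Trace.

Lemma s_inn_lie :
  {in trace (ts tau) &, forall x y, lie x y \in trace (ts tau)}.
Proof. by move=> x y; rewrite !traceP; exact: lsub_lie. Qed.

Definition s_inn : lie_subalg (sp_type g_inn) := LieSubalg s_inn_lie.

Lemma tinn_cover (x : sp_type g_inn) :
  exists a b, [/\ a \in s_inn, b \in trace (tc tau) & x = a + b].
Proof.
have [a [b [sa cb E]]] := triple_cover (val x).
have gb : b \in g_inn := tc_g_inn cb.
have ga : a \in g_inn by rewrite -[a](addrK b) -E rpredB // (valP x).
exists (Sub a ga), (Sub b gb); split; rewrite ?traceP //.
exact: val_inj.
Qed.

Lemma tinn_direct (x : sp_type g_inn) :
  x \in s_inn -> x \in trace (tc tau) -> x = 0.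
Proof.
rewrite !traceP => xs xc; apply: val_inj.
by rewrite raddf0; exact: triple_direct.
Qed.

Definition tinn : triple K := Triple tinn_cover tinn_direct.
End Inner.

Section Core.
Variables (K : fieldType) (tau : triple K).

(* [core] is the union of the ideals of [g] contained in [s]; it is the       *)
(* largest of them, see [core_sub] and [core_max].                            *)
Definition in_core (x : tau) : Prop :=
  exists I : lie_ideal tau, {subset I <= ts tau} /\ x \in I.

Lemma in_core0 : in_core 0.
Proof.
have z0 : submod_closed (pred1 (0 : tau)).
  split=> [|a x y]; rewrite !inE ?eqxx // => /eqP-> /eqP->.
  by rewrite scaler0 addr0.
have zP x : (x \in Subspace z0) = (x == 0) by [].
have zL x y : y \in Subspace z0 -> lie x y \in Subspace z0.
  by rewrite !zP => /eqP->; rewrite lie0r eqxx.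
exists (LieIdeal zL); split; last exact: rpred0.
by move=> x /(elimT eqP) ->; exact: rpred0.
Qed.

Lemma in_coreL a x y : in_core x -> in_core y -> in_core (a *: x + y).
Proof.
move=> [I [sI xI]] [J [sJ yJ]].
pose Q z := exists u v, [/\ u \in lideal I, v \in lideal J & z = u + v].
have Q0 : Q 0 by exists 0, 0; rewrite addr0 !rpred0.
have QL b z w : Q z -> Q w -> Q (b *: z + w).
  move=> [u [v [uI vJ ->]]] [u' [v' [uI' vJ' ->]]].
  exists (b *: u + u'), (b *: v + v').
  by rewrite !rpredD ?rpredZ // scalerDr addrACA.
have Qlie z w : w \in mk_subspace Q0 QL -> lie z w \in mk_subspace Q0 QL.
  move=> /mk_subspaceP[u [v [uI vJ ->]]]; apply/mk_subspaceP.
  by exists (lie z u), (lie z v); rewrite lieDr !lideal_lie.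
exists (LieIdeal Qlie); split.
  by move=> z /mk_subspaceP[u [v [uI vJ ->]]]; apply: rpredD; [exact: sI|exact: sJ].
by apply/mk_subspaceP; exists (a *: x), y; rewrite rpredZ.
Qed.

Lemma core_lie x y : y \in mk_subspace in_core0 in_coreL ->
  lie x y \in mk_subspace in_core0 in_coreL.
Proof.
move=> /mk_subspaceP[I [sI yI]]; apply/mk_subspaceP; exists I.
by split=> //; exact: lideal_lie.
Qed.

Definition core : lie_ideal tau := LieIdeal core_lie.

Lemma coreP x : reflect (in_core x) (x \in core).
Proof. exact: mk_subspaceP. Qed.

Lemma core_sub : {subset core <= ts tau}.
Proof. by move=> x /coreP[I [sI xI]]; exact: sI. Qed.

Lemma core_max (I : lie_ideal tau) : {subset I <= ts tau} -> {subset I <= core}.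
Proof. by move=> sI x xI; apply/coreP; exists I. Qed.

Section Image.
Variable S : subspace tau.

Definition in_image (q : sp_quot core) : Prop :=
  exists2 x, x \in S & q = sp_pi core x.

Lemma in_image0 : in_image 0.
Proof. by exists 0; rewrite ?rpred0 // raddf0. Qed.

Lemma in_imageL a p q : in_image p -> in_image q -> in_image (a *: p + q).
Proof.
move=> [x Sx ->] [y Sy ->]; exists (a *: x + y); first by rewrite rpredD ?rpredZ.
by rewrite sp_pi_linear.
Qed.

(* The image of [S] in [g / core]. *)
Definition quot_image : subspace (sp_quot core) :=
  mk_subspace in_image0 in_imageL.

Lemma quot_imageP q : reflect (in_image q) (q \in quot_image).
Proof. exact: mk_subspaceP. Qed.
End Image.

Lemma s_quot_lie :
  {in quot_image (ts tau) &, forall p q, lie p q \in quot_image (ts tau)}.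
Proof.
move=> _ _ /quot_imageP[x xs ->] /quot_imageP[y ys ->].
apply/quot_imageP; exists (lie x y); first exact: lsub_lie.
exact: quot_lieE.
Qed.

Definition s_quot : lie_subalg (sp_quot core) := LieSubalg s_quot_lie.

Lemma tquot_cover (q : sp_quot core) :
  exists a b, [/\ a \in s_quot, b \in quot_image (tc tau) & q = a + b].
Proof.
have [a [b [sa cb E]]] := triple_cover (repr q).
exists (sp_pi core a), (sp_pi core b); split.
- by apply/quot_imageP; exists a.
- by apply/quot_imageP; exists b.
- by rewrite -sp_piD -E sp_piK.
Qed.

Lemma tquot_direct (q : sp_quot core) :
  q \in s_quot -> q \in quot_image (tc tau) -> q = 0.
Proof.
move=> /quot_imageP[x xs ->] /quot_imageP[y yc Exy].
have /core_sub xy : x - y \in core by apply/sp_piE.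
have ys : y \in ts tau by rewrite -[y](subKr x) rpredB.
by rewrite Exy (triple_direct ys yc) raddf0.
Qed.

(* The triple [(g / core, s / core, c)]. *)
Definition tquot : triple K := Triple tquot_cover tquot_direct.
End Core.

(* tau_red: the core is the largest ideal of g_inn contained in s_inn. *)
Definition tred (K : fieldType) (tau : triple K) : triple K := tquot (tinn tau).

Definition triple_equiv (K : fieldType) (tau tau' : triple K) : Prop :=
  triple_iso (tred tau) (tred tau').

(* The product of the algebra [U ⊗ U]: (a ⊗ b)(c ⊗ d) = ac ⊗ bd. *)
Definition tmul (K : fieldType) (U : lmodType K) (mul : U -> U -> U)
    (s t : tensor U U) : tensor U U :=
  tlift (fun a b => tlift (fun c d => mul a c ⊗ mul b d) t) s.

HB.mixin Record isBialgebra (K : fieldType) U of GRing.Lmodule K U := {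
  bmul : U -> U -> U;
  bone : U;
  comul : U -> tensor U U;
  counit : U -> K;
  bmul_bilin : bilin bmul;
  bmul1l : left_id bone bmul;
  bmul1r : right_id bone bmul;
  comul_linear : linear comul;
  counit_linear : scalar counit;
  comulA : forall u, tassoc (tmap comul id (comul u)) = tmap id comul (comul u);
  comulC : forall u, tswap (comul u) = comul u;
  counitl : forall u, tlift (fun a b => counit a *: b) (comul u) = u;
  counitr : forall u, tlift (fun a b => counit b *: a) (comul u) = u;
  comulM : forall u v, comul (bmul u v) = tmul bmul (comul u) (comul v);
  comul1 : comul bone = bone ⊗ bone;
  counitM : forall u v, counit (bmul u v) = counit u * counit v;
  counit1 : counit bone = 1
}.

(* Unital bialgebras: the product is not assumed associative, the             *)
(* comultiplication is coassociative and cocommutative.                       *)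
#[short(type="bialgType")]
HB.structure Definition Bialgebra (K : fieldType) :=
  {U of GRing.Lmodule K U & isBialgebra K U}.

HB.mixin Record isNaHopf (K : fieldType) U of Bialgebra K U := {
  ldiv : U -> U -> U;   (* ldiv u v = u \ v *)
  rdiv : U -> U -> U;   (* rdiv u v = u / v *)
  ldiv_bilin : bilin ldiv;
  rdiv_bilin : bilin rdiv;
  ldivK : forall u v : U,
    tlift (fun a b => ldiv a (bmul b v)) (comul u) = counit u *: v;
  ldivVK : forall u v : U,
    tlift (fun a b => bmul a (ldiv b v)) (comul u) = counit u *: v;
  rdivK : forall u v : U,
    tlift (fun a b => rdiv (bmul u a) b) (comul v) = counit v *: u;
  rdivVK : forall u v : U,
    tlift (fun a b => bmul (rdiv u a) b) (comul v) = counit v *: u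
}.

#[short(type="naHopfType")]
HB.structure Definition NaHopf (K : fieldType) :=
  {U of Bialgebra K U & isNaHopf K U}.

Definition coalg_morph (K : fieldType) (U V : bialgType K) (f : U -> V) : Prop :=
  [/\ linear f,
      forall u, comul (f u) = tmap f f (comul u) &
      forall u, counit (f u) = counit u].

Definition bialg_morph (K : fieldType) (U V : bialgType K) (f : U -> V) : Prop :=
  [/\ coalg_morph f, forall u v, f (bmul u v) = bmul (f u) (f v) &
      f bone = bone].

Definition bialg_iso (K : fieldType) (U V : bialgType K) : Prop :=
  exists (f : U -> V) (g : V -> U),
    [/\ bialg_morph f, bialg_morph g, cancel f g & cancel g f].

Definition primitive (K : fieldType) (U : bialgType K) (a : U) : Prop :=
  comul a = a ⊗ bone + bone ⊗ a.

Section Monoalternative.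
Variables (K : fieldType) (U : bialgType K).

(* tpow n = U ⊗ ... ⊗ U (n factors), bracketed to the left. *)
Fixpoint tpow (n : nat) : lmodType K :=
  if n is n'.+1 then tensor (tpow n') U else K^o.

(* comuln n y = y_(1) ⊗ ... ⊗ y_(n); for n = 0 this is the counit. *)
Fixpoint comuln (n : nat) : U -> tpow n :=
  match n return U -> tpow n with
  | 0 => counit
  | n'.+1 => fun y => tmap (comuln n') id (comul y)
  end.

(* mulRn x (y_1 ⊗ ... ⊗ y_n) = ((x y_1) ...) y_n. *)
Fixpoint mulRn (n : nat) (x : U) : tpow n -> U :=
  match n return tpow n -> U with
  | 0 => fun a : K => a *: x
  | n'.+1 => tlift (fun t y => bmul (mulRn x t) y)
  end.

Definition right_monoalternative : Prop :=
  forall (x y : U) (n : nat),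
    mulRn x (comuln n y) = bmul x (mulRn bone (comuln n y)).
End Monoalternative.

(* [S] is the symmetric algebra k[V], with its usual coalgebra structure: it   *)
(* is the free commutative associative algebra on [V], and it carries the     *)
(* bialgebra structure for which the elements of [V] are primitive.           *)
Definition is_symmetric_bialgebra (K : fieldType) (V : lmodType K)
    (S : bialgType K) (i : V -> S) : Prop :=
  [/\ associative (@bmul K S), commutative (@bmul K S), linear i,
      forall v, primitive (i v) &
      forall (A : comAlgType K) (f : V -> A), linear f ->
        exists! g : S -> A,
          [/\ linear g, forall u v, g (bmul u v) = g u * g v, g bone = 1 &
              forall v, g (i v) = f v]].

Definition connected (K : fieldType) (U : bialgType K) : Prop :=
  exists (V : lmodType K) (S : bialgType K) (i : V -> S),
    is_symmetric_bialgebra i /\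
    exists (f : S -> U) (g : U -> S),
      [/\ coalg_morph f, coalg_morph g, cancel f g, cancel g f & f bone = bone].

Section TripleOfBialgebra.
Variables (K : fieldType) (U : bialgType K).

(* The condition that [f] is an element of g(U). *)
Definition in_coder (f : U -> U) : Prop :=
  linear f /\
  forall u, comul (f u) = tmap f id (comul u) + tmap id f (comul u).

Let id_linear : linear (@id U). Proof. by []. Qed.
Let tcoder (f : U -> U) t := tmap f id t + tmap id f t.

Let tcoder_comb a f g h t : (forall u, h u = a *: f u + g u) ->
  tcoder h t = a *: tcoder f t + tcoder g t.
Proof.
move=> E; rewrite /tcoder scalerDr addrACA; congr (_ + _).
  by apply: tlift_comb => u v; rewrite E ptensor_l.
by apply: tlift_comb => u v; rewrite E ptensor_r.
Qed.

Lemma in_coderL a f g : in_coder f -> in_coder g -> in_coder (a *: f + g).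
Proof.
move=> [lf Df] [lg Dg]; split=> [b x y|u] /=.
  rewrite /= -![(a *: f + g) _]/(a *: f _ + g _) lf lg !scalerDr !scalerA.
  by rewrite mulrC addrACA.
rewrite -![(a *: f + g) _]/(a *: f _ + g _) comul_linear Df Dg.
by rewrite -(@tcoder_comb a f g (a *: f + g)).
Qed.

Lemma in_coder0 : in_coder 0.
Proof.
split=> [a x y|u]; first by rewrite /= scaler0 addr0.
have E : tcoder 0 (comul u) = (-1) *: tcoder 0 (comul u) + tcoder 0 (comul u).
  by apply: (@tcoder_comb _ 0 0 0) => x; rewrite scaler0 addr0.
rewrite -[RHS]/(tcoder _ _) E scaleN1r addNr.
by have := comul_linear (-1) (0 : U) 0; rewrite scaler0 addr0 scaleN1r addNr.
Qed.

Definition coder_space : subspace (U -> U) := mk_subspace in_coder0 in_coderL.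
Definition coder := sp_type coder_space.
HB.instance Definition _ := GRing.Lmodule.on coder.

Definition coder_fun (f : coder) : U -> U := \val f.

Lemma coderP (f : coder) : in_coder (coder_fun f).
Proof. by have /mk_subspaceP := valP f. Qed.

Definition mk_coder f (Df : in_coder f) : coder :=
  exist _ f (introT (mk_subspaceP in_coder0 in_coderL f) Df).

Lemma coder_eq (f g : coder) : coder_fun f =1 coder_fun g -> f = g.
Proof. by move=> E; apply/val_inj/funext. Qed.

Lemma in_coder_comm (f g : coder) :
  in_coder (fun u => coder_fun f (coder_fun g u) - coder_fun g (coder_fun f u)).
Proof.
have [lf Df] := coderP f; have [lg Dg] := coderP g.
set F := coder_fun f in lf Df *; set G := coder_fun g in lg Dg *.
have lFG : linear (F \o G) by move=> a x y /=; rewrite lg lf.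
have lGF : linear (G \o F) by move=> a x y /=; rewrite lf lg.
have E (P Q : U -> U) : linear P -> linear Q ->
    (forall u, comul (P u) = tcoder P (comul u)) ->
    (forall u, comul (Q u) = tcoder Q (comul u)) ->
    forall u, comul (P (Q u)) = tcoder (P \o Q) (comul u)
      + (tmap P Q (comul u) + tmap Q P (comul u)).
  move=> lP lQ DP DQ u; rewrite DP DQ /tcoder.
  have D (h : tensor U U -> tensor U U) : linear h -> {morph h : x y / x + y}.
    by move=> lh x y; have := lh 1 x y; rewrite !scale1r.
  rewrite (D _ (tmap_linear lP id_linear)) (D _ (tmap_linear id_linear lP)).
  rewrite (tmap_comp _ lQ id_linear lP id_linear).
  rewrite (tmap_comp _ id_linear lQ lP id_linear).
  rewrite (tmap_comp _ lQ id_linear id_linear lP).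
  rewrite (tmap_comp _ id_linear lQ id_linear lP).
  have sumC (p q r s : tensor U U) : p + q + (r + s) = p + s + (q + r).
    by rewrite -!addrA; congr (_ + _); rewrite [s + _]addrC -addrA.
  exact: sumC.
split=> [a x y|u].
  by rewrite /= lg lf lf lg scalerBr opprD addrACA.
have DB (x y : U) : comul (x - y) = comul x - comul y.
  have := comul_linear (-1) y x.
  by rewrite !scaleN1r ![- _ + _]addrC.
rewrite DB !E // [tmap F G _ + _]addrC opprD addrACA subrr addr0.
rewrite addrC -scaleN1r; apply/esym/tcoder_comb => x /=.
by rewrite scaleN1r addrC.
Qed.

Definition coder_lie (f g : coder) : coder := mk_coder (in_coder_comm f g).

Let coder_lieE f g u : coder_fun (coder_lie f g) u =
  coder_fun f (coder_fun g u) - coder_fun g (coder_fun f u).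
Proof. by []. Qed.

Let coder_comb a (f g : coder) u :
  coder_fun (a *: f + g) u = a *: coder_fun f u + coder_fun g u.
Proof. by []. Qed.

Let coder_add (f g : coder) u :
  coder_fun (f + g) u = coder_fun f u + coder_fun g u.
Proof. by []. Qed.

Let coderB (f : coder) x y : coder_fun f (x - y) = coder_fun f x - coder_fun f y.
Proof.
have := (coderP f).1 (-1) y x; by rewrite !scaleN1r ![- _ + _]addrC.
Qed.

Let coder_lie_bilin : bilin coder_lie.
Proof.
split=> h a f g; apply: coder_eq => u; rewrite coder_comb !coder_lieE !coder_comb.
  by rewrite (coderP h).1 scalerBr opprD addrACA.
by rewrite (coderP h).1 scalerBr opprD addrACA.
Qed.

Let coder_lie_alt f : coder_lie f f = 0.
Proof. by apply: coder_eq => u; rewrite coder_lieE subrr. Qed.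

Let coder_lie_jacobi f g h : coder_lie f (coder_lie g h)
  + coder_lie g (coder_lie h f) + coder_lie h (coder_lie f g) = 0.
Proof.
apply: coder_eq => u; rewrite !coder_add !coder_lieE !coderB.
rewrite -[RHS]/(0 : U) !opprB !addrA addrNK addrNK.
set a := coder_fun f _; set b := coder_fun f _; set k := coder_fun h _.
set d := coder_fun g _.
have -> : a - b + k - d + b = a + k - d by rewrite addrAC [_ + k + b]addrAC addrNK.
have -> : a + k - d - k = a - d by rewrite addrAC addrK.
by rewrite addrNK subrr.
Qed.

HB.instance Definition _ := isLieAlgebra.Build K coder
  coder_lie_bilin coder_lie_alt coder_lie_jacobi.

Definition in_s_coder (f : coder) : Prop := coder_fun f bone = 0.

Lemma in_s_coder0 : in_s_coder 0. Proof. by []. Qed.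

Lemma in_s_coderL a f g : in_s_coder f -> in_s_coder g -> in_s_coder (a *: f + g).
Proof. by rewrite /in_s_coder coder_comb => -> ->; rewrite scaler0 addr0. Qed.

Lemma s_coder_lie : {in mk_subspace in_s_coder0 in_s_coderL &, forall f g,
  lie f g \in mk_subspace in_s_coder0 in_s_coderL}.
Proof.
have coder0 (f : coder) : coder_fun f 0 = 0.
  by rewrite -(subrr (0 : U)) coderB !subrr.
move=> f g /mk_subspaceP sf /mk_subspaceP sg; apply/mk_subspaceP.
by rewrite /in_s_coder [lie f g]/(coder_lie f g) coder_lieE sf sg !coder0 subrr.
Qed.

Definition s_coder : lie_subalg coder := LieSubalg s_coder_lie.

Lemma s_coderP f : reflect (coder_fun f bone = 0) (f \in s_coder).
Proof. exact: mk_subspaceP. Qed.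

(* c(U), where R_a = (x |-> x a). *)
Definition in_c_coder (f : coder) : Prop :=
  exists a : U, primitive a /\ forall x, coder_fun f x = bmul x a.

Lemma primitiveL a (x y : U) :
  primitive x -> primitive y -> primitive (a *: x + y).
Proof.
rewrite /primitive comul_linear => -> ->.
by rewrite ptensor_l ptensor_r scalerDr addrACA.
Qed.

Lemma primitive0 : primitive (0 : U).
Proof.
have := comul_linear (-1) (0 : U) 0; rewrite scaler0 addr0 scaleN1r addNr.
have := ptensor_l (bone : U) (-1) (0 : U) 0.
rewrite scaler0 addr0 scaleN1r addNr.
have := ptensor_r (bone : U) (-1) (0 : U) 0.
rewrite scaler0 addr0 scaleN1r addNr /primitive.
by move=> -> -> ->; rewrite addr0.
Qed.

Lemma bmulr0 (x : U) : bmul x 0 = 0.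
Proof.
by have := bmul_bilin.2 x (-1) 0 0; rewrite scaler0 addr0 scaleN1r addNr.
Qed.

Lemma in_c_coder0 : in_c_coder 0.
Proof. by exists 0; split=> [|x]; [exact: primitive0|rewrite bmulr0]. Qed.

Lemma in_c_coderL a f g : in_c_coder f -> in_c_coder g -> in_c_coder (a *: f + g).
Proof.
move=> [x [px Ef]] [y [py Eg]]; exists (a *: x + y); split.
  exact: primitiveL.
by move=> u; rewrite coder_comb Ef Eg bmul_bilin.2.
Qed.

Definition c_coder : subspace coder := mk_subspace in_c_coder0 in_c_coderL.

Lemma c_coderP f : reflect (in_c_coder f) (f \in c_coder).
Proof. exact: mk_subspaceP. Qed.

Lemma tmul_ptensor t (c d : U) :
  tmul (@bmul K U) t (c ⊗ d) = tmap (fun x => bmul x c) (fun x => bmul x d) t.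
Proof.
apply: eq_tlift => a b; rewrite tliftE //; split=> [x e u v|x e u v].
  by rewrite bmul_bilin.2 ptensor_l.
by rewrite bmul_bilin.2 ptensor_r.
Qed.

Lemma tmulDr (s t t' : tensor U U) :
  tmul (@bmul K U) s (t + t') = tmul (@bmul K U) s t + tmul (@bmul K U) s t'.
Proof.
rewrite -[tmul _ s t]scale1r; apply: tlift_comb => a b.
rewrite -[t in LHS]scale1r; apply: tlift_linear.
split=> [x e u v|x e u v].
  by rewrite bmul_bilin.2 ptensor_l.
by rewrite bmul_bilin.2 ptensor_r.
Qed.

Lemma in_coderR (a : U) : primitive a -> in_coder (fun x => bmul x a).
Proof.
move=> pa; split=> [b x y|x]; first by rewrite bmul_bilin.1.
rewrite comulM pa tmulDr !tmul_ptensor; congr (_ + _).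
  by apply: eq_tlift => u v; rewrite bmul1r.
by apply: eq_tlift => u v; rewrite bmul1r.
Qed.

Definition coderR (a : U) (pa : primitive a) : coder := mk_coder (in_coderR pa).

Lemma primitive_at1 (f : coder) : primitive (coder_fun f bone).
Proof.
have [lf Df] := coderP f.
by rewrite /primitive Df comul1 (tmapE lf id_linear) (tmapE id_linear lf).
Qed.

Lemma coder_cover (f : coder) :
  exists s c, [/\ s \in s_coder, c \in c_coder & f = s + c].
Proof.
pose c := coderR (primitive_at1 f).
exists (f - c), c; split; last by rewrite addrNK.
  apply/s_coderP; rewrite -[LHS]/(coder_fun f bone - bmul bone _).
  by rewrite bmul1l subrr.
by apply/c_coderP; exists (coder_fun f bone); split=> //; exact: primitive_at1.
Qed.

Lemma coder_direct (f : coder) : f \in s_coder -> f \in c_coder -> f = 0.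
Proof.
move=> /s_coderP f1 /c_coderP[a [_ E]]; apply: coder_eq => x.
by rewrite E; have := E bone; rewrite f1 bmul1l => <-; rewrite bmulr0.
Qed.

(* The triple T(U) = (g(U), s(U), c(U)). *)
Definition triple_of : triple K := Triple coder_cover coder_direct.
End TripleOfBialgebra.

Definition at1 (K : fieldType) (U : bialgType K) (f : triple_of U) : U :=
  coder_fun f bone.

(* Main.v *)
Require Import Defs.
From HB Require Import structures.
From mathcomp Require Import all_boot all_algebra.
From mathcomp Require Import finmap monalg.
From mathcomp Require Import boolp functions.

Set Implicit Arguments.
Unset Strict Implicit.
Unset Printing Implicit Defensive.

Import GRing.Theory.
Local Open Scope ring_scope.

(** Think of a Lie group [G] with Lie algebra [g] and a subgroup [S] with Lie
    algebra [s]. Since [g = s + c], the map [a |-> exp(a) S] is a formal chart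
    [c -> G/S], so the distributions at the base point of [G/S] form the
    symmetric coalgebra [Sym c], and [g] acts on them by coderivations: the
    fundamental vector fields. The bialgebra of the triple is [Sym c] with the
    product of the formal loop [G/S], [x . exp(a) S = exp(a) x]; that is, the
    power [a^n] multiplies on the right as the [n]-th iterate of the action of
    [a]. Right monoalternativity is then [exp(n a) = exp(a)^n].

    A linear map on [Sym c] is a symmetric multilinear function of finite
    sequences of vectors of [c], and such functions are the Taylor coefficients
    of formal power series on [c]. The computations are carried out on functions
    [seq c -> W]: [conv] is the product of series, [der] a partial derivative,
    [dder] the derivative along a vector field, [deg] the Euler operator. All
    exponentials are solutions of linear equations [deg F = a . F + X], where
    [a] is the generic vector; in characteristic zero such an equation has one
    solution ([eq_unique], [affine_unique]), and every identity between
    exponentials is proved by checking that both sides solve the same equation.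

    Write [B = exp(ad a)] and [Theta = (exp(ad a) - 1) / ad a]. The fundamental
    field [X] of [x] in [g] solves [x = Theta X + B sigma] with [sigma] in [s];
    it exists because the component of [B^-1 Theta] along [c] is an invertible
    series with constant term the identity. The Maurer-Cartan equation of
    [Theta] yields the bracket of two fundamental fields ([fund_comm]), and the
    action of [c] on powers is [a . a^n = a^(n+1)] ([fund_var]).

    For any representation [rho] and any vector [w] killed by [s], the same
    identities show that [exp(rho a) w] is equivariant ([dder_exprho]). Applied
    to [w = 1] in a bialgebra [U'], this gives an equivariant coalgebra map
    [Sym c -> U']. It is multiplicative because right monoalternativity forces
    [y . a^n] to be the [n]-th iterate of [R_a] at [y] ([psi_mulr]), and it is
    the only candidate since [c] generates; this is the universal property.

    Finally, a morphism of triples that is bijective on [c] induces an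
    isomorphism of the reduced triples ([c_iso_equiv]) and one of the bialgebras
    ([c_iso_bialg_iso]). The maps [tau -> T(U_tau)], [tau_inn -> tau],
    [tau_inn -> tau_red] and [T(U) -> T(U')], for [U] and [U'] isomorphic, are
    of this kind, and equivalence of triples thus becomes isomorphism of
    bialgebras. *)

(** * Unbundled linear and bilinear maps *)

Section LinearFacts.
Variables (K : fieldType) (U W : lmodType K) (f : U -> W).
Hypothesis lf : linear f.
Lemma linD x y : f (x + y) = f x + f y.
Proof. by have := lf 1 x y; rewrite !scale1r. Qed.
Lemma lin0 : f 0 = 0.
Proof. by apply: (@addrI _ (f 0)); rewrite -linD !addr0. Qed.
Lemma linZ a x : f (a *: x) = a *: f x.
Proof. by rewrite -[a *: x]addr0 lf lin0 addr0. Qed.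
Lemma linN x : f (- x) = - f x.
Proof. by rewrite -scaleN1r linZ scaleN1r. Qed.
Lemma linB x y : f (x - y) = f x - f y.
Proof. by rewrite linD linN. Qed.
End LinearFacts.

Section BilinearFacts.
Variables (K : fieldType) (U V W : lmodType K) (op : U -> V -> W).
Hypothesis bop : bilin op.
Lemma bilDl x y v : op (x + y) v = op x v + op y v.
Proof. exact: (linD (bop.1 v)). Qed.
Lemma bilDr u x y : op u (x + y) = op u x + op u y.
Proof. exact: (linD (bop.2 u)). Qed.
Lemma bilZl a x v : op (a *: x) v = a *: op x v.
Proof. exact: (linZ (bop.1 v)). Qed.
Lemma bilZr a u x : op u (a *: x) = a *: op u x.
Proof. exact: (linZ (bop.2 u)). Qed.
Lemma bil0l v : op 0 v = 0. Proof. exact: (lin0 (bop.1 v)). Qed.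
Lemma bil0r u : op u 0 = 0. Proof. exact: (lin0 (bop.2 u)). Qed.
Lemma bilNl x v : op (- x) v = - op x v. Proof. exact: (linN (bop.1 v)). Qed.
Lemma bilNr u x : op u (- x) = - op u x. Proof. exact: (linN (bop.2 u)). Qed.
End BilinearFacts.

(** * The space of linear maps *)

Section LinSpace.
Variables (K : fieldType) (U W : lmodType K).

Lemma lin_space0 : linear (0 : U -> W).
Proof. by move=> a x y; rewrite /= scaler0 addr0. Qed.

Lemma lin_spaceL a (f g : U -> W) : linear f -> linear g -> linear (a *: f + g).
Proof.
move=> lf lg b x y; rewrite -![(a *: f + g) _]/(a *: f _ + g _) lf lg.
by rewrite !scalerDr !scalerA [a * b]mulrC addrACA.
Qed.

Definition Lin := sp_type (mk_subspace lin_space0 lin_spaceL).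
HB.instance Definition _ := GRing.Lmodule.on Lin.

Definition ap (f : Lin) : U -> W := \val f.
Definition mkLin (f : U -> W) (lf : linear f) : Lin :=
  exist _ f (introT (mk_subspaceP lin_space0 lin_spaceL f) lf).

Lemma apP (f : Lin) : linear (ap f).
Proof. by have /mk_subspaceP := valP f. Qed.

Lemma Lin_ext (f g : Lin) : ap f =1 ap g -> f = g.
Proof. by move=> E; apply/val_inj/funext. Qed.

Lemma apE f lf x : ap (@mkLin f lf) x = f x. Proof. by []. Qed.
Lemma apD f g x : ap (f + g) x = ap f x + ap g x. Proof. by []. Qed.
Lemma apZ a f x : ap (a *: f) x = a *: ap f x. Proof. by []. Qed.
Lemma bilin_ap : bilin ap.
Proof. by split=> [v a f g|f]; [|exact: apP]. Qed.
End LinSpace.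

Section LinOps.
Variables (K : fieldType).

Lemma lin_id (U : lmodType K) : linear (@id U). Proof. by []. Qed.
Definition idL (U : lmodType K) : Lin U U := mkLin (@lin_id U).

Lemma comp_lin (U V W : lmodType K) (g : V -> W) (f : U -> V) :
  linear g -> linear f -> linear (g \o f).
Proof. by move=> lg lf a x y /=; rewrite lf lg. Qed.

Definition cmp (U V W : lmodType K) (g : Lin V W) (f : Lin U V) : Lin U W :=
  mkLin (comp_lin (apP g) (apP f)).

Lemma bilin_cmp (U V W : lmodType K) : bilin (@cmp U V W).
Proof.
split=> [f a g h|f a g h]; apply: Lin_ext => x //.
by rewrite apE /= apD apZ apP.
Qed.

Lemma cmpE (U V W : lmodType K) (g : Lin V W) (f : Lin U V) x :
  ap (cmp g f) x = ap g (ap f x).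
Proof. by []. Qed.
Lemma cmpA (U V W X : lmodType K) (h : Lin W X) (g : Lin V W) (f : Lin U V) :
  cmp (cmp h g) f = cmp h (cmp g f).
Proof. exact: Lin_ext. Qed.
Lemma cmp1l (U V : lmodType K) (f : Lin U V) : cmp (idL V) f = f.
Proof. exact: Lin_ext. Qed.
Lemma cmp1r (U V : lmodType K) (f : Lin U V) : cmp f (idL U) = f.
Proof. exact: Lin_ext. Qed.

Lemma bilin_mkLin (U V W : lmodType K) (op : U -> V -> W) (b : bilin op) :
  linear (fun u => mkLin (b.2 u)).
Proof. by move=> a x y; apply: Lin_ext => v; rewrite apD apZ !apE b.1. Qed.

Definition cur (U V W : lmodType K) (op : U -> V -> W) (b : bilin op) u : Lin V W
  := mkLin (b.2 u).

End LinOps.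

(** * Formal power series as functions of sequences *)

Section Series.
Variables (K : fieldType) (V : lmodType K).

(** The value of [F : seq V -> W] at [[:: v1; ..; vn]] is the mixed derivative
    at [0], along [v1], .., [vn], of a formal power series on [V]; so prepending
    a vector to the argument differentiates the series. *)
Definition der (T : Type) (b : V) (F : seq V -> T) : seq V -> T :=
  fun s => F (b :: s).

Definition const (W : lmodType K) (w : W) : seq V -> W :=
  fun s => if s is [::] then w else 0.

(** The product of two series. Unfolding the recursion, it is the sum of
    [op (F p) (G q)] over all ways to split [s] into two complementary
    subsequences [p] and [q]; the recursive form is the product rule. *)
Fixpoint conv (A B : Type) (W : lmodType K) (op : A -> B -> W)
    (F : seq V -> A) (G : seq V -> B) (s : seq V) : W :=
  if s is b :: s' then conv op (der b F) G s' + conv op F (der b G) s'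
  else op (F [::]) (G [::]).

(** The sum over the positions [i] of [Phi s_i] at [s] without its [i]-th entry:
    the value of the family [Phi] on the generic vector. *)
Fixpoint ins (W : lmodType K) (Phi : V -> seq V -> W) (s : seq V) : W :=
  if s is b :: s' then Phi b s' + ins (fun v => der b (Phi v)) s' else 0.

(** The derivative of [F] along the vector field [xi], that is, the sum of
    [F (xi p :: q)] over the splittings of [s] into [p] and [q] when [F] is
    symmetric. *)
Fixpoint dder (W : lmodType K) (xi : seq V -> V) (F : seq V -> W) (s : seq V) : W :=
  if s is b :: s' then dder (der b xi) F s' + dder xi (der b F) s'
  else F [:: xi [::]].

(** The operator [op] of the generic vector applied to [F]. *)
Definition act (A : Type) (W : lmodType K) (op : V -> A -> W) (F : seq V -> A) :=
  ins (fun v s => op v (F s)).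

Lemma addE (T : Type) (W : lmodType K) (F G : T -> W) s : (F + G) s = F s + G s.
Proof. by []. Qed.
Lemma scaleE (T : Type) (W : lmodType K) a (F : T -> W) s : (a *: F) s = a *: F s.
Proof. by []. Qed.
Lemma oppE (T : Type) (W : lmodType K) (F : T -> W) s : (- F) s = - F s.
Proof. by []. Qed.

Lemma subE (T : Type) (W : lmodType K) (F G : T -> W) s : (F - G) s = F s - G s.
Proof. by []. Qed.

Lemma derL (W : lmodType K) b a (F G : seq V -> W) :
  der b (a *: F + G) = a *: der b F + der b G.
Proof. by []. Qed.

Lemma derD (W : lmodType K) b (F G : seq V -> W) s :
  der b (F + G) s = der b F s + der b G s.
Proof. by []. Qed.

Lemma der_const (W : lmodType K) b (w : W) : der b (const w) = 0.
Proof. by []. Qed.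

Lemma der_conv (A B : Type) (W : lmodType K) (op : A -> B -> W) b F G :
  der b (conv op F G) = conv op (der b F) G + conv op F (der b G).
Proof. by []. Qed.

Lemma der_dder (W : lmodType K) b xi (F : seq V -> W) :
  der b (dder xi F) = dder (der b xi) F + dder xi (der b F).
Proof. by []. Qed.

Lemma der_ins (W : lmodType K) b (Phi : V -> seq V -> W) :
  der b (ins Phi) = Phi b + ins (fun v => der b (Phi v)).
Proof. by []. Qed.

Lemma der_act (A : Type) (W : lmodType K) (op : V -> A -> W) b (F : seq V -> A) :
  der b (act op F) = (op b \o F) + act op (der b F).
Proof. by []. Qed.

Section Naturality.
Variables (W W' : lmodType K) (f : W -> W').
Hypothesis lf : linear f.

Lemma lin_conv (A B : Type) (op : A -> B -> W) F G s :
  f (conv op F G s) = conv (fun x y => f (op x y)) F G s.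
Proof. by elim: s F G => [|b s IH] F G //=; rewrite (linD lf) !IH. Qed.

Lemma lin_ins Phi s : f (ins Phi s) = ins (fun v s => f (Phi v s)) s.
Proof. by elim: s Phi => [|b s IH] Phi /=; rewrite ?(linD lf) ?IH // (lin0 lf). Qed.

Lemma lin_dder xi F s : f (dder xi F s) = dder xi (f \o F) s.
Proof. by elim: s xi F => [|b s IH] xi F //=; rewrite (linD lf) !IH. Qed.
End Naturality.

Lemma conv_comp (A B A' B' : Type) (W : lmodType K) (op : A -> B -> W)
   (f : A' -> A) (g : B' -> B) F G s :
  conv op (f \o F) (g \o G) s = conv (fun x y => op (f x) (g y)) F G s.
Proof.
elim: s F G => [|b s IH] F G //=.
by rewrite -(IH (der b F) G) -(IH F (der b G)).
Qed.

Lemma conv_eqop (A B : Type) (W : lmodType K) (op op' : A -> B -> W) F G s :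
  (forall x y, op x y = op' x y) -> conv op F G s = conv op' F G s.
Proof. by move=> E; elim: s F G => [|b s IH] F G /=; rewrite ?E // !IH. Qed.

Lemma convC (A B : Type) (W : lmodType K) (op : A -> B -> W) F G s :
  conv op F G s = conv (fun y x => op x y) G F s.
Proof. by elim: s F G => [|b s IH] F G //=; rewrite addrC !IH. Qed.

Lemma convLl (A W : lmodType K) (B : Type) (op : A -> B -> W) a F F' G s :
  (forall y, linear (op^~ y)) ->
  conv op (a *: F + F') G s = a *: conv op F G s + conv op F' G s.
Proof.
move=> lop; elim: s F F' G => [|b s IH] F F' G /=; first exact: lop.
by rewrite derL !IH scalerDr addrACA.
Qed.

Lemma convLr (A : Type) (B W : lmodType K) (op : A -> B -> W) a F G G' s :
  (forall x, linear (op x)) ->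
  conv op F (a *: G + G') s = a *: conv op F G s + conv op F G' s.
Proof.
move=> lop; elim: s F G G' => [|b s IH] F G G' /=; first exact: lop.
by rewrite derL !IH scalerDr addrACA.
Qed.

Lemma convDl1 (A W : lmodType K) (B : Type) (op : A -> B -> W) F F' G s :
  (forall y, linear (op^~ y)) ->
  conv op (F + F') G s = conv op F G s + conv op F' G s.
Proof. by move=> lop; have := convLl 1 F F' G s lop; rewrite !scale1r. Qed.

Lemma convDr1 (A : Type) (B W : lmodType K) (op : A -> B -> W) F G G' s :
  (forall x, linear (op x)) ->
  conv op F (G + G') s = conv op F G s + conv op F G' s.
Proof. by move=> lop; have := convLr 1 F G G' s lop; rewrite !scale1r. Qed.

Lemma conv_vanish (A B : Type) (W : lmodType K) (op : A -> B -> W) F G s :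
  (forall t u, op (F t) (G u) = 0) -> conv op F G s = 0.
Proof.
elim: s F G => [|b s IH] F G E; first exact: E.
by rewrite /= !IH ?addr0 // => t u; exact: E.
Qed.

Section ConvLinear.
Variables (A B W : lmodType K) (op : A -> B -> W).
Hypothesis bop : bilin op.
Lemma bilin_conv s : bilin (fun F G => conv op F G s).
Proof. by split=> [G a F F'|F a G G']; [exact/convLl/bop.1|exact/convLr/bop.2]. Qed.

Lemma convDl F F' G s : conv op (F + F') G s = conv op F G s + conv op F' G s.
Proof. exact: (bilDl (bilin_conv s)). Qed.
Lemma convDr F G G' s : conv op F (G + G') s = conv op F G s + conv op F G' s.
Proof. exact: (bilDr (bilin_conv s)). Qed.
Lemma convZl a F G s : conv op (a *: F) G s = a *: conv op F G s.
Proof. exact: (bilZl (bilin_conv s)). Qed.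
Lemma convZr a F G s : conv op F (a *: G) s = a *: conv op F G s.
Proof. exact: (bilZr (bilin_conv s)). Qed.
Lemma conv0l G s : conv op 0 G s = 0.
Proof. exact: (bil0l (bilin_conv s)). Qed.
Lemma conv0r F s : conv op F 0 s = 0.
Proof. exact: (bil0r (bilin_conv s)). Qed.
Lemma convNl F G s : conv op (- F) G s = - conv op F G s.
Proof. exact: (bilNl (bilin_conv s)). Qed.
Lemma convNr F G s : conv op F (- G) s = - conv op F G s.
Proof. exact: (bilNr (bilin_conv s)). Qed.

Lemma conv_constl w G s : conv op (const w) G s = op w (G s).
Proof.
by elim: s G => [|b s IH] G //=; rewrite der_const conv0l add0r IH.
Qed.
Lemma conv_constr w F s : conv op F (const w) s = op (F s) w.
Proof.
by elim: s F => [|b s IH] F //=; rewrite der_const conv0r addr0 IH.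
Qed.
End ConvLinear.

Lemma convA (A B C : Type) (AB BC W : lmodType K) (op1 : AB -> C -> W) (op2 : A -> B -> AB)
    (op3 : A -> BC -> W) (op4 : B -> C -> BC) F G H s :
  (forall z, linear (op1^~ z)) -> (forall x, linear (op3 x)) ->
  (forall x y z, op1 (op2 x y) z = op3 x (op4 y z)) ->
  conv op1 (conv op2 F G) H s = conv op3 F (conv op4 G H) s.
Proof.
move=> l1 l3 E; elim: s F G H => [|b s IH] F G H /=; first exact: E.
by rewrite !der_conv convDl1 // convDr1 // !IH !addrA.
Qed.

Lemma insD (W : lmodType K) (Phi Psi : V -> seq V -> W) s :
  ins (fun v s => Phi v s + Psi v s) s = ins Phi s + ins Psi s.
Proof.
elim: s Phi Psi => [|b s IH] Phi Psi /=; first by rewrite addr0.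
by rewrite addrACA -(IH (fun v => der b (Phi v))).
Qed.

Lemma eq_ins (W : lmodType K) (Phi Psi : V -> seq V -> W) s :
  (forall v t, size s = (size t).+1 -> Phi v t = Psi v t) -> ins Phi s = ins Psi s.
Proof.
elim: s Phi Psi => [|b s IH] Phi Psi E //=.
congr (_ + _); first exact: E.
by apply: IH => v t Et; rewrite /der E //= Et.
Qed.

Lemma insZ (W : lmodType K) a (Phi : V -> seq V -> W) s :
  ins (fun v s => a *: Phi v s) s = a *: ins Phi s.
Proof.
elim: s Phi => [|b s IH] Phi /=; first by rewrite scaler0.
by rewrite scalerDr -(IH (fun v => der b (Phi v))).
Qed.

Lemma ins0 (W : lmodType K) s : ins (fun v s => 0 : W) s = 0.
Proof. by elim: s => [|b s IH] //=; rewrite add0r; exact: IH. Qed.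

Lemma eq_act (A : Type) (W : lmodType K) (op : V -> A -> W) F G s :
  (forall t, size s = (size t).+1 -> F t = G t) -> act op F s = act op G s.
Proof. by move=> E; apply: eq_ins => v t Et; rewrite E. Qed.

Lemma actL (A W : lmodType K) (op : V -> A -> W) a F G s :
  (forall v, linear (op v)) ->
  act op (a *: F + G) s = a *: act op F s + act op G s.
Proof.
move=> lop; rewrite -insZ -insD; apply: eq_ins => v t _; exact: lop.
Qed.

Lemma actD (A W : lmodType K) (op : V -> A -> W) F G s :
  (forall v, linear (op v)) -> act op (F + G) s = act op F s + act op G s.
Proof. by move=> lop; have := actL 1 F G s lop; rewrite !scale1r. Qed.

Lemma actZ (A W : lmodType K) (op : V -> A -> W) a F s :
  (forall v, linear (op v)) -> act op (a *: F) s = a *: act op F s.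
Proof.
by move=> lop; rewrite -insZ; apply: eq_ins => v t _; rewrite -(linZ (lop v)).
Qed.

Lemma actN (A W : lmodType K) (op : V -> A -> W) F s :
  (forall v, linear (op v)) -> act op (- F) s = - act op F s.
Proof.
move=> lop; rewrite -scaleN1r -insZ; apply: eq_ins => v t _.
by rewrite scaleN1r -(linN (lop v)).
Qed.

(** If every [op3 v] is a derivation of the pairing [op], then so is the operator
    of the generic vector. *)
Lemma act_conv (A B W : lmodType K) (op : A -> B -> W) (op1 : V -> A -> A)
    (op2 : V -> B -> B) (op3 : V -> W -> W) F G s :
  bilin op -> (forall v, linear (op3 v)) ->
  (forall v x y, op3 v (op x y) = op (op1 v x) y + op x (op2 v y)) ->
  act op3 (conv op F G) s = conv op (act op1 F) G s + conv op F (act op2 G) s.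
Proof.
move=> bop l3 E; elim: s F G => [|b s IH] F G.
  by rewrite /= /act /= (bil0l bop) (bil0r bop) addr0.
rewrite -[LHS]/(der b (act op3 _) s) der_act der_conv addE /=.
rewrite lin_conv // (conv_eqop _ _ _ (E b)).
rewrite actD // !IH !der_act !convDl // !convDr //.
have -> : conv (fun x y => op (op1 b x) y + op x (op2 b y)) F G s =
   conv op (op1 b \o F) G s + conv op F (op2 b \o G) s.
  rewrite (conv_comp op (op1 b) id) (conv_comp op id (op2 b)).
  by move: F G; elim: s {IH} => [|c s IH] F G //=; rewrite !IH addrACA.
set x1 := conv _ _ _ _; set x2 := conv _ _ _ _; set x3 := conv _ _ _ _.
set x4 := conv _ _ _ _; set x5 := conv _ _ _ _; set x6 := conv _ _ _ _.
rewrite -!addrA; congr (_ + _); rewrite addrCA; congr (_ + _).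
by rewrite [x5 + (x4 + _)]addrCA [x5 + (x2 + _)]addrCA addrCA.
Qed.

(** An operator of the generic vector passes through a balanced pairing. *)
Lemma conv_act (A B W : lmodType K) (op : A -> B -> W) (op1 : V -> A -> A)
    (op2 : V -> B -> B) F G s :
  bilin op -> (forall v x y, op x (op2 v y) = op (op1 v x) y) ->
  conv op F (act op2 G) s = conv op (act op1 F) G s.
Proof.
move=> bop E; elim: s F G => [|b s IH] F G.
  by rewrite /= /act /= (bil0l bop) (bil0r bop).
rewrite /= !der_act convDl // convDr // IH addrCA -IH -!addrA.
congr (_ + (_ + _)); last exact: IH.
by rewrite (conv_comp op id (op2 b)) (conv_comp op (op1 b) id); exact: conv_eqop.
Qed.

(** The Euler operator: [F] homogeneous of degree [n] is multiplied by [n]. *)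
Definition deg (W : lmodType K) (F : seq V -> W) : seq V -> W :=
  fun s => (size s)%:R *: F s.

Lemma der_deg (W : lmodType K) b (F : seq V -> W) :
  der b (deg F) = der b F + deg (der b F).
Proof. by apply/funext => s; rewrite addE /der /deg /= -natr1 scalerDl scale1r addrC. Qed.

Lemma deg_conv (A B W : lmodType K) (op : A -> B -> W) F G s : bilin op ->
  deg (conv op F G) s = conv op (deg F) G s + conv op F (deg G) s.
Proof.
move=> bop; elim: s F G => [|b s IH] F G.
  by rewrite /deg /= !scale0r (bil0l bop) (bil0r bop) addr0.
rewrite -[LHS]/(der b (deg _) s) der_deg der_conv addE.
have -> : deg (conv op (der b F) G + conv op F (der b G)) s =
  deg (conv op (der b F) G) s + deg (conv op F (der b G)) s.
  by rewrite /deg addE scalerDr.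
rewrite !IH /= !der_deg convDl // convDr // addE.
set x1 := conv _ _ _ _; set x2 := conv _ _ _ _; set x3 := conv _ _ _ _.
set x4 := conv _ _ _ _; set x5 := conv _ _ _ _; set x6 := conv _ _ _ _.
rewrite -!addrA; congr (_ + _).
rewrite addrCA; congr (_ + _).
by rewrite [x5 + (x4 + _)]addrCA [x5 + (x2 + _)]addrCA [in RHS]addrCA.
Qed.

(** * First-order linear equations for series *)

Section Equation.
Hypothesis charK0 : [pchar K] =i pred0.

Lemma natK_neq0 n : (n.+1%:R : K) != 0.
Proof. by rewrite ((pcharf0P K).1 charK0). Qed.

Variables (W : lmodType K) (op : V -> W -> W).

(** The equation gives the values on sequences of size [n + 1] in terms of those
    on sequences of size [n], because [n + 1 + k] is invertible. *)
Lemma eq_unique k F G : F [::] = G [::] ->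
  (forall b s, ((size s).+1 + k)%:R *: F (b :: s) = act op F (b :: s)) ->
  (forall b s, ((size s).+1 + k)%:R *: G (b :: s) = act op G (b :: s)) ->
  F = G.
Proof.
move=> E0 EF EG; apply/funext => s.
have [n] := ubnP (size s); elim: n s => // n IH [|b s] //= /ltnSE sn.
apply: (scalerI (natK_neq0 (size s + k))); rewrite -addSn EF EG.
by apply: eq_act => t [Et]; apply: IH; rewrite -Et.
Qed.

Lemma deg_unique F G : F [::] = G [::] ->
  (forall s, deg F s = act op F s) -> (forall s, deg G s = act op G s) -> F = G.
Proof.
move=> E0 EF EG; apply: (@eq_unique 0) => // b s; rewrite addn0.
  exact: (EF (b :: s)).
exact: (EG (b :: s)).
Qed.

Variable k : nat.

(** Each step consumes one entry, so the [n]-th approximation is correct on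
    sequences of size [n]. *)
Fixpoint sol_trunc (w : W) (n : nat) : seq V -> W :=
  if n is n'.+1 then fun s => (n + k)%:R^-1 *: act op (sol_trunc w n') s
  else const w.

Definition sol w s := sol_trunc w (size s) s.

Lemma solE w b s :
  ((size s).+1 + k)%:R *: sol w (b :: s) = act op (sol w) (b :: s).
Proof.
rewrite {1}/sol [sol_trunc _ _]/= scalerA addSn divff ?natK_neq0 // scale1r.
by apply: eq_act => t [Et]; rewrite /sol Et.
Qed.

End Equation.

(** * Symmetric multilinear series *)

Section SymMultilinear.
Variable W : lmodType K.

(** These are the functions that factor through the symmetric algebra. *)
Definition sml (F : seq V -> W) : Prop :=
  (forall s1 s2 a x y, F (s1 ++ (a *: x + y) :: s2) =
      a *: F (s1 ++ x :: s2) + F (s1 ++ y :: s2)) /\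
  (forall s1 s2 x y, F (s1 ++ x :: y :: s2) = F (s1 ++ y :: x :: s2)).

Lemma sml_der b F : sml F -> sml (der b F).
Proof.
by move=> [Fl Fs]; split=> [s1 s2 a x y|s1 s2 x y];
  [have := Fl (b :: s1) s2 a x y|have := Fs (b :: s1) s2 x y].
Qed.

Lemma sml_derL F a x y : sml F -> der (a *: x + y) F = a *: der x F + der y F.
Proof. by move=> [Fl _]; apply/funext => s; exact: (Fl [::]). Qed.

Lemma sml_derC F x y : sml F -> der x (der y F) = der y (der x F).
Proof. by move=> [_ Fs]; apply/funext => s; exact: (Fs [::]). Qed.

Lemma sml_lin F : sml F -> linear (fun v => F [:: v]).
Proof. by move=> [Fl _] a x y; exact: (Fl [::]). Qed.

(** Adjacent swaps generate all permutations. With [x] and [y] the heads of the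
    two sequences, both are permutations of sequences that start with [x], [y]. *)
Lemma sml_perm F s t : sml F -> perm_eq s t -> F s = F t.
Proof.
have [n] := ubnP (size s); elim: n s t F => // n IH [|x s] t F /= /ltnSE sn smF st.
  by move: st; rewrite perm_sym => /perm_nilP ->.
have xt : x \in t by rewrite -(perm_mem st) mem_head.
case: t xt st => // y t xt st.
have [xy|xy] := eqVneq x y.
  by move: st; rewrite xy perm_cons => st; apply: (IH s t (der y F)) => //; exact: sml_der.
have {xt}xt : x \in t by move: xt; rewrite inE (negPf xy).
have tr := perm_to_rem xt; set r := rem x t in tr.
have sr : perm_eq s (y :: r).
  rewrite -(perm_cons x); apply: (perm_trans st).
  have := tr; rewrite -(perm_cons y) => /perm_trans; apply.
  by apply/permP => P /=; rewrite addnCA.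
have smx := sml_der x smF; have smy := sml_der y smF.
rewrite -[F (x :: s)]/(der x F s) (IH s (y :: r) _ sn smx sr).
rewrite -[RHS]/(der y F t) -[LHS]/(der y (der x F) r) sml_derC //.
rewrite -[LHS]/(der y F (x :: r)); apply: IH => //; last by rewrite perm_sym.
by move: sn; rewrite (perm_size sr).
Qed.

Lemma sml_const w : sml (const w).
Proof. by split=> [[|c s1] s2 a x y|[|c s1] s2 x y] //=; rewrite scaler0 addr0. Qed.

Lemma sml_lc a F G : sml F -> sml G -> sml (a *: F + G).
Proof.
move=> [Fl Fs] [Gl Gs]; split=> [s1 s2 b x y|s1 s2 x y]; rewrite !addE !scaleE.
  by rewrite Fl Gl !scalerDr !scalerA addrACA mulrC.
by rewrite Fs Gs.
Qed.

Lemma sml0 : sml 0.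
Proof. by split=> [s1 s2 a x y|s1 s2 x y] //=; rewrite scaler0 addr0. Qed.
Lemma smlD F G : sml F -> sml G -> sml (F + G).
Proof. by rewrite -[F]scale1r => sF sG; apply: sml_lc => //; rewrite -[F]scale1r. Qed.
Lemma smlZ a F : sml F -> sml (a *: F).
Proof. by move=> sF; rewrite -[_ *: _]addr0; apply: sml_lc => //; exact: sml0. Qed.
Lemma smlN F : sml F -> sml (- F).
Proof. by rewrite -scaleN1r; exact: smlZ. Qed.
End SymMultilinear.

Lemma sml_comp (W W' : lmodType K) (f : W -> W') F : linear f -> sml F -> sml (f \o F).
Proof.
by move=> lf [Fl Fs]; split=> s1 s2 => [a x y|x y] /=; [rewrite Fl lf|rewrite Fs].
Qed.

Lemma sml_conv (A B W : lmodType K) (op : A -> B -> W) F G :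
  bilin op -> sml F -> sml G -> sml (conv op F G).
Proof.
move=> bop sF sG; split=> [s1|s1].
  elim: s1 F G sF sG => [|c s1 IH] F G sF sG s2 a x y.
    rewrite /= !sml_derL // !(convDl, convDr) // convZl // convZr //.
    by rewrite scalerDr addrACA.
  by rewrite /= !IH // ?scalerDr 1?addrACA //; exact: sml_der.
elim: s1 F G sF sG => [|c s1 IH] F G sF sG s2 x y.
  rewrite /= (sml_derC y x sF) (sml_derC y x sG) addrACA -!addrA.
  by congr (_ + _); rewrite addrCA.
by rewrite /=; congr (_ + _); apply: IH => //; exact: sml_der.
Qed.

Lemma sml_act (A W : lmodType K) (op : V -> A -> W) F :
  bilin op -> sml F -> sml (act op F).
Proof.
move=> bop sF; split=> [s1|s1].
  elim: s1 F sF => [|c s1 IH] F sF s2 a x y.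
    rewrite -![act op F (_ ++ _)]/(der _ (act op F) s2) !der_act sml_derL //.
    rewrite !addE /= actD ?actZ //; try exact: bop.2.
    by rewrite (bilDl bop) (bilZl bop) scalerDr addrACA.
  rewrite /= -![act op F (_ :: _)]/(der _ (act op F) _) !der_act !addE /= sF.1 IH.
    by rewrite (bilDr bop) (bilZr bop) scalerDr addrACA.
  exact: sml_der.
elim: s1 F sF => [|c s1 IH] F sF s2 x y; last first.
  rewrite /= -![act op F (_ :: _)]/(der _ (act op F) _) !der_act !addE /= sF.2 IH //.
  exact: sml_der.
rewrite -![act op F (_ ++ _)]/(der _ (der _ (act op F)) s2) !der_act.
rewrite -![der _ (_ + _)]/(der _ _ + der _ _) !der_act sml_derC // !addrA.
by congr ((_ + _) _); rewrite addrC.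
Qed.

Lemma sml_size (W : lmodType K) (F : nat -> seq V -> W) :
  (forall n, sml (F n)) -> sml (fun s => F (size s) s).
Proof.
move=> sF; split=> [s1 s2 a x y|s1 s2 x y]; rewrite !size_cat /=.
  exact: (sF _).1.
exact: (sF _).2.
Qed.

Lemma sml_size0 (W : lmodType K) w (F : seq V -> W) :
  sml F -> sml (fun s => if s is [::] then w else F s).
Proof.
by move=> sF; split=> [[|c s1] s2 a x y|[|c s1] s2 x y] /=;
  [apply: (sF.1 [::])|apply: (sF.1 (c :: s1))|apply: (sF.2 [::])|apply: (sF.2 (c :: s1))].
Qed.

Lemma sml_sol (W : lmodType K) (op : V -> W -> W) k w :
   bilin op -> sml (sol op k w).
Proof.
move=> bop; apply: sml_size; elim=> [|n IH] /=; first exact: sml_const.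
by apply: smlZ; exact: sml_act.
Qed.

End Series.

(** * Inverses of operator series *)

Section Inverse.
Variables (K : fieldType) (V : lmodType K).

Lemma conv_eq (A B : Type) (W : lmodType K) (op : A -> B -> W)
    (F F' : seq V -> A) (G G' : seq V -> B) s :
  (forall t, (size t <= size s)%N -> F t = F' t) ->
  (forall t, (size t <= size s)%N -> G t = G' t) ->
  conv op F G s = conv op F' G' s.
Proof.
elim: s F F' G G' => [|b s IH] F F' G G' EF EG /=; first by rewrite EF ?EG.
by congr (_ + _); apply: IH => t ts; rewrite /der ?EF ?EG //= ltnW.
Qed.

(** A series without constant term raises the degree. *)
Lemma conv_eq_small (A B W : lmodType K) (op : A -> B -> W)
    (F : seq V -> A) (G G' : seq V -> B) s :
  bilin op -> F [::] = 0 ->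
  (forall t, (size t < size s)%N -> G t = G' t) ->
  conv op F G s = conv op F G' s.
Proof.
move=> bop; elim: s F G G' => [|b s IH] F G G' F0 EG /=; first by rewrite F0 !(bil0l bop).
congr (_ + _); first by apply: conv_eq => t ts; rewrite // EG.
by apply: IH => // t ts; rewrite /der EG.
Qed.

(** [F] without its constant term. *)
Definition aug (W : lmodType K) (F : seq V -> W) : seq V -> W :=
  fun s => if s is [::] then 0 else F s.

Lemma augE (W : lmodType K) (F : seq V -> W) : F = const (F [::]) + aug F.
Proof. by apply/funext => -[|b s]; rewrite addE /= ?addr0 ?add0r. Qed.

Variables (W : lmodType K) (F : seq V -> Lin W W).
Hypothesis F0 : F [::] = idL W.

(** Partial sums of the Neumann series of [1 + aug F]. *)
Fixpoint cinv_trunc n : seq V -> Lin W W :=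
  if n is n'.+1 then const (idL W) - conv (@cmp _ _ _ _) (aug F) (cinv_trunc n')
  else const (idL W).

Definition cinv s := cinv_trunc (size s) s.

Let bc := @bilin_cmp K W W W.

Lemma cinv_truncE n m s : (size s <= n)%N -> (size s <= m)%N ->
  cinv_trunc n s = cinv_trunc m s.
Proof.
have i0 k : cinv_trunc k [::] = idL W.
  case: k => [|k] //; transitivity (idL W - cmp 0 (cinv_trunc k [::])) => //.
  by rewrite (bil0l bc) subr0.
elim: n m s => [|n IH] [|m] [|b s] // sn sm; rewrite ?i0 //.
rewrite [LHS]/(_ - _) [RHS]/(_ - _); congr (_ - _).
by apply: conv_eq_small => // t ts; apply: IH; rewrite -ltnS (leq_trans ts).
Qed.

Lemma cinv_nil : cinv [::] = idL W. Proof. by []. Qed.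

Lemma cinv_r : conv (@cmp _ _ _ _) F cinv = const (idL W).
Proof.
apply/funext => s; rewrite [in LHS](augE F) F0 convDl // conv_constl //.
rewrite cmp1l.
case: s => [|b s]; first by rewrite /= (bil0l bc) addr0.
have -> : cinv (b :: s) = - conv (@cmp _ _ _ _) (aug F) (cinv_trunc (size s)) (b :: s).
  transitivity (0 - conv (@cmp _ _ _ _) (aug F) (cinv_trunc (size s)) (b :: s)) => //.
  exact: sub0r.
rewrite [RHS]/(0 : Lin W W) addrC; apply/eqP; rewrite subr_eq0; apply/eqP.
apply: conv_eq_small => // t ts; exact: cinv_truncE.
Qed.

Lemma sml_cinv : sml F -> sml cinv.
Proof.
move=> sF; apply: sml_size; elim=> [|n IH]; first exact: sml_const.
apply: smlD; first exact: sml_const.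
by apply: smlN; apply: sml_conv => //; exact: sml_size0.
Qed.

End Inverse.

(** In a monoid, a right inverse that itself has a right inverse is two-sided. *)
Lemma cinv_l (K : fieldType) (V W : lmodType K) (F : seq V -> Lin W W) :
  F [::] = idL W -> conv (@cmp _ _ _ _) (cinv F) F = const (idL W).
Proof.
move=> F0; have bc := @bilin_cmp K W W W.
have J0 := cinv_r (cinv_nil F).
suff E : cinv (cinv F) = F by rewrite -[RHS]J0 E.
apply/funext => s.
have := convA F (cinv F) (cinv (cinv F)) s bc.1 bc.2 (@cmpA K _ _ _ _).
by rewrite cinv_r // J0 conv_constl // conv_constr // cmp1l cmp1r.
Qed.

(** * Derivatives along vector fields *)

Section Directional.
Variables (K : fieldType) (V : lmodType K).

Lemma dderDr (W : lmodType K) xi (F G : seq V -> W) s :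
  dder xi (F + G) s = dder xi F s + dder xi G s.
Proof.
elim: s xi F G => [|b s IH] xi F G //=.
by rewrite -[der b (F + G)]/(der b F + der b G) !IH addrACA.
Qed.

Lemma dderL (W : lmodType K) a xi eta (F : seq V -> W) s : sml F ->
  dder (a *: xi + eta) F s = a *: dder xi F s + dder eta F s.
Proof.
elim: s xi eta F => [|b s IH] xi eta F sF /=; first exact: sF.1 [::] [::] a _ _.
rewrite derL !IH //; last exact: sml_der.
by rewrite scalerDr addrACA.
Qed.

Lemma dderD (W : lmodType K) xi eta (F : seq V -> W) s : sml F ->
  dder (xi + eta) F s = dder xi F s + dder eta F s.
Proof. by move=> sF; have := dderL 1 xi eta s sF; rewrite !scale1r. Qed.

Lemma sml_dder (W : lmodType K) xi (F : seq V -> W) : sml xi -> sml F ->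
  sml (dder xi F).
Proof.
move=> sX sF; split=> [s1|s1].
  elim: s1 xi F sX sF => [|c s1 IH] xi F sX sF s2 a x y.
    rewrite /= !sml_derL // dderL // dderDr.
    have -> : dder xi (a *: der x F) s2 = a *: dder xi (der x F) s2.
      by rewrite (lin_dder (f := fun w => a *: w)) // => b u v;
         rewrite scalerDr !scalerA mulrC.
    by rewrite scalerDr addrACA.
  by rewrite /= !IH // ?scalerDr 1?addrACA //; exact: sml_der.
elim: s1 xi F sX sF => [|c s1 IH] xi F sX sF s2 x y.
  rewrite /= (sml_derC y x sF) (sml_derC y x sX) -!addrA.
  by congr (_ + _); rewrite addrCA.
by rewrite /=; congr (_ + _); apply: IH => //; exact: sml_der.
Qed.

Lemma dder_conv (A B W : lmodType K) (op : A -> B -> W)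
    (xi : seq V -> V) F G s :
  bilin op ->
  dder xi (conv op F G) s = conv op (dder xi F) G s + conv op F (dder xi G) s.
Proof.
move=> bop; elim: s xi F G => [|b s IH] xi F G //=.
rewrite -[dder _ (conv op F G) s]/(dder (der b xi) (conv op F G) s).
rewrite der_conv dderDr !IH !der_dder convDl // convDr //.
set x1 := conv _ _ _ _; set x2 := conv _ _ _ _; set x3 := conv _ _ _ _.
set x4 := conv _ _ _ _; set x5 := conv _ _ _ _; set x6 := conv _ _ _ _.
rewrite -!addrA; congr (_ + _).
rewrite addrCA; congr (_ + _).
by rewrite [x5 + (x4 + _)]addrCA [x5 + (x2 + _)]addrCA [in RHS]addrCA.
Qed.

(** The second-order terms cancel, as second derivatives are symmetric: the
    commutator of two vector fields is a vector field. *)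
Lemma dder_comm (W : lmodType K) (xi eta : seq V -> V) (F : seq V -> W) s : sml F ->
  dder xi (dder eta F) s - dder eta (dder xi F) s =
  dder (dder xi eta - dder eta xi) F s.
Proof.
elim: s xi eta F => [|b s IH] xi eta F sF.
  rewrite /= /der opprD addrACA.
  rewrite -[F [:: eta _; xi _]](sF.2 [::] [::]) subrr addr0.
  exact/esym/(linB (sml_lin sF)).
have sbF := sml_der b sF.
rewrite [RHS]/= -[der b (_ - _)]/(der b _ - der b _) !der_dder.
rewrite [LHS]/= !der_dder !dderDr.
have -> : dder (der b xi) eta + dder xi (der b eta) -
   (dder (der b eta) xi + dder eta (der b xi)) =
   (dder (der b xi) eta - dder eta (der b xi)) +
   (dder xi (der b eta) - dder (der b eta) xi).
  by rewrite opprD [- _ - _]addrC addrACA.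
rewrite dderD // -!IH // !opprD [- dder (der b eta) _ _ + _]addrC.
set x1 := dder _ _ _; set x2 := dder _ _ _; set x3 := dder _ _ _.
set x4 := - dder _ _ _; set x5 := - dder _ _ _; set x6 := - dder _ _ _.
by rewrite -[x5 + x6 + x4]addrA [x6 + x4]addrC addrACA [x2 + x3 + _]addrACA addrA.
Qed.

Section Substitution.

(** With [op := ev], [conv] substitutes a vector-valued series for the argument
    of a series of functions. Identities that hold for all constant vectors can
    in this way be applied to vector fields. *)
Definition ev (T : Type) (W : Type) (phi : T -> W) (t : T) : W := phi t.
Definition evs (U W : lmodType K) (Th : seq V -> Lin U W) (u : U) : seq V -> W :=
  fun s => ap (Th s) u.

Lemma ev_lin (T : Type) (W : lmodType K) (t : T) : linear (fun phi : T -> W => ev phi t).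
Proof. by []. Qed.

Lemma conv_evD (T : Type) (W : lmodType K) (Phi Psi : seq V -> T -> W) eta s :
  conv (@ev T W) (Phi + Psi) eta s = conv (@ev T W) Phi eta s + conv (@ev T W) Psi eta s.
Proof. exact/convDl1/ev_lin. Qed.

Lemma dder_sub (W : lmodType K) (F : seq V -> W) eta s : sml F ->
  dder eta F s = conv (@ev V W) (fun t b => F (b :: t)) eta s.
Proof.
elim: s eta F => [|c s IH] eta F sF //=.
rewrite addrC; congr (_ + _); last exact: IH.
rewrite IH; last exact: sml_der.
by apply: conv_eq => // t _; apply/funext => b; apply: (sF.2 [::]).
Qed.



Lemma conv_sub (U A B W : lmodType K) (op : A -> B -> W) (Th : seq V -> Lin U A) eta
   (G : seq V -> B) s : bilin op ->
  conv op (conv (@ap _ _ _) Th eta) G s =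
  conv (@ev _ W) (fun t b => conv op (evs Th b) G t) eta s.
Proof.
move=> bop; elim: s Th eta G => [|c s IH] Th eta G //=.
rewrite der_conv convDl // !IH.
rewrite -[X in _ = X + _]/(conv (@ev _ W)
  ((fun t b => conv op (evs (der c Th) b) G t) +
   (fun t b => conv op (evs Th b) (der c G) t)) eta s).
by rewrite conv_evD addrAC.
Qed.

Definition sub2 (U U' W : lmodType K) (Om : seq V -> U -> U' -> W)
    (eta : seq V -> U) (zeta : seq V -> U') s : W :=
  conv (@ev _ W) (conv (@ev _ (_ -> W)) Om eta) zeta s.

Lemma sub2D (U U' W : lmodType K) (Om Om' : seq V -> U -> U' -> W) eta zeta s :
  sub2 (Om + Om') eta zeta s = sub2 Om eta zeta s + sub2 Om' eta zeta s.
Proof.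
rewrite /sub2 -conv_evD; congr (conv _ _ _ _); apply/funext => t.
exact: conv_evD.
Qed.

Lemma sub2C (U U' W : lmodType K) (Om : seq V -> U -> U' -> W) eta zeta s :
  sub2 Om eta zeta s = sub2 (fun t b b' => Om t b' b) zeta eta s.
Proof.
have sub2_cons (T T' : lmodType K) (Om' : seq V -> T -> T' -> W) xi xi' c t :
  sub2 Om' xi xi' (c :: t) = sub2 (der c Om') xi xi' t +
     sub2 Om' (der c xi) xi' t + sub2 Om' xi (der c xi') t.
  by rewrite /sub2 /= der_conv conv_evD.
elim: s Om eta zeta => [|c s IH] Om eta zeta //.
by rewrite !sub2_cons (IH (der c Om)) (IH Om (der c eta)) (IH Om eta) addrAC.
Qed.

Lemma sub2_lin (U U' W : lmodType K) (Th : seq V -> U -> Lin U' W) eta zeta s :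
  conv (@ap _ _ _) (conv (@ev _ (Lin U' W)) Th eta) zeta s =
  sub2 (fun t b b' => ap (Th t b) b') eta zeta s.
Proof.
rewrite /sub2 -(conv_comp (@ev _ W) (@ap K U' W) id).
apply: conv_eq => // t _ /=.
rewrite (lin_conv (f := @ap K U' W)) //.
exact/esym/(conv_comp (@ev _ (_ -> W)) (fun (phi : U -> Lin U' W) b => ap (phi b)) id).
Qed.

Lemma sub2_conv (U U' A B W : lmodType K) (op : A -> B -> W)
   (Th : seq V -> Lin U A) (Th' : seq V -> Lin U' B) eta zeta s : bilin op ->
  conv op (conv (@ap _ _ _) Th eta) (conv (@ap _ _ _) Th' zeta) s =
  sub2 (fun t b b' => conv op (evs Th b) (evs Th' b') t) eta zeta s.
Proof.
move=> bop; rewrite conv_sub // sub2C /sub2; apply: conv_eq => // t _.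
apply/funext => b; rewrite convC conv_sub; last by split; [exact: bop.2|exact: bop.1].
rewrite (lin_conv (f := fun phi : U -> W => phi b)) //.
rewrite -(conv_comp (@ev _ W) (fun (phi : U' -> U -> W) b' => phi b' b) id).
by apply: conv_eq => // u _; apply/funext => b' /=; rewrite convC.
Qed.

End Substitution.

End Directional.

(** * Exponentials *)

Section Flow.
Variables (K : fieldType) (charK0 : [pchar K] =i pred0) (V : lmodType K).

(** The generic vector, that is, the identity of [V] as a series. *)
Definition var (s : seq V) : V := if s is [:: v] then v else 0.

Lemma sml_var : sml var.
Proof.
split=> [[|c [|d s1]] [|e s2] a x y|[|c [|d s1]] [|e s2] x y] //=;
  by rewrite ?scaler0 ?addr0.
Qed.

Lemma deg_var : deg var = var.
Proof. by apply/funext => -[|b [|c s]]; rewrite /deg /= ?scaler0 ?scale1r. Qed.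

Lemma der_var b : der b var = const b.
Proof. by apply/funext => -[|c s]. Qed.

Lemma act_const (A : lmodType K) (W : lmodType K) (op : V -> A -> W) w s :
  bilin op -> act op (const w) s = op (var s) w.
Proof.
move=> bop; case: s => [|c [|d t]]; first by rewrite (bil0l bop).
  by rewrite /act /= addr0.
rewrite -[LHS]/(der c (act op (const w)) (d :: t)) der_act addE /= der_const.
rewrite (bil0r bop) add0r (bil0l bop) -[RHS](ins0 _ (d :: t)).
by apply: eq_ins => v u _; rewrite (bil0r bop).
Qed.

Lemma affine_unique (W : lmodType K) (op : V -> W -> W) c (X F G : seq V -> W) :
  (forall v, linear (op v)) -> F [::] = G [::] ->
  (forall s, c%:R *: F s + deg F s = act op F s + X s) ->
  (forall s, c%:R *: G s + deg G s = act op G s + X s) -> F = G.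
Proof.
move=> lop E0 EF EG; apply/eqP; rewrite -subr_eq0; apply/eqP.
apply: (@eq_unique _ _ charK0 _ op c) => [|b s|b s].
- by rewrite -[LHS]/(F [::] - G [::]) E0 subrr.
- set t := b :: s; rewrite actD // actN //.
  have <- : c%:R *: F t + deg F t - (c%:R *: G t + deg G t) = act op F t - act op G t.
    by rewrite EF EG opprD addrACA subrr addr0.
  by rewrite natrD scalerDl addrC /deg opprD addrACA -!scalerBr.
- rewrite scaler0; apply/esym; rewrite -[RHS](ins0 _ (b :: s)).
  by apply: eq_ins => v u _; exact: lin0.
Qed.

Lemma affine_unique1 (W : lmodType K) (op : V -> W -> W) c (X F G : seq V -> W) :
  (forall v, linear (op v)) ->
  (forall s, c.+1%:R *: F s + deg F s = act op F s + X s) ->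
  (forall s, c.+1%:R *: G s + deg G s = act op G s + X s) -> F = G.
Proof.
move=> lop EF EG; apply: (affine_unique lop _ EF EG).
apply: (scalerI (natK_neq0 charK0 c)).
by have := EG [::]; have := EF [::]; rewrite /deg /act /= !scale0r !addr0 => -> ->.
Qed.

Section FlowOf.
Variables (N : lmodType K) (io : V -> N -> N) (bio : bilin io).

Definition post (U : lmodType K) v (f : Lin U N) : Lin U N := cmp (cur bio v) f.

Lemma bilin_post U : bilin (@post U).
Proof.
split=> [f a v v'|v a f f']; apply: Lin_ext => x; rewrite cmpE ?apD ?apZ ?cmpE /=.
  exact: bio.1.
exact: bio.2.
Qed.

(** The exponential of the action [io]: its value at [[:: v; ..; v]] is the
    iterate of [io v]. All that matters about it is its equation. *)
Lemma flow_exists : {F : seq V -> Lin N N |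
  [/\ F [::] = idL N, forall w s, deg (evs F w) s = act io (evs F w) s & sml F]}.
Proof.
exists (sol (@post N) 0 (idL N)); split=> // [w s|]; last exact/sml_sol/bilin_post.
case: s => [|b s]; first by rewrite /deg scale0r.
have := solE charK0 (@post N) 0 (idL N) b s.
move/(congr1 (fun h => ap h w)); rewrite apZ addn0 => E; apply: etrans E _.
exact: (lin_ins (f := fun h : Lin N N => ap h w)).
Qed.

Definition flow : seq V -> Lin N N := sval flow_exists.

Lemma flow_nil : flow [::] = idL N.
Proof. by case: (svalP flow_exists). Qed.

Lemma deg_flow w s : deg (evs flow w) s = act io (evs flow w) s.
Proof. by case: (svalP flow_exists). Qed.

Lemma sml_flow : sml flow.
Proof. by case: (svalP flow_exists). Qed.

Lemma evs_flow_nil w : evs flow w [::] = w.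
Proof. by rewrite /evs flow_nil. Qed.

Lemma flow_uniq w F : F [::] = w -> (forall s, deg F s = act io F s) -> F = evs flow w.
Proof.
move=> F0 EF; apply: (deg_unique charK0 _ EF) => [|s]; last exact: deg_flow.
by rewrite evs_flow_nil.
Qed.

Lemma flow1 v w : evs flow w [:: v] = io v w.
Proof. by have := deg_flow w [:: v]; rewrite /deg /act /= scale1r addr0 evs_flow_nil. Qed.
End FlowOf.

Lemma sml_evs (U W : lmodType K) (F : seq V -> Lin U W) u : sml F -> sml (evs F u).
Proof. exact: (sml_comp (f := fun h : Lin U W => ap h u)). Qed.

Section LieFlow.
Variables (g : lieAlgType K) (inc : V -> g) (linc : linear inc).

Definition adv (v : V) (x : g) : g := lie (inc v) x.
Lemma bilin_adv : bilin adv.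
Proof.
by split=> [x a v w|v a x y]; rewrite /adv ?linc; [apply: lie_bilin.1|apply: lie_bilin.2].
Qed.

(** The series [exp (ad a)]. *)
Definition expad : seq V -> Lin g g := flow bilin_adv.

(** [dexp] is the series [(exp (ad a) - 1) / ad a]: the differential of the
    exponential map, translated back to the identity. *)
Lemma dexp_exists : {F : seq V -> Lin V g | [/\ F [::] = mkLin linc, sml F &
  forall s, F s + deg F s = const (mkLin linc) s + act (@post _ _ bilin_adv V) F s]}.
Proof.
exists (sol (@post _ _ bilin_adv V) 1 (mkLin linc)); split=> // [|s].
  exact/sml_sol/bilin_post.
case: s => [|b s]; first by rewrite /deg scale0r.
have := solE charK0 (@post _ _ bilin_adv V) 1 (mkLin linc) b s.
rewrite natrD scalerDl scale1r addrC => E; apply: etrans E _.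
by rewrite -[const _ _]/(0 : Lin V g) add0r.
Qed.

Definition dexp : seq V -> Lin V g := sval dexp_exists.

Lemma dexp_nil : dexp [::] = mkLin linc.
Proof. by case: (svalP dexp_exists). Qed.

Lemma sml_dexp : sml dexp.
Proof. by case: (svalP dexp_exists). Qed.

Lemma deg_dexpL s :
  dexp s + deg dexp s = const (mkLin linc) s + act (@post _ _ bilin_adv V) dexp s.
Proof. by case: (svalP dexp_exists). Qed.

Lemma deg_dexp b s : evs dexp b s + deg (evs dexp b) s = const (inc b) s + act adv (evs dexp b) s.
Proof.
have := congr1 (fun h => ap h b) (deg_dexpL s); rewrite !apD => E.
apply: etrans E _; congr (_ + _); first by case: s.
exact: (lin_ins (f := fun h : Lin V g => ap h b)).
Qed.

Section Representation.
Variables (N : lmodType K) (rho : g -> N -> N) (brho : bilin rho).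
Hypothesis rho_lie : forall x y n,
  rho (lie x y) n = rho x (rho y n) - rho y (rho x n).

Definition io (v : V) (n : N) : N := rho (inc v) n.
Lemma bilin_io : bilin io.
Proof. by split=> [n a v w|v]; [rewrite /io linc brho.1|exact: brho.2]. Qed.

(** The series [exp (rho a)]. *)
Definition exprho := flow bilin_io.

Lemma io_leibniz v x n : io v (rho x n) = rho (adv v x) n + rho x (io v n).
Proof. by rewrite /io /adv rho_lie addrNK. Qed.

(** The differential of [exp (rho a)] in the direction [b] is
    [rho (dexp b) exp (rho a)]. *)
Lemma der_flow b w : der b (evs exprho w) = conv rho (evs dexp b) (evs exprho w).
Proof.
apply: (affine_unique1 (c := 0) (op := io) (X := io b \o evs exprho w)) => [v|s|s].
- exact: bilin_io.2.
- have D : der b (evs exprho w) s + deg (der b (evs exprho w)) s = der b (deg (evs exprho w)) s.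
    by rewrite der_deg.
  rewrite scale1r D; have -> : deg (evs exprho w) = act io (evs exprho w).
    by apply/funext; exact: deg_flow.
  by rewrite der_act addrC.
- rewrite scale1r deg_conv // addrA -convDl //.
  have -> : evs dexp b + deg (evs dexp b) = const (inc b) + act adv (evs dexp b).
    by apply/funext; exact: deg_dexp.
  rewrite convDl // conv_constl // -addrA addrC; congr (_ + _).
  have -> : deg (evs exprho w) = act io (evs exprho w).
    by apply/funext; exact: deg_flow.
  by rewrite (act_conv _ _ _ brho bilin_io.2 io_leibniz).
Qed.

(** [exp (rho a) rho_x exp (- rho a) = rho (exp (ad a) x)], multiplied out so
    that no inverse appears. *)
Lemma flow_Ad x w : evs exprho (rho x w) = conv rho (evs expad x) (evs exprho w).
Proof.
apply/esym/(flow_uniq bilin_io) => [|s]; first by rewrite /= !evs_flow_nil.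
rewrite deg_conv // (act_conv _ _ _ brho bilin_io.2 io_leibniz).
by congr (_ + _); apply: conv_eq => // t _; exact: deg_flow.
Qed.

Lemma dder_flow eta w s :
  dder eta (evs exprho w) s = conv rho (conv (@ap _ _ _) dexp eta) (evs exprho w) s.
Proof.
rewrite dder_sub; last by apply: sml_evs; exact: sml_flow.
rewrite conv_sub //; apply: conv_eq => // t _; apply/funext => b.
by rewrite -der_flow.
Qed.
End Representation.

Lemma lie_rep (x y n : g) : lie (lie x y) n = lie x (lie y n) - lie y (lie x n).
Proof.
have := lie_jacobi x y n; rewrite [lie n (lie x y)]lieC [lie n x]lieC lieNr.
by move/eqP; rewrite subr_eq0 => /eqP.
Qed.

Let blie := @lie_bilin K g.

(** Both sides solve [2 F + deg F = [a, F] + [b, Theta b'] - [b', Theta b]]. *)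
Lemma maurer_cartan b b' :
  der b (evs dexp b') - der b' (evs dexp b) = conv (@lie K g) (evs dexp b) (evs dexp b').
Proof.
have bad := bilin_adv.
pose X s := lie (inc b) (evs dexp b' s) - lie (inc b') (evs dexp b s).
apply: (affine_unique1 (c := 1) (op := adv) (X := X)) => [v|s|s].
- exact: bad.2.
- have H c c' : 2%:R *: der c (evs dexp c') s + deg (der c (evs dexp c')) s =
     lie (inc c) (evs dexp c' s) + act adv (der c (evs dexp c')) s.
    have D : der c (evs dexp c') s + deg (der c (evs dexp c')) s = der c (deg (evs dexp c')) s.
      by rewrite der_deg.
    rewrite scaler_nat mulr2n -addrA D.
    rewrite -derD.
    have -> : evs dexp c' + deg (evs dexp c') = const (inc c') + act adv (evs dexp c').
      by apply/funext; exact: deg_dexp.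
    by rewrite derD der_act der_const add0r.
  rewrite scalerBr /deg scalerBr addrACA -opprD !H /X actD ?actN //; try exact: bad.2.
  by rewrite opprD addrACA addrC.
- rewrite deg_conv // scaler_nat mulr2n addrACA -convDl // -convDr //.
  have E c : evs dexp c + deg (evs dexp c) = const (inc c) + act adv (evs dexp c).
    by apply/funext; exact: deg_dexp.
  rewrite !E convDl // conv_constl // convDr // conv_constr // addrACA.
  rewrite (act_conv _ _ _ (op3 := adv) blie bad.2 (op1 := adv) (op2 := adv)).
    by rewrite addrC /X [lie (evs _ _ _) _]lieC.
  by move=> v x y; rewrite /adv lie_rep addrNK.
Qed.

Lemma maurer_cartan_sub eta zeta s :
  conv (@ap _ _ _) (dder eta dexp) zeta s - conv (@ap _ _ _) (dder zeta dexp) eta s =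
  conv (@lie K g) (conv (@ap _ _ _) dexp eta) (conv (@ap _ _ _) dexp zeta) s.
Proof.
have E : forall xi, dder xi dexp = conv (@ev _ _) (fun t b => dexp (b :: t)) xi.
  by move=> xi; apply/funext => t; rewrite dder_sub //; exact: sml_dexp.
rewrite !E !sub2_lin [X in _ - X]sub2C sub2_conv //.
apply/eqP; rewrite subr_eq addrC -sub2D; apply/eqP; congr sub2.
apply/funext => t; apply/funext => b; apply/funext => b'.
have /= := congr1 (fun F : seq V -> g => F t) (maurer_cartan b b').
by rewrite subE => /eqP; rewrite subr_eq addrC => /eqP.
Qed.

(** [Theta a = a], because [[a, a] = 0]. *)
Lemma dexp_var s : conv (@ap _ _ _) dexp var s = inc (var s).
Proof.
suff E : conv (@ap _ _ _) dexp var = inc \o var by rewrite E.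
pose bad := bilin_adv.
apply: (affine_unique (c := 0) (op := adv) (X := inc \o var)) => [v||t|t].
- exact: bad.2.
- by rewrite /= (lin0 (apP _)) (lin0 linc).
- rewrite scale0r add0r deg_conv; last exact: bilin_ap.
  rewrite deg_var -convDl; last exact: bilin_ap.
  have -> : deg dexp + dexp = const (mkLin linc) + act (@post _ _ bad V) dexp.
    rewrite [LHS]addrC; by apply/funext => u; exact: deg_dexpL.
  rewrite convDl ?conv_constl; try exact: bilin_ap.
  rewrite addrC; congr (_ + _).
  rewrite (act_conv (op1 := @post _ _ bad V) (op2 := fun _ _ => 0)).
  + have -> : act (fun _ _ => 0) var = 0 :> (seq V -> V) by apply/funext => u; exact: ins0.
    by rewrite conv0r ?addr0 //; exact: bilin_ap.
  + exact: bilin_ap.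
  + exact: bad.2.
  + by move=> v f x; rewrite (lin0 (apP _)) addr0.
- rewrite scale0r add0r -[deg _ _]/(_ *: _) /= -(linZ linc).
  rewrite -[_ *: var t]/(deg var t) deg_var -[LHS]add0r; congr (_ + _).
  case: t => [|b t] //; rewrite -[RHS]/(der b _ t) der_act addE /=.
  have -> : der b (inc \o var) = const (inc b).
    apply/funext => u; rewrite -[LHS]/(inc (der b var u)) der_var.
    by case: u => //=; rewrite (lin0 linc).
  by rewrite act_const // /adv [lie (inc b) _]lieC addNr.
Qed.

(** * Fundamental vector fields *)

Section VectorField.
Variables (pr : g -> V) (lpr : linear pr).
Hypothesis incK : cancel inc pr.
Hypothesis pr_lie : forall x y, pr x = 0 -> pr y = 0 -> pr (lie x y) = 0.

Let prL : Lin g V := mkLin lpr.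
Notation cc := (@cmp _ _ _ _).
Notation ac := (@ap _ _ _).

(** [exp (ad a)] is inverted as an operator series; then [pr_expadV] is the
    component of [exp (- ad a) x] along [c], and [dexpc] is its restriction to
    tangent vectors of the chart, which has constant term the identity. *)
Definition expadV : seq V -> Lin g g := cinv expad.
Let expad_nil : expad [::] = idL g := flow_nil bilin_adv.
Definition pr_expadV : seq V -> Lin g V := fun s => cmp prL (expadV s).
Definition dexpc : seq V -> Lin V V := conv cc pr_expadV dexp.

Lemma dexpc_nil : dexpc [::] = idL V.
Proof. by apply: Lin_ext => v; rewrite /dexpc /= cmpE dexp_nil; exact: incK. Qed.

(** [fund] and [isot] are the solution [X = fund x], [sigma = isot x] of
    [x = Theta X + B sigma] with [sigma] in the kernel of [pr]; apply
    [pr B^-1] to eliminate [sigma]. See [fund_eq]. *)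
Definition fund : seq V -> Lin g V := conv cc (cinv dexpc) pr_expadV.
Definition isot : seq V -> Lin g g := conv cc expadV (const (idL g) - conv cc dexp fund).

Lemma sml_expadV : sml expadV.
Proof. by apply: sml_cinv; exact: sml_flow. Qed.

Lemma sml_pr_expadV : sml pr_expadV.
Proof. exact: (sml_comp ((@bilin_cmp K g g V).2 prL) sml_expadV). Qed.

Lemma sml_fund : sml fund.
Proof.
have bc U W X := @bilin_cmp K U W X; apply: sml_conv => //; last exact: sml_pr_expadV.
apply: sml_cinv.
apply: sml_conv => //; [exact: sml_pr_expadV|exact: sml_dexp].
Qed.

Lemma conv_ccA (U1 U2 U3 U4 : lmodType K) (F : seq V -> Lin U3 U4)
    (G : seq V -> Lin U2 U3) (H : seq V -> Lin U1 U2) :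
  conv cc (conv cc F G) H = conv cc F (conv cc G H).
Proof.
apply/funext => s; apply: convA; [exact: (@bilin_cmp _ _ _ _).1|
  exact: (@bilin_cmp _ _ _ _).2|exact: cmpA].
Qed.

Lemma conv_acA (U2 U3 U4 : lmodType K) (F : seq V -> Lin U3 U4)
    (G : seq V -> Lin U2 U3) (H : seq V -> U2) :
  conv ac (conv cc F G) H = conv ac F (conv ac G H).
Proof.
by apply/funext => s; apply: convA => [z|f|//];
  [exact: (@bilin_ap _ _ _).1|exact: (@bilin_ap _ _ _).2].
Qed.

Lemma conv_cc1 (U W : lmodType K) (F : seq V -> Lin U W) : conv cc (const (idL W)) F = F.
Proof. by apply/funext => s; rewrite conv_constl ?cmp1l //; exact: bilin_cmp. Qed.
Lemma conv_ac1 (W : lmodType K) (F : seq V -> W) : conv ac (const (idL W)) F = F.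
Proof. by apply/funext => s; rewrite conv_constl //; exact: bilin_ap. Qed.

Lemma pr_expadV_cmp (U : lmodType K) (F : seq V -> Lin U g) s :
  conv cc pr_expadV F s = cmp prL (conv cc expadV F s).
Proof.
rewrite (lin_conv (f := cmp prL)); last exact: (@bilin_cmp _ _ _ _).2 prL.
apply: etrans (conv_comp cc (cmp prL) id expadV F s) _.
by apply: conv_eqop => x y; exact: cmpA.
Qed.

Lemma pr_expadV_ap (F : seq V -> g) s : conv ac pr_expadV F s = pr (conv ac expadV F s).
Proof.
rewrite (lin_conv (f := pr)) //.
exact: (conv_comp ac (cmp prL) id).
Qed.

Lemma isot_pr x s : pr (evs isot x s) = 0.
Proof.
have bc U W X := @bilin_cmp K U W X.
suff E : cmp prL (isot s) = 0 by have := congr1 (fun h => ap h x) E.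
rewrite -pr_expadV_cmp convDr // convNr // conv_constr // cmp1r.
by rewrite -conv_ccA -/dexpc /fund -conv_ccA cinv_r ?dexpc_nil // conv_cc1 subrr.
Qed.

Lemma fund_eq : conv cc dexp fund + conv cc expad isot = const (idL g).
Proof.
rewrite /isot -conv_ccA cinv_r // conv_cc1 addrC subrK //.
Qed.

Lemma conv_evs (U1 U2 U3 : lmodType K) (F : seq V -> Lin U2 U3)
    (G : seq V -> Lin U1 U2) u : evs (conv cc F G) u = conv ac F (evs G u).
Proof.
apply/funext => s; rewrite /evs (lin_conv (f := fun h : Lin U1 U3 => ap h u)) //.
exact/esym/(conv_comp ac id (fun h : Lin U1 U2 => ap h u)).
Qed.

Lemma fund_eqx x : conv ac dexp (evs fund x) + conv ac expad (evs isot x) = const x.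
Proof.
rewrite -!conv_evs; apply/funext => s.
rewrite addE -[LHS]/(ap ((conv cc dexp fund + conv cc expad isot) s) x) fund_eq.
by case: s.
Qed.

Lemma fund_unique eta t : (forall s, pr (t s) = 0) ->
  conv ac dexp eta + conv ac expad t = 0 -> eta = 0.
Proof.
move=> pt E; have ba U W := @bilin_ap K U W.
have : conv ac dexpc eta = 0.
  apply/funext => s; rewrite /dexpc conv_acA pr_expadV_ap.
  have /(congr1 (fun F : seq V -> g => F s)) : conv ac expadV (conv ac dexp eta + conv ac expad t) = 0.
    by rewrite E; apply/funext => u; rewrite conv0r.
  rewrite convDr // -!conv_acA cinv_l // conv_ac1 conv_acA => /eqP.
  by rewrite addr_eq0 => /eqP ->; rewrite (linN lpr) pt oppr0.
move=> /(congr1 (conv ac (cinv dexpc))); rewrite -conv_acA cinv_l ?dexpc_nil // conv_ac1 => ->.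
by apply/funext => s; rewrite conv0r.
Qed.

Lemma dder0 (W : lmodType K) (eta : seq V -> V) s : dder eta (0 : seq V -> W) s = 0.
Proof. by elim: s eta => [|b s IH] eta //=; rewrite !IH addr0. Qed.

Lemma dder_const (W : lmodType K) (eta : seq V -> V) (w : W) s : dder eta (const w) s = 0.
Proof. by elim: s eta => [|b s IH] eta //=; rewrite IH der_const dder0 addr0. Qed.

Lemma exprho_lie : exprho blie = expad.
Proof. by rewrite /exprho /expad (Prop_irrelevance (bilin_io blie) bilin_adv). Qed.

Lemma dder_expad eta (F : seq V -> g) s :
  conv ac (dder eta expad) F s = conv (@lie K g) (conv ac dexp eta) (conv ac expad F) s.
Proof.
pose op (y : g) (f : Lin g g) := cmp (cur blie y) f.
have -> : dder eta expad = conv op (conv ac dexp eta) expad.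
  apply/funext => t; apply: Lin_ext => w.
  rewrite (lin_dder (f := fun h : Lin g g => ap h w)) // (lin_conv (f := fun h : Lin g g => ap h w)) //.
  rewrite -[LHS]/(dder eta (evs expad w) t) -exprho_lie dder_flow; last exact: lie_rep.
  by rewrite -(conv_comp (@lie K g) id (fun h : Lin g g => ap h w)).
by apply: convA => [z|z|//]; [exact: (@bilin_ap _ _ _).1|exact: blie.2].
Qed.

(** The equation of [fund x], differentiated along [eta]. *)
Lemma dder_fund_eq eta x s :
  conv ac (dder eta dexp) (evs fund x) s + conv ac dexp (dder eta (evs fund x)) s +
  (conv (@lie K g) (conv ac dexp eta) (conv ac expad (evs isot x)) s +
   conv ac expad (dder eta (evs isot x)) s) = 0.
Proof.
have ba U W := @bilin_ap K U W.
have := congr1 (fun F => dder eta F s) (fund_eqx x).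
by rewrite dder_const dderDr !dder_conv // dder_expad.
Qed.

(** [exp (ad a)] is an automorphism: this is [flow_Ad] for the adjoint
    representation, applied to series instead of constants. *)
Lemma expad_lie (F G : seq V -> g) s :
  conv ac expad (conv (@lie K g) F G) s =
  conv (@lie K g) (conv ac expad F) (conv ac expad G) s.
Proof.
rewrite sub2_conv // /sub2.
pose op (f : Lin g g) (x : g) := fun y => ap f (lie x y).
have <- : conv op expad F = conv (@ev _ (g -> g))
    (fun t b b' => conv (@lie K g) (evs expad b) (evs expad b') t) F.
  apply/funext => t.
  rewrite -[RHS]/(conv (@ev _ (g -> g)) (fun t b b' => conv (@lie K g) (evs expad b) (evs expad b') t) (id \o F) t).
  have -> : (fun t b b' => conv (@lie K g) (evs expad b) (evs expad b') t) =
     (fun (f : Lin g g) x y => ap f (lie x y)) \o expad.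
    apply/funext => u; apply/funext => b; apply/funext => b' /=.
    by have := flow_Ad blie lie_rep b b'; rewrite exprho_lie => <-.
  exact/esym/conv_comp.
apply/esym; apply: convA => [z|z|//]; last exact: apP.
by [].
Qed.

Lemma conv_lie_pr (F G : seq V -> g) s : (forall s, pr (F s) = 0) -> (forall s, pr (G s) = 0) ->
  pr (conv (@lie K g) F G s) = 0.
Proof.
move=> F0 G0; rewrite (lin_conv (f := pr)) //; apply: conv_vanish => t u.
exact: pr_lie.
Qed.

Lemma dder_pr eta (F : seq V -> g) s : (forall s, pr (F s) = 0) -> pr (dder eta F s) = 0.
Proof.
move=> F0; rewrite (lin_dder (f := pr)) //.
have -> : pr \o F = 0 by apply/funext => t; exact: F0.
exact: dder0.
Qed.

(** Differentiate [x = Theta X + B sigma_x] along [Y], the analogous equation for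
    [y] along [X], and subtract. The Maurer-Cartan equation turns the derivatives
    of [Theta] into brackets, and what remains is the equation that defines the
    field of the bracket, up to a term [B sigma] with [sigma] in [s]. *)
Lemma fund_comm x y :
  dder (evs fund x) (evs fund y) - dder (evs fund y) (evs fund x) = evs fund (lie y x).
Proof.
have ba U W := @bilin_ap K U W.
set X := evs fund x; set Y := evs fund y.
pose TX := conv ac dexp X; pose TY := conv ac dexp Y.
pose BX := conv ac expad (evs isot x); pose BY := conv ac expad (evs isot y).
have EX : TX = const x - BX by rewrite -(fund_eqx x) addrK.
have EY : TY = const y - BY by rewrite -(fund_eqx y) addrK.
pose S := conv (@lie K g) (evs isot x) (evs isot y).
have pS s : pr (S s) = 0 by apply: conv_lie_pr => t; exact: isot_pr.
have main s : const (lie y x) s + conv ac expad S s +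
    (conv ac dexp (dder Y X - dder X Y) s +
     conv ac expad (dder Y (evs isot x) - dder X (evs isot y)) s) = 0.
  have E1 := dder_fund_eq X y s; have E2 := dder_fund_eq Y x s.
  have := etrans (congr2 (fun a b => a - b) E2 E1) (subrr 0).
  rewrite -/X -/Y -/TX -/TY -/BX -/BY !opprD addrACA.
  rewrite [_ + _ + (- _ - _)]addrACA [X in _ + X]addrACA (maurer_cartan_sub Y X s) -/TX -/TY.
  rewrite addrACA [conv _ TY TX s + _]addrA -convDr // (fund_eqx x) conv_constr // [in X in X - _]EY.
  rewrite [in X in _ - X + _]EX convDl // convNl // conv_constl //.
  rewrite subE lieBl [lie x _]lieC opprB addrA.
  rewrite ![conv ac _ (_ - _) s]convDr // !convNr // expad_lie -/BX -/BY => <-.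
  congr (_ + _); last by rewrite addrA.
  have -> : const (lie y x) s = lie (const y s) x by case: (s) => //=; rewrite lie0l.
  by rewrite opprK [conv _ BX BY s + lie _ _]addrC addrA subrK.
have E := fund_eqx (lie y x).
pose t := evs isot (lie y x) + S + (dder Y (evs isot x) - dder X (evs isot y)).
have pt s : pr (t s) = 0.
  rewrite /t !addE oppE !(linD lpr) (linN lpr) isot_pr pS !dder_pr ?oppr0 ?addr0 //;
  by move=> u; exact: isot_pr.
have := @fund_unique (evs fund (lie y x) + (dder Y X - dder X Y)) t pt.
move=> H; apply/eqP; rewrite -subr_eq0 -opprB oppr_eq0 opprD opprK; apply/eqP.
rewrite -[RHS]H; first by rewrite [- dder X Y + _]addrC.
apply/funext => s; rewrite addE convDr // /t.
rewrite [conv ac expad (_ + _ + _) s]convDr // [conv ac expad (_ + S) s]convDr // -[RHS](main s).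
rewrite -[const (lie y x)]E addE -[in RHS](addrA (conv ac dexp _ s)).
by rewrite [in RHS]addrACA.
Qed.

(** The part [B sigma] of [x] contributes
    [rho (B sigma) exp (rho a) w = exp (rho a) rho_sigma w = 0]. *)
Lemma dder_exprho (N : lmodType K) (rho : g -> N -> N) (brho : bilin rho) x w s :
  (forall x y n, rho (lie x y) n = rho x (rho y n) - rho y (rho x n)) ->
  (forall z, pr z = 0 -> rho z w = 0) ->
  dder (evs fund x) (evs (exprho brho) w) s = rho x (evs (exprho brho) w s).
Proof.
move=> rl rw; rewrite dder_flow //.
have -> : conv ac dexp (evs fund x) = const x - conv ac expad (evs isot x).
  by rewrite -(fund_eqx x) addrK.
rewrite convDl // convNl // conv_constl // conv_sub //.
rewrite [X in _ - X]conv_vanish ?subr0 // => t u.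
rewrite /ev -flow_Ad // rw ?isot_pr //.
by rewrite /evs (lin0 (apP _)).
Qed.

Lemma ins_var (W : lmodType K) (F : seq V -> Lin V W) s :
  ins (fun v => evs F v) s = conv (@ap K V W) F var s.
Proof.
elim: s F => [|b s IH] F /=; first by rewrite (lin0 (apP _)).
rewrite der_var conv_constr; last exact: bilin_ap.
by rewrite addrC -IH.
Qed.

(** The field of the generic vector is the Euler field: as [Theta a = a], the
    generic vector solves the defining equation with [sigma = 0]. *)
Lemma fund_var s : ins (fun v => evs fund (inc v)) s = var s.
Proof.
have ba U W := @bilin_ap K U W.
pose ixi t := cmp (fund t) (mkLin linc).
rewrite -[LHS]/(ins (fun v => evs ixi v) s) ins_var.
have Ei (W : lmodType K) (F : seq V -> Lin g W) t :
  conv ac (fun u => cmp (F u) (mkLin linc)) var t = conv ac F (inc \o var) t.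
  rewrite -[LHS]/(conv ac ((fun h => cmp h (mkLin linc)) \o F) (id \o var) t) conv_comp.
  by rewrite -[RHS]/(conv ac (id \o F) (inc \o var) t) conv_comp.
rewrite /ixi Ei.
have E := @fund_unique (conv ac fund (inc \o var) - var) (conv ac isot (inc \o var)).
apply/eqP; rewrite -subr_eq0 -subE E // => [t|].
  by rewrite (lin_conv (f := pr)) // conv_vanish // => u v; exact: isot_pr.
apply/funext => t; rewrite addE convDr // convNr // dexp_var.
rewrite -!conv_acA addrAC -convDl // fund_eq conv_ac1.
by rewrite subrr.
Qed.

End VectorField.

End LieFlow.

End Flow.

(** * Tensors and coderivations *)
Section TensorFacts.
Variables (K : fieldType).

Lemma lin_tlift (U V W W' : lmodType K) (f : W -> W') (op : U -> V -> W) t :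
  linear f -> f (tlift op t) = tlift (fun u v => f (op u v)) t.
Proof.
move=> lf; rewrite unlock.
pose f' := HB.pack_for {linear W -> W'} f (GRing.isLinear.Build _ _ _ _ f lf).
rewrite -[f]/(f' : _ -> _) linear_sum; apply: eq_bigr => p _.
by rewrite linearZ.
Qed.

Lemma tlift_tmap (U U' V V' W : lmodType K) (f : U -> U') (g : V -> V')
    (op : U' -> V' -> W) t : linear f -> linear g -> bilin op ->
  tlift op (tmap f g t) = tlift (fun u v => op (f u) (g v)) t.
Proof.
move=> lf lg bop; rewrite (lin_tlift _ _ (tlift_linear bop)); apply: eq_tlift => u v.
by rewrite tliftE.
Qed.

Lemma tmap_id (U V : lmodType K) (t : tensor U V) : tmap id id t = t.
Proof.
move: t; apply: tensor_ext; [exact: tmap_linear|by []|].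
by move=> u v; rewrite tmapE.
Qed.

Lemma bilin_tmapL (U U' V V' : lmodType K) t :
  bilin (fun (f : Lin U U') (g : Lin V V') => tmap (ap f) (ap g) t).
Proof.
split=> [g a f f'|f a g g']; apply: tlift_comb => u v; rewrite apD apZ.
  exact: ptensor_l.
exact: ptensor_r.
Qed.

Lemma bilin_regular (W : lmodType K) : bilin (fun (a : K^o) (w : W) => (a : K) *: w).
Proof.
split=> [w a x y|a b x y]; first by rewrite scalerDl -scalerA.
by rewrite scalerDr !scalerA [b * _]mulrC.
Qed.
End TensorFacts.

Section Coalgebra.
Variables (K : fieldType) (N : lmodType K) (D : N -> tensor N N) (e : N -> K).
Hypotheses (lD : linear D) (le : scalar e).
Hypothesis counitlN : forall u, tlift (fun a b => e a *: b) (D u) = u.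
Hypothesis counitrN : forall u, tlift (fun a b => e b *: a) (D u) = u.

Definition coderivation (f : N -> N) : Prop :=
  linear f /\ forall u, D (f u) = tmap f id (D u) + tmap id f (D u).

Let le' : linear (e : N -> K^o). Proof. exact: le. Qed.

Lemma coder_counit f u : coderivation f -> e (f u) = 0.
Proof.
move=> [lf Df]; have ll : linear (@id N) by [].
have le2 a x y : e (a *: x + y) = a * e x + e y := le a x y.
have beb : bilin (fun a b => e a * e b : K^o).
  split=> [v a x y|v a x y]; rewrite le2.
    by rewrite mulrDl -mulrA.
  by rewrite mulrDr mulrCA.
have E w : tlift (fun a b => e a * e b : K^o) (D w) = e w.
  by rewrite -[in RHS](counitlN w) (lin_tlift _ _ le'); apply: eq_tlift => a b;
    rewrite -[RHS]/(e _) (linZ le').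
have lef : linear (fun x => e (f x) : K^o) by move=> a x y; rewrite lf le2.
have := E (f u); rewrite Df (linD (tlift_linear beb)).
rewrite !tlift_tmap //=.
have -> : tlift (fun a b => e (f a) * e b : K^o) (D u) = e (f u).
  rewrite -[in RHS](counitrN u) (lin_tlift _ _ lef); apply: eq_tlift => a b.
  by rewrite (linZ lef) mulrC.
have -> : tlift (fun a b => e a * e (f b) : K^o) (D u) = e (f u).
  rewrite -[in RHS](counitlN u) (lin_tlift _ _ lef); apply: eq_tlift => a b.
  by rewrite (linZ lef).
by move=> E2; apply: (@addrI _ (e (f u))); rewrite addr0.
Qed.

Variables (charK0 : [pchar K] =i pred0) (V : lmodType K).
Variables (io : V -> N -> N) (bio : bilin io).
Hypothesis cio : forall v, coderivation (io v).

(** The exponential of coderivations is group-like: both sides are solutions of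
    the equation of the diagonal action on the tensor square. *)
Lemma flow_comul u s :
  D (evs (flow charK0 bio) u s) =
  conv (fun f g : Lin N N => tmap (ap f) (ap g) (D u)) (flow charK0 bio) (flow charK0 bio) s.
Proof.
set F := flow charK0 bio; set op := fun f g : Lin N N => _.
pose op3 v t := tmap (io v) id t + tmap id (io v) t.
have ll : linear (@id N) by [].
have lop3 v : linear (op3 v).
  move=> a x y; rewrite /op3 (tmap_linear (bio.2 v) ll) (tmap_linear ll (bio.2 v)).
  by rewrite scalerDr addrACA.
suff -> : conv op F F = fun s => D (evs F u s) by [].
apply: (deg_unique charK0 (op := op3)) => [|t|t].
- rewrite [LHS]/= /F evs_flow_nil /op flow_nil; exact: tmap_id.
- have bop : bilin op by exact: bilin_tmapL.
  rewrite deg_conv //.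
  have -> : deg F = act (post bio (U := N)) F.
    apply/funext => r; apply: Lin_ext => w.
    have := deg_flow charK0 bio w r => E; apply: etrans E _.
    exact/esym/(lin_ins (f := fun h : Lin N N => ap h w)).
  rewrite (act_conv (op1 := post bio (U := N)) (op2 := post bio (U := N))) //.
  move=> v f g; rewrite /op3 /op.
  rewrite !tmap_comp //; try exact: apP; exact: bio.2.
- rewrite /deg -(linZ lD) -[_ *: evs F u t]/(deg (evs F u) t) deg_flow (lin_ins lD).
  by apply: eq_ins => v r _; rewrite (cio v).2.
Qed.

Lemma flow_counit u s : e (evs (flow charK0 bio) u s) = const (e u : K^o) s.
Proof.
case: s => [|b s]; first by rewrite evs_flow_nil.
have := deg_flow charK0 bio u (b :: s) => /(congr1 (e : N -> K^o)).
rewrite (linZ le') (lin_ins le').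
rewrite [RHS](_ : _ = 0); last first.
  rewrite -[RHS](ins0 K^o (b :: s)); apply: eq_ins => v r _.
  exact: coder_counit.
move=> E; apply: (@scalerI K K^o _ (natK_neq0 charK0 (size s))).
by rewrite [RHS]scaler0.
Qed.

End Coalgebra.

(** * The symmetric coalgebra *)
Section Sym.
Variables (K : fieldType) (V : lmodType K).

Inductive sym_rel : {malg K[seq V]} -> Prop :=
| Sym_lin s1 s2 a x y : sym_rel
    (<< s1 ++ (a *: x + y) :: s2 >> - a *: << s1 ++ x :: s2 >> - << s1 ++ y :: s2 >>)
| Sym_swap s1 s2 x y : sym_rel
    (<< s1 ++ x :: y :: s2 >> - << s1 ++ y :: x :: s2 >>).

Definition Sym := sp_quot (Defs.span sym_rel).
HB.instance Definition _ := GRing.Lmodule.on Sym.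

Definition cls (s : seq V) : Sym := sp_pi _ << s >>.

Lemma sml_cls : sml cls.
Proof.
split=> [s1 s2 a x y|s1 s2 x y]; rewrite /cls.
  rewrite -sp_pi_linear; apply/sp_piE/spanP => S; apply.
  by rewrite opprD addrA; exact: Sym_lin.
by apply/sp_piE/spanP => S; apply; exact: Sym_swap.
Qed.

Lemma Sym_sum (t : Sym) : t = \sum_(k <- msupp (repr t)) (repr t)@_k *: cls k.
Proof.
rewrite -[LHS]sp_piK {1}(monalgE (repr t)) raddf_sum /=.
apply: eq_bigr => u _; rewrite /cls -linearZ /=; congr sp_pi.
by apply/malgP => k; rewrite mcoeffZ !mcoeffU mulrnAr mulr1.
Qed.

Lemma Sym_ext (W : lmodType K) (F G : Sym -> W) : linear F -> linear G ->
  (forall s, F (cls s) = G (cls s)) -> F =1 G.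
Proof.
move=> lF lG E t.
pose F' := HB.pack_for {linear Sym -> W} F (GRing.isLinear.Build _ _ _ _ F lF).
pose G' := HB.pack_for {linear Sym -> W} G (GRing.isLinear.Build _ _ _ _ G lG).
rewrite -[F]/(F' : _ -> _) -[G]/(G' : _ -> _) (Sym_sum t) !linear_sum.
by apply: eq_bigr => p _; rewrite !linearZ /= E.
Qed.

Section Lift.
Variables (W : lmodType K) (F : seq V -> W).

Definition mext (m : {malg K[seq V]}) : W := \sum_(k <- msupp m) m@_k *: F k.

Lemma mext_linear : linear mext.
Proof.
move=> a m m'; pose d := (msupp m `|` msupp m' `|` msupp (a *: m + m'))%fset.
have E n : (msupp n `<=` d)%fset -> mext n = \sum_(p <- d) n@_p *: F p.
  move=> nd; apply: big_fset_incl => // p _.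
  by move/mcoeff_outdom=> ->; rewrite scale0r.
rewrite !E ?fsubsetUr // /d; last 2 first.
- by rewrite fsubsetU // fsubsetUr.
- by rewrite fsubsetU // fsubsetUl.
rewrite scaler_sumr -big_split /=; apply: eq_bigr => p _.
by rewrite mcoeffD mcoeffZ scalerDl scalerA.
Qed.

Lemma mextU s : mext << s >> = F s.
Proof. by rewrite /mext msuppU oner_eq0 big_seq_fset1 mcoeffUU scale1r. Qed.

Hypothesis sF : sml F.

Lemma mext_rel m : m \in Defs.span sym_rel -> mext m = 0.
Proof.
have lm := mext_linear.
move=> /spanP Sm.
have P0 : mext 0 = 0 by exact: lin0.
have PL a x y : mext x = 0 -> mext y = 0 -> mext (a *: x + y) = 0.
  by move=> x0 y0; rewrite lm x0 y0 scaler0 addr0.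
apply/(mk_subspaceP P0 PL)/Sm => _ [s1 s2 a x y|s1 s2 x y]; apply/mk_subspaceP.
  by rewrite !(linB lm) (linZ lm) !mextU sF.1 addrAC addrK subrr.
by rewrite (linB lm) !mextU sF.2 subrr.
Qed.

Lemma slift_exists : {f : Lin Sym W | forall s, ap f (cls s) = F s}.
Proof.
have E m : mext (repr (sp_pi (Defs.span sym_rel) m)) = mext m.
  apply/eqP; rewrite -subr_eq0 -(linB mext_linear); apply/eqP/mext_rel/sp_piE.
  exact: sp_piK.
have lf : linear (fun t : Sym => mext (repr t)).
  move=> a x y; rewrite -[x]sp_piK -[y]sp_piK -sp_pi_linear !E.
  exact: mext_linear.
by exists (mkLin lf) => s; rewrite apE E mextU.
Qed.

Definition slift : Lin Sym W := sval slift_exists.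

Lemma sliftE s : ap slift (cls s) = F s.
Proof. exact: (svalP slift_exists). Qed.
End Lift.

Definition scomul : Lin Sym (tensor Sym Sym) :=
  slift (sml_conv (bilin_ptensor Sym Sym) sml_cls sml_cls).
Definition scounit : Lin Sym K^o := slift (@sml_const K V K^o 1).

Lemma scomulE s : ap scomul (cls s) = conv (@ptensor K Sym Sym) cls cls s.
Proof. exact: sliftE. Qed.

Lemma scounitE s : ap scounit (cls s) = const (1 : K^o) s.
Proof. exact: sliftE. Qed.

Lemma tlift_comul (W : lmodType K) (op : Sym -> Sym -> W) s : bilin op ->
  tlift op (ap scomul (cls s)) = conv op cls cls s.
Proof.
move=> bop; rewrite scomulE (lin_conv (tlift_linear bop)).
by apply: conv_eqop => x y; exact: tliftE.
Qed.

Lemma linid : linear (@id Sym). Proof. by []. Qed.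

Lemma scomulA u : tassoc (tmap (ap scomul) id (ap scomul u)) =
  tmap id (ap scomul) (ap scomul u).
Proof.
have bt X Y := bilin_ptensor (K := K) X Y.
have b1 : bilin (fun (t : tensor Sym Sym) (w : Sym) =>
    tlift (fun u v => u ⊗ (v ⊗ w)) t).
  split=> [w a x y|t a x y].
    by apply: tlift_linear; split=> [v b z z'|v b z z'];
      [exact: ptensor_l|rewrite ptensor_l; exact: ptensor_r].
  by apply: tlift_comb => p q; rewrite !ptensor_r.
have b2 : bilin (fun a b : Sym => ap scomul a ⊗ b). exact (bilin_tmap (apP scomul) linid).
have b3 : bilin (fun a b : Sym => a ⊗ ap scomul b). exact (bilin_tmap linid (apP scomul)).
move: u; apply: Sym_ext => [a x y|a x y|s].
- rewrite (apP scomul) (tmap_linear (apP scomul) linid).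
  exact: (tlift_linear b1).
- by rewrite (apP scomul) (tmap_linear linid (apP scomul)).
rewrite [tmap _ _ _]tlift_comul // [tmap id _ _]tlift_comul //.
have lt : linear (@tassoc K Sym Sym Sym) := tlift_linear b1.
rewrite (lin_conv lt).
rewrite -[RHS]/(conv (fun a b => a ⊗ ap scomul b) (id \o cls) cls s).
have E : ap scomul \o cls = conv (@ptensor K Sym Sym) cls cls.
  by apply/funext => t; exact: scomulE.
transitivity (conv (@ptensor K Sym (tensor Sym Sym)) cls (conv (@ptensor K Sym Sym) cls cls) s);
  last by rewrite -E; exact: (conv_comp _ id (ap scomul) cls cls s).
rewrite -(convA (op1 := fun t w => tlift (fun u v => u ⊗ (v ⊗ w)) t)
    (op2 := @ptensor K Sym Sym)).
- rewrite -E; apply: esym; apply: etrans (conv_comp _ (ap scomul) id cls cls s) _.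
  apply: conv_eqop => x y; rewrite /tassoc tliftE. by []. by []. 
- exact: b1.1.
- exact: (bt _ _).2.
- move=> x y z; apply: (tliftE x y (f := fun u v => u ⊗ (v ⊗ z))).
  split=> [v b p q|v b p q]; [exact: ptensor_l|rewrite ptensor_l; exact: ptensor_r].
Qed.

Lemma scomulC u : tswap (ap scomul u) = ap scomul u.
Proof.
have bt : bilin (fun u v : Sym => v ⊗ u).
  by split=> [v b z z'|v b z z']; rewrite ?ptensor_l ?ptensor_r.
move: u; apply: Sym_ext; [move=> a x y|exact: apP|move=> s].
  by rewrite (apP scomul); exact: (tlift_linear bt).
apply: etrans (tlift_comul s bt) _; rewrite scomulE; exact/esym/(convC (@ptensor K Sym Sym)).
Qed.

Lemma bilin_scounit (W : lmodType K) : bilin (fun (a : Sym) (b : W) => (ap scounit a : K) *: b).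
Proof.
have [b1 b2] := bilin_regular W.
by split=> [v a x y|u]; [rewrite (apP scounit); exact: b1|exact: b2].
Qed.

Lemma scounitl u : tlift (fun a b => (ap scounit a : K) *: b) (ap scomul u) = u.
Proof.
have bt := bilin_scounit Sym.
move: u; apply: Sym_ext => [a x y|//|s].
  by rewrite (apP scomul); exact: (tlift_linear bt).
rewrite tlift_comul //.
transitivity (conv (fun (a : K^o) (w : Sym) => (a : K) *: w) (const (1 : K^o)) cls s).
  have <- : ap scounit \o cls = const (1 : K^o) by apply/funext => t; exact: scounitE.
  exact/esym/(conv_comp _ (ap scounit) id cls cls s).
by rewrite conv_constl ?scale1r //; exact: bilin_regular.
Qed.

Lemma scounitr u : tlift (fun a b => (ap scounit b : K) *: a) (ap scomul u) = u.
Proof. 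
rewrite -{2}(scounitl u) -{2}(scomulC u).
have [b1 b2] := bilin_scounit Sym.
rewrite (lin_tlift _ _ (tlift_linear (conj b1 b2))); apply: eq_tlift => a b.
by rewrite tliftE.
Qed.

End Sym.

(** * The bialgebra of an exponential action *)

Lemma act_actC (K : fieldType) (V W : lmodType K) (opA opB : V -> W -> W) F s :
  (forall v, linear (opA v)) -> (forall v, linear (opB v)) ->
  (forall v w x, opA v (opB w x) = opB w (opA v x)) ->
  act opA (act opB F) s = act opB (act opA F) s.
Proof.
move=> lA lB E; elim: s F => [|b s IH] F //.
rewrite -![_ (b :: s)]/(der b _ s) !der_act !addE /= !actD // IH.
have -> : opA b (act opB F s) = act opB (opA b \o F) s.
  by rewrite (lin_ins (lA b)); apply: eq_ins => v t _; rewrite /= E.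
have -> : opB b (act opA F s) = act opA (opB b \o F) s.
  by rewrite (lin_ins (lB b)); apply: eq_ins => v t _; rewrite /= E.
exact: addrCA.
Qed.

(** The field [act_cls] says, in polarised form, that [v . v^n = v^(n+1)]. *)
Record action (K : fieldType) (V : lmodType K) := Action {
  actf :> V -> Sym V -> Sym V;
  act_bilin : bilin actf;
  act_coder : forall v, coderivation (ap (scomul V)) (actf v);
  act_cls : forall s, act actf (@cls K V) s = deg (@cls K V) s
}.

(** The carrier and the coalgebra do not depend on the action; the alias carries
    the product that it defines. *)
Definition Ualg (K : fieldType) (charK0 : [pchar K] =i pred0) (V : lmodType K)
  (a : action V) : Type := Sym V.
HB.instance Definition _ K charK0 V a := GRing.Lmodule.on (@Ualg K charK0 V a).

Section ActionBialgebra.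
Variables (K : fieldType) (charK0 : [pchar K] =i pred0) (V : lmodType K).
Variable (a : action V).
Local Notation U := (Ualg charK0 a).
Local Notation S := (Sym V).
Local Notation cls := (@cls K V).
Local Notation D := (ap (scomul V)).
Local Notation e := (ap (scounit V)).

Definition eflow : seq V -> Lin S S := flow charK0 (act_bilin a).

Lemma eflow_nil : eflow [::] = idL S. Proof. exact: flow_nil. Qed.
Lemma sml_eflow : sml eflow. Proof. exact: sml_flow. Qed.

(** Right multiplication by [v1 .. vn] is the coefficient of [exp] of the action:
    the average, over all orders, of the products of the operators of the
    [v_i]. *)
Definition rmul : Lin S (Lin S S) := slift sml_eflow.

Definition umul (x y : U) : U := ap (ap rmul y) x.
Definition uone : U := cls [::].
Definition ucomul (x : U) : tensor U U := D x.
Definition ucounit (x : U) : K := e x.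

Lemma umulE x s : umul x (cls s) = ap (eflow s) x.
Proof. by rewrite /umul sliftE. Qed.

Lemma umul_bilin : bilin umul.
Proof. by split=> [y|x]; [exact: apP|move=> c y y'; rewrite /umul (apP rmul)]. Qed.

Lemma eflow_one s : ap (eflow s) uone = cls s.
Proof.
have := @flow_uniq _ charK0 _ _ _ (act_bilin a) uone cls erefl.
by move=> /(_ (fun s => esym (act_cls a s))) /(congr1 (fun F => F s)).
Qed.

Lemma umul1l : left_id uone umul.
Proof.
move=> x; move: x; apply: (@Sym_ext _ _ _ (umul uone) id) => // [|s].
  exact: umul_bilin.2.
by rewrite umulE eflow_one.
Qed.

Lemma umul1r : right_id uone umul.
Proof. by move=> x; rewrite umulE eflow_nil. Qed.

Lemma ucomul_linear : linear ucomul. Proof. exact: apP. Qed.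
Lemma ucounit_linear : scalar ucounit. Proof. exact: (apP (scounit V)). Qed.

Lemma ucomul1 : ucomul uone = uone ⊗ uone.
Proof. exact: scomulE. Qed.

Lemma tmul_linear_r (mul : S -> S -> S) t : bilin mul -> linear (tmul mul t).
Proof.
move=> bm b x y; apply: tlift_comb => p q; apply: tlift_linear.
by split=> [v c z z'|v c z z']; rewrite ?bm.2 ?ptensor_l ?ptensor_r.
Qed.

Lemma ucomulM u v : ucomul (umul u v) = tmul umul (ucomul u) (ucomul v).
Proof.
have lt := tmul_linear_r (ucomul u) umul_bilin.
move: v; apply: Sym_ext => [b x y|b x y|s].
- by rewrite (umul_bilin.2 u b x y); exact: ucomul_linear.
- by rewrite (ucomul_linear b x y); exact: lt.
rewrite umulE; have E0 := @flow_comul K S ucomul ucomul_linear charK0 V a (act_bilin a) (act_coder a) u s.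
apply: (etrans E0).
rewrite [ucomul (cls s)]scomulE (lin_conv lt) -/eflow.
have E : ap rmul \o cls = eflow by apply/funext => t; exact: sliftE.
rewrite -E conv_comp; apply: conv_eqop => x y.
apply: eq_tlift => p q; rewrite tliftE //.
by split=> [z c w w'|z c w w']; rewrite umul_bilin.2 ?ptensor_l ?ptensor_r.
Qed.

Lemma ucounitM u v : ucounit (umul u v) = ucounit u * ucounit v.
Proof.
rewrite mulrC; move: v.
apply: (@Sym_ext _ _ K^o (fun v => ucounit (umul u v)) (fun v => ucounit v * ucounit u)).
- by move=> b x y; rewrite umul_bilin.2; exact: ucounit_linear.
- move=> b x y; have -> : ucounit (b *: x + y) = b * ucounit x + ucounit y.
    exact: ucounit_linear.
  by rewrite mulrDl -mulrA.
move=> s; rewrite umulE /ucounit.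
have -> : e (ap (eflow s) u) = const (e u : K^o) s.
  exact: (flow_counit (ucounit_linear) (@scounitl K V) (@scounitr K V) charK0 _ (act_coder a)).
rewrite scounitE; case: s => [|b s] /=; first by rewrite mul1r.
by rewrite mul0r.
Qed.

Lemma ucounit1 : ucounit uone = 1. Proof. exact: scounitE. Qed.

HB.instance Definition _ := isBialgebra.Build K U umul_bilin umul1l umul1r
  ucomul_linear ucounit_linear (@scomulA K V) (@scomulC K V) (@scounitl K V)
  (@scounitr K V) ucomulM ucomul1 ucounitM ucounit1.

(** The symmetric coalgebra admits all convolution inverses of operator series with
    constant term the identity. Left and right multiplications by [Sym V] are
    such series, and their inverses are the divisions. *)
Definition eflow_inv := cinv eflow.
Lemma sml_eflow_inv : sml eflow_inv.
Proof. exact: sml_cinv sml_eflow. Qed.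
Definition urdiv (x y : U) : U := ap (ap (slift sml_eflow_inv) y) x.

Definition lmul : seq V -> Lin S S := cur umul_bilin \o cls.
Lemma sml_lmul : sml lmul.
Proof. exact: (sml_comp (bilin_mkLin umul_bilin) (@sml_cls K V)). Qed.
Lemma lmul_nil : lmul [::] = idL S.
Proof. by apply: Lin_ext => x; rewrite apE; exact: umul1l. Qed.
Definition lmul_inv := cinv lmul.
Lemma sml_lmul_inv : sml lmul_inv.
Proof. exact: sml_cinv sml_lmul. Qed.
Definition uldiv (x y : U) : U := ap (ap (slift sml_lmul_inv) x) y.

Lemma uldiv_bilin : bilin uldiv.
Proof.
by split=> [y b x x'|x]; [rewrite /uldiv (apP (slift _))|exact: apP].
Qed.
Lemma urdiv_bilin : bilin urdiv.
Proof.
by split=> [y|x b y y']; [exact: apP|rewrite /urdiv (apP (slift _))].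
Qed.

Lemma ap_slift_cls (W : lmodType K) (F : seq V -> W) (sF : sml F) :
  ap (slift sF) \o cls = F.
Proof. by apply/funext => s; exact: sliftE. Qed.

Lemma counit_scale s (w : S) : ucounit (cls s) *: w = const w s.
Proof. by rewrite /ucounit scounitE; case: s => [|b s]; rewrite ?scale1r ?scale0r. Qed.

(** Convolution inverses, read in Sweedler notation. *)
Lemma sweedler_inverse (F G : S -> Lin S S) (w : S) (u : S) :
  linear F -> linear G ->
  conv (@cmp _ _ _ _) (F \o cls) (G \o cls) = const (idL S) ->
  tlift (fun x y => ap (F x) (ap (G y) w)) (D u) = ucounit u *: w.
Proof.
move=> lF lG E.
have lGw : linear (fun y => ap (G y) w) by move=> b y y'; rewrite lG.
have bop : bilin (fun x y => ap (F x) (ap (G y) w)).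
  split=> [y b x x'|x]; first by rewrite lF.
  exact: (comp_lin (apP (F x)) lGw).
move: u; apply: Sym_ext => [b x y|b x y|s].
- by rewrite (apP (scomul V) b x y); exact: (tlift_linear bop).
- have -> : ucounit (b *: x + y) = b * ucounit x + ucounit y by exact: ucounit_linear.
  by rewrite scalerDl scalerA.
rewrite tlift_comul // counit_scale.
have := congr1 (fun H => ap (H s) w) E => /=.
rewrite conv_comp (lin_conv (f := fun h : Lin S S => ap h w)) // => ->.
by case: s.
Qed.

Lemma uldivK u v : tlift (fun x y => uldiv x (bmul y v)) (ucomul u) = ucounit u *: v.
Proof.
apply: (@sweedler_inverse (ap (slift sml_lmul_inv)) (cur umul_bilin)); first exact: apP.
  exact: bilin_mkLin.
by rewrite ap_slift_cls; apply: cinv_l; exact: lmul_nil.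
Qed.

Lemma uldivVK u v : tlift (fun x y => bmul x (uldiv y v)) (ucomul u) = ucounit u *: v.
Proof.
apply: (@sweedler_inverse (cur umul_bilin) (ap (slift sml_lmul_inv))); last 1 first.
- by rewrite ap_slift_cls; apply: cinv_r; exact: lmul_nil.
- exact: bilin_mkLin.
- exact: apP.
Qed.

Lemma tlift_ucomulC (W : lmodType K) (op : S -> S -> W) u : bilin op ->
  tlift op (D u) = tlift (fun x y => op y x) (D u).
Proof.
move=> [b1 b2]; rewrite -[in LHS]scomulC (lin_tlift _ _ (tlift_linear (conj b1 b2))).
by apply: eq_tlift => x y; rewrite tliftE.
Qed.

Lemma sweedler_inverse_op (F G : S -> Lin S S) (w : S) (u : S) :
  linear F -> linear G ->
  conv (@cmp _ _ _ _) (F \o cls) (G \o cls) = const (idL S) ->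
  tlift (fun x y => ap (F y) (ap (G x) w)) (D u) = ucounit u *: w.
Proof.
move=> lF lG E; rewrite -(sweedler_inverse w u lF lG E).
have lGw : linear (fun y => ap (G y) w) by move=> b y y'; rewrite lG.
apply/esym/tlift_ucomulC; split=> [y b x x'|x]; first by rewrite lF.
exact: (comp_lin (apP (F x)) lGw).
Qed.

Lemma urdivK u v : tlift (fun x y => urdiv (bmul u x) y) (ucomul v) = ucounit v *: u.
Proof.
apply: (@sweedler_inverse_op (ap (slift sml_eflow_inv)) (ap rmul)); [exact: apP|exact: apP|].
by rewrite !ap_slift_cls; apply: cinv_l; exact: eflow_nil.
Qed.

Lemma urdivVK u v : tlift (fun x y => bmul (urdiv u x) y) (ucomul v) = ucounit v *: u.
Proof.
apply: (@sweedler_inverse_op (ap rmul) (ap (slift sml_eflow_inv))); [exact: apP|exact: apP|].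
by rewrite !ap_slift_cls; apply: cinv_r; exact: eflow_nil.
Qed.

HB.instance Definition _ := isNaHopf.Build K U uldiv_bilin urdiv_bilin
  uldivK uldivVK urdivK urdivVK.

Lemma post_eflow s : act (post (act_bilin a) (U := S)) eflow s = deg eflow s.
Proof.
apply: Lin_ext => w; have := deg_flow charK0 (act_bilin a) w s => E; apply: etrans (esym E).
exact: (lin_ins (f := fun h : Lin S S => ap h w)).
Qed.

(** The generic vector commutes with its own exponential. Counting in two ways
    the products with two distinguished factors, one at each end, reduces the
    claim for degree [n + 2] to degree [n + 1]. *)
Lemma pre_eflow s :
  act (fun v f => cmp f (cur (act_bilin a) v)) eflow s = deg eflow s.
Proof.
have bc := @bilin_cmp K S S S.
set pre := fun v f => _; set io := act_bilin a.
have lpre v : linear (pre v) := bc.1 _.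
have lpost v : linear (post io (U := S) v) := (bilin_post io S).2 v.
(* The case of one entry is separate: there the recursion would divide by 0. *)
have [n] := ubnP (size s); elim: n s => // n IH [|b [|c s]] /= sn.
- by rewrite /deg scale0r.
- by rewrite /act /= addr0 -post_eflow /act /= addr0 eflow_nil /pre /post cmp1l cmp1r.
set t := b :: c :: s.
apply: (scalerI (natK_neq0 charK0 (size s))).
have E1 : act pre (act (post io (U := S)) eflow) t = (size s).+1%:R *: act pre eflow t.
  rewrite -insZ; apply: eq_ins => v r [Er]; rewrite -(linZ (lpre v)).
  by rewrite post_eflow /deg -Er.
have E2 : act (post io (U := S)) (act pre eflow) t = (size s).+1%:R *: deg eflow t.
  rewrite -post_eflow -insZ; apply: eq_ins => v r [Er]; rewrite -(linZ (lpost v)).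
  by rewrite IH /deg -?Er //.
rewrite -E1 -E2; apply: act_actC => [||v w f]; [exact: lpre|exact: lpost|exact: cmpA].
Qed.

(** [exp(a) exp(n a) = exp((n + 1) a)]; as a series in [a], [exp(n a)] has the
    coefficients of [exp a] multiplied by [n ^ size]. *)
Lemma conv_eflow n x s :
  conv (@ap _ _ _) eflow (fun t => (n ^ size t)%:R *: ap (eflow t) x) s =
  (n.+1 ^ size s)%:R *: ap (eflow s) x.
Proof.
have ba := @bilin_ap K S S.
pose G m t : S := (m ^ size t)%:R *: ap (eflow t) x.
have degG m t : deg (G m) t = m%:R *: act a (G m) t.
  rewrite /deg /G scalerA [_ * _]mulrC -scalerA.
  have := deg_flow charK0 (act_bilin a) x t => E; rewrite [X in _ *: X]E -!insZ.
  apply: eq_ins => v r ->; rewrite (linZ ((act_bilin a).2 v)) scalerA -natrM.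
  by rewrite expnS.
pose op v w := n.+1%:R *: a v w.
have lop v : linear (op v).
  by move=> c y z; rewrite /op (act_bilin a).2 scalerDr !scalerA [c * _]mulrC.
suff -> : conv (@ap _ _ _) eflow (G n) = G n.+1 by [].
apply: (deg_unique charK0 (op := op)) => [|t|t].
- by rewrite /= /G !expn0 !scale1r eflow_nil.
- rewrite deg_conv //.
  have -> : deg (G n) = n%:R *: act a (G n) by apply/funext; exact: degG.
  rewrite convZr // (conv_act (op1 := fun v f => cmp f (cur (act_bilin a) v))) //.
  have -> : act (fun v f => cmp f (cur (act_bilin a) v)) eflow = deg eflow.
    by apply/funext; exact: pre_eflow.
  rewrite addrC -[X in _ + X]scale1r -scalerDl natr1.
  rewrite [RHS]insZ; congr (_ *: _).
  have -> : deg eflow = act (post (act_bilin a) (U := S)) eflow.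
    by apply/funext => r; rewrite post_eflow.
  apply/esym/etrans; first apply: (act_conv (op := @ap K S S) (op1 := post (act_bilin a) (U := S)) (op2 := fun _ _ => 0)) => //.
    exact: (act_bilin a).2.
    by move=> v f y; rewrite (lin0 (apP _)) addr0.
  have -> : act (fun _ _ => 0) (G n) = 0 :> (seq V -> S) by apply/funext => u; exact: ins0.
  by rewrite conv0r // addr0.
- by rewrite degG -insZ.
Qed.

Lemma comuln_linear (B : bialgType K) n : linear (@comuln K B n).
Proof.
elim: n => [|n IH]; first exact: (@counit_linear K B).
by move=> c x y /=; rewrite comul_linear; apply: tmap_linear.
Qed.

Lemma mulRn_linear (B : bialgType K) n x : linear (@mulRn K B n x).
Proof.
elim: n => [|n IH] /=; first by move=> c y z; rewrite scalerDl scalerA.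
apply: tlift_linear; split=> [y c u v|u]; last exact: bmul_bilin.2.
by rewrite IH bmul_bilin.1.
Qed.

Lemma mulRn_cls n (x : U) s :
  mulRn x (comuln n (cls s : U)) = (n ^ size s)%:R *: ap (eflow s) x.
Proof.
elim: n s => [|n IH] s.
  rewrite /= -[counit _]/(e (cls s)) scounitE.
  by case: s => [|b s]; rewrite /= ?scale1r ?eflow_nil // exp0n // !scale0r.
have bm : bilin (fun t y : U => bmul (mulRn x (comuln n t)) y).
  split=> [y c u v|u]; last exact: bmul_bilin.2.
  by rewrite comuln_linear mulRn_linear bmul_bilin.1.
have bm1 : bilin (fun t (y : U) => bmul (@mulRn K U n x t) y).
  split=> [y c u v|u]; last exact: bmul_bilin.2.
  by rewrite mulRn_linear bmul_bilin.1.
rewrite [LHS]/= tlift_tmap //; last exact: comuln_linear.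
apply: etrans (tlift_comul s bm) _.
rewrite -conv_eflow convC.
have -> : (fun t => (n ^ size t)%:R *: ap (eflow t) x) = (fun y => mulRn x (comuln n (y : U))) \o cls.
  by apply/funext => t; rewrite /= IH.
have <- : ap rmul \o cls = eflow by apply/funext => t; exact: sliftE.
exact/esym/(conv_comp (@ap K S S) (ap rmul) (fun y => mulRn x (comuln n (y : U))) cls cls s).
Qed.

Lemma Ualg_monoalt : right_monoalternative U.
Proof.
move=> x y n; move: y; apply: Sym_ext => [c y z|c y z|s].
- by rewrite comuln_linear mulRn_linear.
- by rewrite comuln_linear mulRn_linear bmul_bilin.2.
rewrite !mulRn_cls eflow_one.
rewrite (bilZr (@bmul_bilin K U)); congr (_ *: _).
exact/esym/umulE.
Qed.

End ActionBialgebra.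

(** * Vector fields on the symmetric coalgebra *)

Section VectorFieldsOnSym.
Variables (K : fieldType) (charK0 : [pchar K] =i pred0) (V : lmodType K).
Local Notation S := (Sym V).
Local Notation cls := (@cls K V).
Local Notation D := (ap (scomul V)).

Lemma dder_zero_field (W : lmodType K) (F : seq V -> W) s : sml F -> dder 0 F s = 0.
Proof.
move=> sF; apply: (@addrI _ (dder 0 F s)); by rewrite -dderD // !addr0.
Qed.

Lemma dder_const_field (W : lmodType K) b (F : seq V -> W) s : sml F ->
  dder (const b) F s = F (b :: s).
Proof.
elim: s F => [|c s IH] F sF //=.
rewrite der_const dder_zero_field // add0r IH; last exact: sml_der.
exact: (sF.2 [::]).
Qed.

(** The generic vector, as a vector field, is the Euler field. *)
Lemma dder_var_field (W : lmodType K) (F : seq V -> W) s : sml F ->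
  dder (@var K V) F s = deg F s.
Proof.
elim: s F => [|b s IH] F sF.
  by rewrite /deg scale0r /=; exact: (lin0 (sml_lin sF)).
rewrite /= der_var dder_const_field // IH; last exact: sml_der.
by rewrite -[RHS]/(der b (deg F) s) der_deg.
Qed.

Lemma dder_ins (W : lmodType K) (Xi : V -> seq V -> V) (F : seq V -> W) s : sml F ->
  ins (fun v t => dder (Xi v) F t) s = dder (ins Xi) F s.
Proof.
elim: s Xi F => [|b s IH] Xi F sF /=; first exact/esym/(lin0 (sml_lin sF)).
rewrite der_ins dderD // -!addrA; congr (_ + _).
rewrite -(IH (fun v => der b (Xi v))) // -(IH Xi); last exact: sml_der.
exact: insD.
Qed.

Lemma ins_cons (W : lmodType K) (F : seq V -> W) s : sml F ->
  ins (fun v t => F (v :: t)) s = deg F s.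
Proof.
elim: s F => [|b s IH] F sF; first by rewrite /deg scale0r.
rewrite -[RHS]/(der b (deg F) s) der_deg addE -IH; last exact: sml_der.
by rewrite /=; congr (_ + _); apply: eq_ins => v t _; apply: (sF.2 [::]).
Qed.

Section Field.
Variables (eta : seq V -> V) (se : sml eta).
Definition vf : Lin S S := slift (sml_dder se (@sml_cls K V)).
Lemma vfE s : ap vf (cls s) = dder eta cls s. Proof. exact: sliftE. Qed.

Lemma vf_comp (W : lmodType K) (f : Lin S W) s : ap f (ap vf (cls s)) = dder eta (ap f \o cls) s.
Proof. by rewrite vfE (lin_dder (apP f)). Qed.

Lemma vf_coder : coderivation D (ap vf).
Proof.
have ll : linear (@id S) by [].
split=> [|u]; first exact: apP.
move: u; apply: Sym_ext => [||s].
- exact: (comp_lin (apP (scomul V)) (apP vf)).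
- move=> c x y; rewrite (apP (scomul V)) (tmap_linear (apP vf) ll).
  by rewrite (tmap_linear ll (apP vf)) scalerDr addrACA.
have E : ap vf \o cls = dder eta cls by apply/funext => t; exact: vfE.
rewrite vf_comp.
have -> : D \o cls = conv (@ptensor K S S) cls cls by apply/funext => t; exact: scomulE.
rewrite dder_conv; last exact: bilin_ptensor.
rewrite -E scomulE (lin_conv (tmap_linear (apP vf) ll)) (lin_conv (tmap_linear ll (apP vf))).
congr (_ + _).
  apply: etrans (conv_comp _ (ap vf) id cls cls s) _.
  by apply: conv_eqop => x y; rewrite tmapE //; exact: apP.
apply: etrans (conv_comp _ id (ap vf) cls cls s) _.
by apply: conv_eqop => x y; rewrite tmapE //; exact: apP.
Qed.
End Field.

(** Multiplication by a vector is the constant vector field. The exponential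
    action it defines makes [Ualg] the symmetric algebra. *)
Definition smul (v : V) : S -> S := ap (vf (@sml_const K V V v)).

Lemma smulE v s : smul v (cls s) = cls (v :: s).
Proof. by rewrite /smul vfE dder_const_field //; exact: sml_cls. Qed.

Lemma smul_bilin : bilin smul.
Proof.
split=> [u c v w|v]; last exact: apP.
move: u; apply: Sym_ext => [||s]; first exact: apP.
  exact: (lin_spaceL c (apP (vf (@sml_const K V V v))) (apP (vf (@sml_const K V V w)))).
by rewrite !smulE; exact: ((@sml_cls K V).1 [::]).
Qed.

Lemma smul_cls s : act smul cls s = deg cls s.
Proof.
rewrite -ins_cons; last exact: sml_cls.
by apply: eq_ins => v t _; exact: smulE.
Qed.

Definition sym_action : action V :=
  Action smul_bilin (fun v => vf_coder (@sml_const K V V v)) smul_cls.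

Local Notation U0 := (Ualg charK0 sym_action).

Lemma sml_cat (W : lmodType K) (F : seq V -> W) t : sml F -> sml (fun s => F (s ++ t)).
Proof.
by move=> sF; split=> [s1 s2 c x y|s1 s2 x y]; rewrite -!catA; [exact: sF.1|exact: sF.2].
Qed.

Lemma umul_cls t s : umul (cls t : U0) (cls s) = cls (s ++ t).
Proof.
rewrite umulE -[LHS]/(evs (flow charK0 smul_bilin) (cls t) s).
suff <- : (fun r => cls (r ++ t)) = evs (flow charK0 smul_bilin) (cls t) by [].
apply: flow_uniq => // r; rewrite -ins_cons; last exact: sml_cat (@sml_cls K V).
by apply: eq_ins => v q _; rewrite smulE.
Qed.

Lemma umulC : commutative (@umul _ charK0 _ sym_action).
Proof.
move=> x y; move: x; apply: Sym_ext => [||s].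
- exact: (umul_bilin charK0 sym_action).1.
- exact: (umul_bilin charK0 sym_action).2.
move: y; apply: Sym_ext => [||t].
- exact: (umul_bilin charK0 sym_action).2.
- exact: (umul_bilin charK0 sym_action).1.
rewrite !umul_cls; apply: sml_perm; first exact: sml_cls.
by rewrite perm_catC.
Qed.

Lemma umulA : associative (@umul _ charK0 _ sym_action).
Proof.
have bm := umul_bilin charK0 sym_action.
move=> x y z; move: x; apply: Sym_ext => [||s].
- exact: bm.1.
- exact: (comp_lin (bm.1 z) (bm.1 y)).
move: y; apply: Sym_ext => [||t].
- exact: (comp_lin (bm.2 (cls s)) (bm.1 z)).
- exact: (comp_lin (bm.1 z) (bm.2 (cls s))).
move: z; apply: Sym_ext => [||r].
- exact: (comp_lin (bm.2 (cls s)) (bm.2 (cls t))).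
- exact: bm.2.
by rewrite !umul_cls catA.
Qed.

Lemma cls1_linear : linear (fun v => cls [:: v]).
Proof. exact: sml_lin (@sml_cls K V). Qed.

Lemma cls1_comul v : D (cls [:: v]) = cls [:: v] ⊗ cls [::] + cls [::] ⊗ cls [:: v].
Proof. exact: scomulE. Qed.

Lemma sml_prod (A : comAlgType K) (f : V -> A) : linear f ->
  sml (fun s => \prod_(v <- s) f v).
Proof.
move=> lf; split=> [s1 s2 c x y|s1 s2 x y]; rewrite !big_cat /= !big_cons.
  by rewrite lf mulrDl mulrDr -scalerAl -scalerAr.
by congr (_ * _); rewrite mulrCA.
Qed.

Lemma sym_symmetric : is_symmetric_bialgebra (S := U0) (fun v => cls [:: v] : U0).
Proof.
have bm := umul_bilin charK0 sym_action.
split; [exact: umulA|exact: umulC|exact: cls1_linear|exact: cls1_comul|].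
move=> A f lf; have sP := sml_prod lf.
exists (ap (slift sP)); split.
  split; [exact: apP| | |].
  - move=> u v; move: u; apply: Sym_ext => [|c x y|s].
    + exact: (comp_lin (apP (slift sP)) (bm.1 v)).
    + by rewrite (apP (slift sP) c x y) mulrDl -scalerAl.
    move: v; apply: Sym_ext => [|c x y|t].
    + exact: (comp_lin (apP (slift sP)) (bm.2 (cls s))).
    + by rewrite (apP (slift sP) c x y) mulrDr -scalerAr.
    rewrite -[bmul _ _]/(umul (cls s : U0) (cls t)) umul_cls !sliftE big_cat /=.
    by rewrite mulrC.
  - by rewrite -[bone]/(cls [::]) sliftE big_nil.
  - by move=> v; rewrite sliftE big_seq1.
move=> g [lg gM g1 gf]; apply/funext; apply: Sym_ext => [||s]; [exact: apP|exact: lg|].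
rewrite sliftE; elim: s => [|v s IH]; first by rewrite big_nil.
rewrite big_cons IH -gf -gM; congr (g _).
by rewrite -[bmul _ _]/(umul (cls [:: v] : U0) (cls s)) umul_cls;
  apply: sml_perm; [exact: sml_cls|rewrite perm_catC].
Qed.

Lemma Ualg_connected (a : action V) : connected (Ualg charK0 a).
Proof.
exists V, U0, (fun v => cls [:: v] : U0); split; first exact: sym_symmetric.
exists (fun x : U0 => x : Ualg charK0 a), (fun x : Ualg charK0 a => x : U0); split=> //.
  by split=> // u; rewrite -[RHS]/(tmap id id (D u)) tmap_id.
by split=> // u; rewrite -[RHS]/(tmap id id (D u)) tmap_id.
Qed.

(** On [Sym V], multiplying the linear part of [u_(1)] with [u_(2)] is the Euler
    operator [E]. On a primitive [u] it returns the linear part of [u], so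
    [E u] and [E] of that part agree, and [E] is injective up to constants. *)
Lemma Sym_primitive (u : S) : D u = u ⊗ cls [::] + cls [::] ⊗ u ->
  exists v, u = cls [:: v].
Proof.
move=> pu'.
pose pr1 : Lin S V := slift (@sml_var K V).
have pr1E s : ap pr1 (cls s) = var s by exact: sliftE.
exists (ap pr1 u).
have sd : sml (deg cls).
  by rewrite (_ : deg cls = act smul cls); [apply: sml_act; [exact: smul_bilin|exact: sml_cls]|
    apply/funext => s; rewrite smul_cls].
pose E : Lin S S := slift sd.
pose J : Lin S S := slift (sml_size (F := fun n s => n%:R^-1 *: cls s)
   (fun n => smlZ n%:R^-1 (@sml_cls K V))).
have bop : bilin (fun x y => smul (ap pr1 x) y).
  split=> [y c x z|x]; first by rewrite (apP pr1) smul_bilin.1.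
  exact: smul_bilin.2.
have euler x : tlift (fun x y => smul (ap pr1 x) y) (D x) = ap E x.
  move: x; apply: Sym_ext => [c x y||s]; last 1 first.
  - rewrite tlift_comul // sliftE -dder_var_field; last exact: sml_cls.
    rewrite dder_sub; last exact: sml_cls.
    have <- : ap pr1 \o cls = @var K V by apply/funext => t; exact: pr1E.
    have -> : (fun t b => cls (b :: t)) = (fun w b => smul b w) \o cls.
      by apply/funext => t; apply/funext => b; rewrite /= smulE.
    apply/esym/etrans; first exact: (conv_comp _ (fun w b => smul b w) (ap pr1) cls cls s).
    exact: convC.
  - by rewrite (apP (scomul V) c x y); exact: (tlift_linear bop).
  - exact: apP.
have JE x : ap J (ap E x) = x - (ap (scounit V) x : K) *: cls [::].
  have [_ b2] := bilin_scounit V S; have [b1 _] := bilin_scounit V S.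
  move: x; apply: Sym_ext => [||s]; first exact: (comp_lin (apP J) (apP E)).
    move=> c x y; rewrite (b1 (cls [::]) c x y) scalerBr opprD addrACA //.
  rewrite sliftE /deg (linZ (apP J)) sliftE scounitE; case: s => [|b s] /=.
    by rewrite scale0r scale1r subrr.
  by rewrite scalerA divff ?natK_neq0 // scale1r scale0r subr0.
have e1 v : (ap (scounit V) (cls [:: v]) : K) = 0 by rewrite scounitE.
have eu : (ap (scounit V) u : K) = 0.
  have bs := bilin_scounit V S.
  have e0 : u = (ap (scounit V) u : K) *: cls [::] + (ap (scounit V) (cls [::]) : K) *: u.
    rewrite -[in LHS](scounitl u).
    rewrite pu' (linD (tlift_linear bs)); congr (_ + _); exact: (tliftE _ _ bs).
  move: e0; rewrite scounitE scale1r => /eqP; rewrite -subr_eq0 opprD addrCA subrr addr0.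
  rewrite oppr_eq0 => /eqP /(congr1 (ap (scounit V))).
  by rewrite (linZ (apP (scounit V))) scounitE (lin0 (apP _)) -[_ *: _]/(_ * 1) mulr1.
have Eu : ap E u = ap E (cls [:: ap pr1 u]).
  rewrite -euler pu' (linD (tlift_linear bop)).
  have t1 : tlift (fun x y => smul (ap pr1 x) y) (u ⊗ cls [::]) = smul (ap pr1 u) (cls [::]).
    exact: (tliftE u (cls [::]) bop).
  have t2 : tlift (fun x y => smul (ap pr1 x) y) (cls [::] ⊗ u) = smul (ap pr1 (cls [::])) u.
    exact: (tliftE (cls [::]) u bop).
  have z : smul (ap pr1 (cls [::])) u = 0 by rewrite pr1E; exact: (bil0l smul_bilin).
  apply: etrans (congr2 +%R t1 (etrans t2 z)) _.
  rewrite smulE sliftE addr0.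
  exact/esym/scale1r.
have := JE u; rewrite Eu JE eu e1 !scale0r !subr0 => E0.
exact: esym E0.
Qed.

Lemma Ualg_primitive (a : action V) (u : Ualg charK0 a) : primitive u ->
  exists v, u = cls [:: v].
Proof. exact: Sym_primitive. Qed.

End VectorFieldsOnSym.

(** * Triples and their bialgebras *)

Lemma conv_top (K : fieldType) (V A B W : lmodType K) (op : A -> B -> W)
    (F : seq V -> A) (G : seq V -> B) s :
  bilin op -> (forall t, (size t < size s)%N -> F t = 0) ->
  conv op F G s = op (F s) (G [::]).
Proof.
move=> bop; elim: s F G => [|b s IH] F G F0 //=.
rewrite IH => [|t ts]; last by rewrite /der F0.
have -> : conv op F (der b G) s = conv op 0 (der b G) s.
  by apply: conv_eq => // t ts; rewrite F0.
by rewrite conv0l // addr0.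
Qed.

(** If [F] starts in degree [n] and [G] in degree [1], then in degree [n + 1] only
    the linear part of [G] contributes. *)
Lemma conv_low (K : fieldType) (V A B W : lmodType K) (op : A -> B -> W)
    (F : seq V -> A) (G : seq V -> B) n s :
  bilin op -> G [::] = 0 -> (forall t, (size t < n)%N -> F t = 0) -> size s = n.+1 ->
  conv op F G s = ins (fun v t => op (F t) (G [:: v])) s.
Proof.
move=> bop G0; elim: s F n => [|b s IH] F n // F0 [Es] /=.
rewrite addrC; congr (_ + _).
  by rewrite conv_top // => t; rewrite Es; exact: F0.
case: s Es IH => [|c s] Es IH; first by rewrite /= G0 (bil0r bop).
case: n Es F0 => // n [Es] F0; rewrite (IH (der b F) n) //= ?Es // => t tn.
exact: F0.
Qed.

Section TripleAction.
Variables (K : fieldType) (charK0 : [pchar K] =i pred0) (tau : triple K).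

Definition cT : lmodType K := sp_type (tc tau).
Definition inc : cT -> tau := fun v => \val v.

Lemma inc_linear : linear inc. Proof. by []. Qed.
Lemma inc_c v : inc v \in tc tau. Proof. exact: (valP v). Qed.
Lemma inc_inj : injective inc. Proof. exact: val_inj. Qed.

Lemma pr_exists (x : tau) : {v : cT | x - inc v \in ts tau}.
Proof.
apply: cid; have [s [c [ss cc ->]]] := triple_cover x.
by exists (exist _ c cc); rewrite addrK.
Qed.

Definition pr (x : tau) : cT := sval (pr_exists x).

Lemma pr_s x : x - inc (pr x) \in ts tau.
Proof. exact: (svalP (pr_exists x)). Qed.

Lemma pr_uniq x v : x - inc v \in ts tau -> pr x = v.
Proof.
move=> xv; apply: inc_inj; apply/eqP; rewrite -subr_eq0; apply/eqP.
apply: triple_direct; last by rewrite rpredB ?inc_c.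
by rewrite -(subrK x (inc (pr x))) -addrA rpredD // -opprB rpredN pr_s.
Qed.

Lemma incK : cancel inc pr.
Proof. by move=> v; apply: pr_uniq; rewrite subrr rpred0. Qed.

Lemma pr_linear : linear pr.
Proof.
move=> a x y; apply: pr_uniq; rewrite inc_linear opprD addrACA -scalerBr.
by rewrite rpredD ?rpredZ ?pr_s.
Qed.

Lemma pr_eq0 x : pr x = 0 <-> x \in ts tau.
Proof.
split=> [E|xs]; first by have := pr_s x; rewrite E (lin0 inc_linear) subr0.
by apply: pr_uniq; rewrite (lin0 inc_linear) subr0.
Qed.

Lemma pr_lie x y : pr x = 0 -> pr y = 0 -> pr (lie x y) = 0.
Proof. by move=> /pr_eq0 xs /pr_eq0 ys; apply/pr_eq0; exact: lsub_lie. Qed.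

Local Notation S := (Sym cT).
Local Notation cls := (@cls K cT).

Definition field (x : tau) : seq cT -> cT := evs (fund charK0 inc_linear pr_linear) x.

Lemma sml_field x : sml (field x).
Proof. exact/sml_evs/sml_fund. Qed.

Definition iotaS (x : tau) : S -> S := ap (vf (sml_field x)).

Lemma iotaSE x s : iotaS x (cls s) = dder (field x) cls s.
Proof. exact: vfE. Qed.

Lemma iotaS_bilin : bilin iotaS.
Proof.
split=> [u a x y|x]; last exact: apP.
move: u; apply: Sym_ext => [||s]; first exact: apP.
  exact: (lin_spaceL a (apP (vf (sml_field x))) (apP (vf (sml_field y)))).
rewrite !iotaSE -dderL; last exact: sml_cls.
congr dder; apply/funext => t; exact: apP.
Qed.

(** Composition of operators on [Sym c] reverses the order of the vector fields,
    which compensates the order in [fund_comm]. *)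
Lemma iotaS_lie x y u : iotaS (lie x y) u = iotaS x (iotaS y u) - iotaS y (iotaS x u).
Proof.
move: u; apply: Sym_ext => [||s]; first exact: apP.
  move=> c u v; rewrite /iotaS !apP scalerBr opprD addrACA //.
rewrite [X in X - _]vf_comp [X in _ - X]vf_comp.
have E z : ap (vf (sml_field z)) \o cls = dder (field z) cls by apply/funext => t; exact: vfE.
rewrite !E dder_comm; last exact: sml_cls.
rewrite iotaSE /field fund_comm //; [exact: incK|exact: pr_lie].
Qed.

Lemma iotaS_one x : iotaS x (cls [::]) = cls [:: pr x].
Proof. by rewrite iotaSE. Qed.

Lemma iotaS_cls s : act (fun v => iotaS (inc v)) cls s = deg cls s.
Proof.
transitivity (ins (fun v t => dder (field (inc v)) cls t) s).
  by apply: eq_ins => v t _; exact: iotaSE.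
have sc := @sml_cls K cT; rewrite dder_ins // -dder_var_field //.
congr dder; apply/funext => t; apply: fund_var; exact: incK.
Qed.

Lemma iotaS_inc_bilin : bilin (fun v => iotaS (inc v)).
Proof. by split=> [u a v w|v]; [rewrite inc_linear iotaS_bilin.1|exact: apP]. Qed.

Definition triple_action : action cT :=
  Action iotaS_inc_bilin (fun v => vf_coder (sml_field (inc v))) iotaS_cls.

Definition Utau : naHopfType K := Ualg charK0 triple_action.

Lemma iota_in_coder x : @in_coder K Utau (iotaS x).
Proof. exact: vf_coder. Qed.

Definition iotaT (x : tau) : triple_of Utau := mk_coder (iota_in_coder x).

Lemma iotaTE x u : coder_fun (iotaT x) u = iotaS x u. Proof. by []. Qed.

Lemma umul_cls1 (u : Utau) v : bmul u (cls [:: v] : Utau) = iotaS (inc v) u.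
Proof.
rewrite -[LHS]/(umul (a := triple_action) (charK0 := charK0) u (cls [:: v])) umulE.
exact: (flow1 charK0 (act_bilin triple_action)).
Qed.

Lemma at1_iota v : at1 (iotaT (inc v)) = cls [:: v].
Proof. by rewrite /at1 iotaTE -[bone]/(cls [::]) iotaS_one incK. Qed.

Lemma iota_hom : is_triple_hom iotaT.
Proof.
split=> [a x y|x y|x /pr_eq0 px|x xc].
- by apply: coder_eq => u; rewrite iotaTE iotaS_bilin.1.
- by apply: coder_eq => u; rewrite iotaTE iotaS_lie.
- apply/s_coderP; rewrite iotaTE -[bone]/(cls [::]) iotaS_one px.
  exact: (lin0 (@cls1_linear K cT)).
apply/c_coderP; exists (cls [:: exist _ x xc] : Utau); split.
  exact: (@cls1_comul K cT).
by move=> u; rewrite umul_cls1.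
Qed.

Lemma iota_inj : {in tc tau &, injective iotaT}.
Proof.
move=> x y xc yc E; pose vx : cT := exist _ x xc; pose vy : cT := exist _ y yc.
have Ea : at1 (iotaT (inc vx)) = at1 (iotaT (inc vy)) by exact: (congr1 (@at1 K Utau) E).
have Ec : cls [:: vx] = cls [:: vy].
  by apply: etrans (esym (at1_iota vx)) _; apply: etrans Ea _; exact: at1_iota.
suff Ev : vx = vy by exact: (congr1 inc Ev).
have L v : ap (slift (@sml_var K cT)) (cls [:: v]) = v by rewrite sliftE.
by rewrite -(L vx) Ec L.
Qed.

Lemma iota_surj (f : triple_of Utau) : f \in tc (triple_of Utau) ->
  exists2 c : tau, c \in tc tau & iotaT c = f.
Proof.
move=> /c_coderP[a [pa Ef]]; have [v Ev] := Ualg_primitive pa.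
exists (inc v); first exact: inc_c.
by apply: coder_eq => u; rewrite Ef Ev umul_cls1.
Qed.

Section Universal.
Variables (B : bialgType K) (iota' : tau -> triple_of B).
Hypotheses (mB : right_monoalternative B) (hi : is_triple_hom iota').

Let rho (x : tau) (n : B) : B := coder_fun (iota' x) n.

Lemma rho_bilin : bilin rho.
Proof.
case: hi => li _ _ _; split=> [n a x y|x]; last exact: (coderP (iota' x)).1.
by rewrite /rho li.
Qed.

Lemma rho_lie x y n : rho (lie x y) n = rho x (rho y n) - rho y (rho x n).
Proof. by case: hi => _ ll _ _; rewrite /rho ll. Qed.

Lemma rho_s x : pr x = 0 -> rho x bone = 0.
Proof. by case: hi => _ _ hs _ /pr_eq0 /hs /s_coderP. Qed.

Let io' (v : cT) (n : B) : B := rho (inc v) n.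

Lemma io_mul v n : io' v n = bmul n (io' v bone).
Proof.
case: hi => _ _ _ hc; have /hc /c_coderP[a [_ E]] := inc_c v.
by rewrite /io' /rho !E bmul1l.
Qed.

Let E := exprho charK0 inc_linear rho_bilin.

(** The exponential of the action of [c] on [B], applied to the unit. *)
Definition psi : Lin S B := slift (sml_evs bone (sml_flow charK0 (bilin_io inc_linear rho_bilin))).

Lemma psiE s : ap psi (cls s) = evs E bone s.
Proof. exact: sliftE. Qed.

Lemma psi_one : ap psi (cls [::]) = bone.
Proof. by rewrite psiE; exact: evs_flow_nil. Qed.

Lemma psi_cls1 v : ap psi (cls [:: v]) = io' v bone.
Proof. by rewrite psiE; exact: flow1. Qed.

Lemma psi_equiv x u : ap psi (iotaS x u) = rho x (ap psi u).
Proof.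
move: u; apply: Sym_ext => [||s].
- exact: (comp_lin (apP psi) (apP _)).
- exact: (comp_lin (rho_bilin.2 x) (apP psi)).
rewrite vf_comp.
have -> : ap psi \o cls = evs E bone by apply/funext => t; exact: psiE.
rewrite psiE; apply: dder_exprho; [exact: incK|exact: rho_lie|exact: rho_s].
Qed.

Lemma rho_coder x : coderivation (@comul K B) (rho x).
Proof. exact: coderP. Qed.

Lemma psi_coalg : coalg_morph (ap psi : Utau -> B).
Proof.
split; first exact: apP.
  move=> u; move: u; apply: Sym_ext => [||s].
  - exact: (comp_lin (@comul_linear K B) (apP psi)).
  - exact: (comp_lin (tmap_linear (apP psi) (apP psi)) (apP (scomul cT))).
  rewrite psiE -[comul (cls s : Utau)]/(ap (scomul cT) (cls s)) scomulE.
  rewrite (lin_conv (tmap_linear (apP psi) (apP psi))).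
  have H := @flow_comul K B (@comul K B) (@comul_linear K B) charK0 cT _
    (bilin_io inc_linear rho_bilin) (fun v => rho_coder (inc v)) bone s.
  apply: etrans H _; rewrite comul1.
  rewrite -[RHS](conv_eqop (op := fun x y => ap psi x ⊗ ap psi y)); last first.
    by move=> x y; rewrite tmapE //; exact: apP.
  rewrite -[RHS](conv_comp (@ptensor K B B) (ap psi) (ap psi) cls cls s).
  have -> : ap psi \o cls = (fun f : Lin B B => ap f bone) \o E by apply/funext => t; exact: psiE.
  rewrite conv_comp; apply: conv_eqop => f g.
  by rewrite tmapE //; exact: apP.
apply: (@Sym_ext _ _ K^o (fun u => counit (ap psi u)) (fun u => ap (scounit cT) u)).
- by move=> a x y; rewrite (apP psi a x y) (@counit_linear K B a).
- exact: apP.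
move=> s; rewrite psiE scounitE.
have H := @flow_counit K B (@comul K B) (@counit K B) (@counit_linear K B)
  (@counitl K B) (@counitr K B) charK0 cT _
    (bilin_io inc_linear rho_bilin) (fun v => rho_coder (inc v)) bone s.
by apply: etrans H _; rewrite counit1.
Qed.

(** Monoalternativity concerns the powers [Psi^n] of the group-like series
    [Psi = exp(a)]. Its [m]-th difference replaces [Psi^n] by [(Psi - 1)^m Psi^n].
    For [n = 0] the lowest term of [(Psi - 1)^m], of degree [m], is [m!] times
    the [m]-th power of [R_a], and this is the term that is needed. *)
Lemma psi_mulr x s : bmul x (ap psi (cls s)) = ap (E s) x.
Proof.
pose Psi : seq cT -> B := ap psi \o cls.
have bm := @bmul_bilin K B.
have Psi0 : Psi [::] = bone by exact: psi_one.
pose T n x s := mulRn x (comuln n (Psi s)).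
have T0 y : T 0%N y = const y.
  apply/funext => t; rewrite /T /= /Psi; have [_ _ ->] := psi_coalg.
  by rewrite -[counit _]/(ap (scounit cT) (cls t)) scounitE; case: t => [|b t] /=;
    rewrite ?scale1r ?scale0r.
have TS n y : T n.+1 y = conv (@bmul K B) (T n y) Psi.
  apply/funext => t; rewrite /T /= /Psi; have [_ -> _] := psi_coalg.
  have bm1 : bilin (fun t y' => bmul (@mulRn K B n y t) y').
    split=> [z c u v|u]; last exact: bm.2.
    by rewrite mulRn_linear bm.1.
  have bm2 : bilin (fun u y' => bmul (mulRn y (comuln n u)) y').
    split=> [z c u v|u]; last exact: bm.2.
    by rewrite comuln_linear mulRn_linear bm.1.
  rewrite [LHS]tlift_tmap //; last exact: comuln_linear.
  rewrite tlift_tmap //; try exact: apP.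
  have bm3 : bilin (fun u v : S => bmul (mulRn y (comuln n (ap psi u))) (ap psi v)).
    split=> [z c u v|z c u v]; first by rewrite (apP psi) bm2.1.
    by rewrite (apP psi) bm2.2.
  rewrite [LHS](tlift_comul t bm3).
  exact/esym/(conv_comp (@bmul K B) (fun u => mulRn y (comuln n (ap psi u))) (ap psi) cls cls t).
(* [R] multiplies by [Psi - 1]. *)
pose R F := conv (@bmul K B) F (aug Psi).
have RB F F' : R (F - F') = R F - R F'.
  by apply/funext => t; rewrite /R convDl // convNl.
have iterB m F F' : iter m R (F - F') = iter m R F - iter m R F'.
  by elim: m => //= m ->; exact: RB.
have RT n y : R (T n y) = T n.+1 y - T n y.
  apply/funext => t; rewrite subE TS /R [in X in _ = X - _](augE Psi) Psi0.
  by rewrite convDr // conv_constr // bmul1r addrAC subrr add0r.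
have GM m : forall n y t, iter m R (T n y) t = bmul y (iter m R (T n bone) t).
  elim: m => [|m IH] n y t; first by rewrite /= /T mB.
  rewrite !iterSr !RT !iterB !subE IH [X in _ - X]IH.
  by rewrite (bilDr bm) (bilNr bm).
have Rlow m F : (forall t, (size t < m)%N -> F t = 0) ->
    forall t, (size t < m.+1)%N -> R F t = 0.
  move=> F0 t tm; rewrite /R; case: (ltnP (size t) m) => [tm'|mt].
    have -> : conv (@bmul K B) F (aug Psi) t = conv (@bmul K B) 0 (aug Psi) t.
      by apply: conv_eq => // r rt; rewrite F0 // (leq_ltn_trans rt).
    by rewrite conv0l.
  rewrite conv_top //; first exact: (bil0r bm).
  by move=> r rt; rewrite F0 // (leq_trans rt).
have G0 m y : forall t, (size t < m)%N -> iter m R (T 0%N y) t = 0.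
  by elim: m => // m IH; exact: Rlow.
have Gm m y : forall t, size t = m -> iter m R (T 0%N y) t = m`!%:R *: ap (E t) y.
  elim: m => [|m IH] t Et.
    by rewrite T0 (size0nil Et) fact0 scale1r; exact/esym/(evs_flow_nil charK0 _ y).
  rewrite iterS /R (conv_low (n := m)) //; last exact: G0.
  transitivity (m`!%:R *: act io' (evs E y) t).
    rewrite -insZ; apply: eq_ins => v r; rewrite Et => -[Er].
    rewrite IH // (bilZl bm) /=; congr (_ *: _).
    by rewrite -[Psi _]/(ap psi (cls [:: v])) psi_cls1 -io_mul.
  have <- := deg_flow charK0 (bilin_io inc_linear rho_bilin) y t.
  by rewrite /deg Et scalerA -natrM mulnC factS.
have fN : ((size s)`!%:R : K) != 0.
  by have := natK_neq0 charK0 (size s)`!.-1; rewrite prednK ?fact_gt0.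
apply: (scalerI fN); rewrite -(Gm (size s) x s) // GM Gm //.
by rewrite (bilZr bm) psiE.
Qed.

Lemma psi_mul (u v : Utau) : ap psi (bmul u v) = bmul (ap psi u) (ap psi v).
Proof.
have bm := @bmul_bilin K B; have bu := @bmul_bilin K Utau.
move: v; apply: Sym_ext => [||s].
- exact: (comp_lin (apP psi) (bu.2 u)).
- exact: (comp_lin (bm.2 (ap psi u)) (apP psi)).
rewrite psi_mulr; have -> : bmul u (cls s : Utau) = evs (eflow charK0 triple_action) u s.
  exact: umulE.
suff H : ap psi \o evs (eflow charK0 triple_action) u = evs E (ap psi u).
  exact: (congr1 (fun F : seq cT -> B => F s) H).
apply: flow_uniq => [|t]; first by rewrite /= evs_flow_nil.
rewrite -[LHS]/(_ *: ap psi (evs _ u t)) -(linZ (apP psi)).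
rewrite [X in ap psi X](deg_flow charK0 (act_bilin triple_action) u t).
rewrite (lin_ins (apP psi)); apply: eq_ins => v r _.
exact: psi_equiv.
Qed.

Lemma psi_morph : bialg_morph (ap psi : Utau -> B).
Proof. by split; [exact: psi_coalg|exact: psi_mul|exact: psi_one]. Qed.

Lemma psi_at1 c : c \in tc tau -> at1 (iota' c) = ap psi (at1 (iotaT c)).
Proof.
move=> cc; rewrite -[c]/(inc (exist _ c cc)) at1_iota; exact/esym/psi_cls1.
Qed.

Lemma psi_unique (f : Utau -> B) : bialg_morph f ->
  (forall c, c \in tc tau -> at1 (iota' c) = f (at1 (iotaT c))) -> (ap psi : Utau -> B) = f.
Proof.
move=> [[lf _ _] fM f1] fc; apply/funext; apply: Sym_ext; [exact: apP|exact: lf|].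
move=> s; rewrite psiE.
suff H : f \o cls = evs E bone by exact: (congr1 (fun F : seq cT -> B => F s) (esym H)).
apply: flow_uniq => // t.
rewrite -[LHS]/(_ *: f (cls t)) -(linZ lf) -[_ *: cls t]/(deg cls t) -iotaS_cls.
rewrite (lin_ins lf); apply: eq_ins => v r _.
rewrite -umul_cls1 fM -at1_iota -fc ?inc_c //.
by rewrite -[RHS]/(io' v (f (cls r))) io_mul.
Qed.

End Universal.
End TripleAction.

(** * Equivalence of triples *)

Section TripleIso.
Variable K : fieldType.
Implicit Types t : triple K.

(** The morphisms under which both the reduced triple and the bialgebra are
    invariant. *)
Definition c_iso t t' (f : t -> t') : Prop :=
  [/\ is_triple_hom f, {in tc t &, injective f} &
      forall y, y \in tc t' -> exists2 x, x \in tc t & f x = y].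

Lemma hom_comp t1 t2 t3 (f : t1 -> t2) (g : t2 -> t3) :
  is_triple_hom f -> is_triple_hom g -> is_triple_hom (g \o f).
Proof.
move=> [lf bf sf cf] [lg bg sg cg]; split=> [|x y|x xs|x xc] /=.
- exact: comp_lin.
- by rewrite bf bg.
- exact/sg/sf.
- exact/cg/cf.
Qed.

Lemma triple_iso_sym t t' : triple_iso t t' -> triple_iso t' t.
Proof. by move=> [f [g [hf hg fK gK]]]; exists g, f. Qed.

Lemma triple_iso_trans t1 t2 t3 :
  triple_iso t1 t2 -> triple_iso t2 t3 -> triple_iso t1 t3.
Proof.
move=> [f [g [hf hg fK gK]]] [f' [g' [hf' hg' fK' gK']]].
exists (f' \o f), (g \o g'); split; try exact: hom_comp; exact: can_comp.
Qed.

Lemma triple_iso_c_iso t t' : triple_iso t t' -> exists f : t -> t', c_iso f.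
Proof.
move=> [f [g [hf hg fK gK]]]; exists f; split=> // [x y _ _|y yc]; first exact: can_inj fK _ _.
by exists (g y); rewrite ?gK //; case: hg => _ _ _; apply.
Qed.

Section CIso.
Variables (t t' : triple K) (f : t -> t').
Hypothesis cf : c_iso f.

Lemma c_iso_lin : linear f. Proof. by case: cf => -[]. Qed.
Lemma c_iso_lie x y : f (lie x y) = lie (f x) (f y). Proof. by case: cf => -[]. Qed.
Lemma c_iso_s x : x \in ts t -> f x \in ts t'. Proof. by case: cf => -[_ _ h _] _ _; exact: h. Qed.
Lemma c_iso_c x : x \in tc t -> f x \in tc t'. Proof. by case: cf => -[_ _ _ h] _ _; exact: h. Qed.

(** The component of [x] along [c] goes to [s'], hence to [0]. *)
Lemma c_iso_reflect_s x : f x \in ts t' -> x \in ts t.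
Proof.
move=> fx; have [a [b [as_ bc E]]] := triple_cover x.
have fb0 : f b = 0.
  apply: triple_direct; last exact: c_iso_c.
  by rewrite -[b](addKr a) -E (linD c_iso_lin) (linN c_iso_lin) rpredD ?rpredN // c_iso_s.
have [_ inj _] := cf.
have b0 : b = 0 by apply: inj; rewrite ?rpred0 // fb0 (lin0 c_iso_lin).
by rewrite E b0 addr0.
Qed.

Lemma c_iso_inv_c x : injective f -> f x \in tc t' -> x \in tc t.
Proof. by move=> fi; have [_ _ fs] := cf => /fs [z zc /fi <-]. Qed.

Lemma c_iso_bij : injective f -> (forall y, exists x, f x = y) -> triple_iso t t'.
Proof.
move=> fi fs; pose g y := sval (cid (fs y)).
have gK : cancel g f by move=> y; exact: (svalP (cid (fs y))).
have fK : cancel f g by move=> x; apply: fi; rewrite gK.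
exists f, g; split=> //; first by case: cf.
split=> [a x y|x y|y ys|y yc].
- by apply: fi; rewrite c_iso_lin !gK.
- by apply: fi; rewrite c_iso_lie !gK.
- by apply: c_iso_reflect_s; rewrite gK.
- by apply: c_iso_inv_c => //; rewrite gK.
Qed.

Lemma g_inn_map x : x \in g_inn t -> f x \in g_inn t'.
Proof.
move=> /g_innP Hx; apply/g_innP => G cG.
have P0 : f 0 \in lsub G by rewrite (lin0 c_iso_lin) rpred0.
have PL a u v : f u \in lsub G -> f v \in lsub G -> f (a *: u + v) \in lsub G.
  by move=> fu fv; rewrite c_iso_lin rpredD ?rpredZ.
have Plie : {in mk_subspace (P := fun z => f z \in lsub G) P0 PL &, forall u v,
   lie u v \in mk_subspace (P := fun z => f z \in lsub G) P0 PL}.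
  move=> u v /mk_subspaceP fu /mk_subspaceP fv; apply/mk_subspaceP.
  by rewrite c_iso_lie; exact: lsub_lie.
suff : x \in lsub (LieSubalg Plie) by move/mk_subspaceP.
by apply: Hx => c cc; apply/mk_subspaceP/cG/c_iso_c.
Qed.

Lemma g_inn_surj y : y \in g_inn t' -> exists2 x, x \in g_inn t & f x = y.
Proof.
move=> /g_innP Hy.
pose P z := exists2 x, x \in g_inn t & f x = z.
have P0 : P 0 by exists 0; [exact: rpred0|exact: lin0 c_iso_lin].
have PL a u v : P u -> P v -> P (a *: u + v).
  move=> [x gx <-] [z gz <-]; exists (a *: x + z); first by rewrite rpredD ?rpredZ.
  exact: c_iso_lin.
have Plie : {in mk_subspace P0 PL &, forall u v, lie u v \in mk_subspace P0 PL}.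
  move=> u v /mk_subspaceP[x gx <-] /mk_subspaceP[z gz <-]; apply/mk_subspaceP.
  by exists (lie x z); [exact: lsub_lie|exact: c_iso_lie].
suff : y \in lsub (LieSubalg Plie) by move/mk_subspaceP.
apply: Hy => c cc; apply/mk_subspaceP; have [_ _ fs] := cf; have [x xc <-] := fs c cc.
by exists x => //; exact: tc_g_inn.
Qed.

Definition inn_map (x : tinn t) : tinn t' := exist _ (f (val x)) (g_inn_map (valP x)).

Lemma inn_map_surj y : exists x, inn_map x = y.
Proof.
have [x gx E] := g_inn_surj (valP y).
by exists (exist _ x gx); apply: val_inj.
Qed.

Lemma inn_map_c_iso : c_iso inn_map.
Proof.
have [_ inj fs] := cf; split.
- split=> [a x y|x y|x|x].
  + by apply: val_inj; exact: c_iso_lin.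
  + by apply: val_inj; exact: c_iso_lie.
  + by rewrite !traceP; exact: c_iso_s.
  + by rewrite !traceP; exact: c_iso_c.
- move=> x y; rewrite !traceP => xc yc /(congr1 val) E.
  by apply: val_inj; exact: inj.
- move=> y; rewrite traceP => /fs[x xc E].
  exists (exist _ x (tc_g_inn xc)); first by rewrite traceP.
  exact: val_inj.
Qed.

End CIso.

Section Quotient.
Variables (t t' : triple K) (f : t -> t').
Hypothesis cf : c_iso f.
Hypothesis fsurj : forall y, exists x, f x = y.

(** Preimages of ideals contained in [s'] lie in [s] by [c_iso_reflect_s], and
    images of ideals are ideals by surjectivity. *)
Lemma core_map x : (f x \in core t') = (x \in core t).
Proof.
apply/coreP/coreP => -[I [sI xI]].
- have P0 : f 0 \in lideal I by rewrite (lin0 (c_iso_lin cf)) rpred0.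
  have PL a u v : f u \in lideal I -> f v \in lideal I -> f (a *: u + v) \in lideal I.
    by move=> fu fv; rewrite (c_iso_lin cf) rpredD ?rpredZ.
  have Plie u v : v \in mk_subspace (P := fun z => f z \in lideal I) P0 PL ->
     lie u v \in mk_subspace (P := fun z => f z \in lideal I) P0 PL.
    by move=> /mk_subspaceP fv; apply/mk_subspaceP; rewrite (c_iso_lie cf) lideal_lie.
  exists (LieIdeal Plie); split; last exact/mk_subspaceP.
  by move=> z /mk_subspaceP fz; apply: (c_iso_reflect_s cf); exact: sI.
pose P z := exists2 x, x \in lideal I & f x = z.
have P0 : P 0 by exists 0; [exact: rpred0|exact: lin0 (c_iso_lin cf)].
have PL a u v : P u -> P v -> P (a *: u + v).
  move=> [y yI <-] [z zI <-]; exists (a *: y + z); first by rewrite rpredD ?rpredZ.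
  exact: (c_iso_lin cf).
have Plie u v : v \in mk_subspace P0 PL -> lie u v \in mk_subspace P0 PL.
  move=> /mk_subspaceP[z zI <-]; apply/mk_subspaceP; have [y <-] := fsurj u.
  by exists (lie y z); [exact: lideal_lie|exact: (c_iso_lie cf)].
exists (LieIdeal Plie); split; last by apply/mk_subspaceP; exists x.
by move=> _ /mk_subspaceP[z zI <-]; apply: (c_iso_s cf); exact: sI.
Qed.

Definition quot_map (q : tquot t) : tquot t' := sp_pi (core t') (f (repr q)).

Lemma quot_mapE x : quot_map (sp_pi (core t) x) = sp_pi (core t') (f x).
Proof.
apply/sp_piE; rewrite -(linB (c_iso_lin cf)) core_map; apply/sp_piE; exact: sp_piK.
Qed.

Lemma quot_map_c_iso : c_iso quot_map.
Proof.
have [_ inj fs] := cf; split.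
- split=> [a p q|p q|q|q].
  + rewrite -[p]sp_piK -[q]sp_piK -sp_pi_linear !quot_mapE (c_iso_lin cf).
    exact: sp_pi_linear.
  + rewrite -[p]sp_piK -[q]sp_piK; set x := repr p; set y := repr q.
    transitivity (quot_map (sp_pi (core t) (lie x y))).
      by congr quot_map; exact: quot_lieE.
    by rewrite !quot_mapE (c_iso_lie cf); exact/esym/quot_lieE.
  + move=> /quot_imageP[x xs ->]; apply/quot_imageP; exists (f x).
      exact: (c_iso_s cf).
    exact: quot_mapE.
  + move=> /quot_imageP[x xs ->]; apply/quot_imageP; exists (f x).
      exact: (c_iso_c cf).
    exact: quot_mapE.
- move=> _ _ /quot_imageP[x xc ->] /quot_imageP[y yc ->].
  by rewrite !quot_mapE => /sp_piE; rewrite -(linB (c_iso_lin cf)) core_map => /sp_piE.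
- move=> _ /quot_imageP[y /fs[x xc <-] ->]; exists (sp_pi (core t) x).
    by apply/quot_imageP; exists x.
  exact: quot_mapE.
Qed.

Lemma quot_map_iso : triple_iso (tquot t) (tquot t').
Proof.
apply: (c_iso_bij quot_map_c_iso) => [p q|q].
  rewrite -[p]sp_piK -[q]sp_piK !quot_mapE => /sp_piE.
  by rewrite -(linB (c_iso_lin cf)) core_map => /sp_piE.
have [x E] := fsurj (repr q); exists (sp_pi (core t) x).
by rewrite quot_mapE E sp_piK.
Qed.
End Quotient.

Lemma c_iso_equiv t t' (f : t -> t') : c_iso f -> triple_equiv t t'.
Proof.
move=> cf; exact: (quot_map_iso (inn_map_c_iso cf) (inn_map_surj cf)).
Qed.

Lemma tinn_c_iso t : c_iso (val : tinn t -> t).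
Proof.
split; first split=> //.
- by move=> x; rewrite traceP.
- by move=> x; rewrite traceP.
- by move=> x y _ _; exact: val_inj.
- move=> y yc; exists (exist _ y (tc_g_inn yc)) => //.
  by rewrite traceP.
Qed.

Lemma tquot_c_iso t : c_iso (sp_pi (core t) : t -> tquot t).
Proof.
split; first split.
- exact: sp_pi_linear.
- by move=> x y; exact/esym/quot_lieE.
- by move=> x xs; apply/quot_imageP; exists x.
- by move=> x xs; apply/quot_imageP; exists x.
- move=> x y xc yc /sp_piE /core_sub xy; apply/eqP; rewrite -subr_eq0; apply/eqP.
  by apply: triple_direct => //; rewrite rpredB.
- by move=> _ /quot_imageP[x xc ->]; exists x.
Qed.

End TripleIso.

(** * Isomorphisms of bialgebras *)

Section Bialgebras.
Variable K : fieldType.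

Lemma bialg_iso_sym (U B : bialgType K) : bialg_iso U B -> bialg_iso B U.
Proof. by move=> [f [g [hf hg fK gK]]]; exists g, f. Qed.

Lemma bialg_morph_comp (U B C : bialgType K) (f : U -> B) (g : B -> C) :
  bialg_morph f -> bialg_morph g -> bialg_morph (g \o f).
Proof.
move=> [[lf df ef] mf f1] [[lg dg eg] mg g1]; split; [split| |].
- exact: comp_lin.
- by move=> u /=; rewrite dg df tmap_comp.
- by move=> u /=; rewrite eg.
- by move=> u v /=; rewrite mf mg.
- by rewrite /= f1.
Qed.

Lemma bialg_iso_trans (U B C : bialgType K) :
  bialg_iso U B -> bialg_iso B C -> bialg_iso U C.
Proof.
move=> [f [g [hf hg fK gK]]] [f' [g' [hf' hg' fK' gK']]].
exists (f' \o f), (g \o g'); split; try exact: bialg_morph_comp; exact: can_comp.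
Qed.

Lemma bialg_morph_inv (U B : bialgType K) (f : U -> B) (g : B -> U) :
  bialg_morph f -> cancel f g -> cancel g f -> bialg_iso U B.
Proof.
move=> hf fK gK; exists f, g; split=> //; case: hf => -[lf df ef] mf f1.
have fi := can_inj fK.
have lg : linear g by move=> a x y; apply: fi; rewrite lf !gK.
split; first split=> //.
- move=> v; rewrite -[in RHS](gK v) df tmap_comp // -[LHS]tmap_id.
  by apply: eq_tlift => x y; rewrite /= !fK.
- by move=> v; rewrite -{2}(gK v) ef.
- by move=> u v; apply: fi; rewrite mf !gK.
- by apply: fi; rewrite f1 gK.
Qed.

(** Conjugation by the isomorphism. *)
Lemma bialg_iso_c_iso (U B : bialgType K) : bialg_iso U B ->
  exists f : triple_of U -> triple_of B, c_iso f.
Proof.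
move=> [f [g [[[lf df ef] mf f1] [[lg dg eg] mg g1] fK gK]]].
have tK (s : tensor B B) : tmap f f (tmap g g s) = s.
  by rewrite tmap_comp // -[RHS]tmap_id; apply: eq_tlift => x y; rewrite /= !gK.
have cP (h : triple_of U) : in_coder (fun y => f (coder_fun h (g y))).
  have [lh Dh] := coderP h; split; first exact: (comp_lin lf (comp_lin lh lg)).
  move=> u; rewrite df Dh dg (linD (tmap_linear lf lf)) !tmap_comp //; last first.
    exact: comp_lin.
    exact: comp_lin.
  by congr (_ + _); apply: eq_tlift => x y; rewrite /= gK.
pose phi h : triple_of B := mk_coder (cP h).
have phiE h y : coder_fun (phi h) y = f (coder_fun h (g y)) by [].
exists phi; split; first split.
- by move=> a h h'; apply: coder_eq => y; rewrite phiE lf.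
- by move=> h h'; apply: coder_eq => y; rewrite phiE (linB lf) -[coder_fun (lie _ _) y]/(_ - _) !phiE !fK.
- by move=> h /s_coderP hs; apply/s_coderP; rewrite phiE g1 hs (lin0 lf).
- move=> h /c_coderP[a [pa E]]; apply/c_coderP; exists (f a); split.
    by rewrite /primitive df pa (linD (tmap_linear lf lf)) !tmapE // f1.
  by move=> x; rewrite phiE E mf gK.
- move=> h h' _ _ E; apply: coder_eq => y.
  have := congr1 (fun k : triple_of B => coder_fun k (f y)) E.
  by rewrite !phiE !fK => /(can_inj fK).
- move=> k /c_coderP[a [pa E]].
  have pga : primitive (g a).
    by rewrite /primitive dg pa (linD (tmap_linear lg lg)) !tmapE // g1.
  exists (coderR pga).
    by apply/c_coderP; exists (g a); split.
  by apply: coder_eq => y; rewrite phiE E -[coder_fun _ _]/(bmul _ _) mf !gK.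
Qed.

Hypothesis charK0 : [pchar K] =i pred0.

Lemma iotaT_c_iso t : c_iso (@iotaT K charK0 t).
Proof. by split; [exact: iota_hom|exact: iota_inj|exact: iota_surj]. Qed.

Lemma ins_map (V V' W : lmodType K) (h : V -> V') (Phi : V' -> seq V' -> W) s :
  ins Phi (map h s) = ins (fun v t => Phi (h v) (map h t)) s.
Proof.
elim: s Phi => [|b s IH] Phi //=; congr (_ + _); exact: IH.
Qed.

Lemma sml_map (V V' W : lmodType K) (h : V -> V') (F : seq V' -> W) :
  linear h -> sml F -> sml (F \o map h).
Proof.
by move=> lh sF; split=> [s1 s2 a x y|s1 s2 x y]; rewrite /= !map_cat /=;
  [rewrite lh sF.1|rewrite sF.2].
Qed.

(** The universal property yields the morphism. On [Sym c] it is the functorial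
    map of the linear bijection between the subspaces [c], hence bijective. *)
Lemma c_iso_bialg_iso (t t' : triple K) (f : t -> t') : c_iso f ->
  bialg_iso (Utau charK0 t) (Utau charK0 t').
Proof.
move=> cf; have [hf inj fs] := cf.
pose h (v : cT t) : cT t' := exist _ (f (inc v)) (c_iso_c cf (inc_c v)).
have hE v : inc (h v) = f (inc v) by [].
have lh : linear h by move=> a v w; apply: inc_inj; exact: (c_iso_lin cf).
have hs (w : cT t') : exists v, h v = w.
  have [x xc E] := fs _ (inc_c w); exists (exist _ x xc).
  by apply: inc_inj; rewrite hE.
pose k w := sval (cid (hs w)).
have kK : cancel k h by move=> w; exact: (svalP (cid (hs w))).
have hi : injective h.
  by move=> v w /(congr1 (@inc K t')) E; apply: inc_inj; apply: inj; [exact: inc_c|exact: inc_c|].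
have hK : cancel h k by move=> v; apply: hi; rewrite kK.
have lk : linear k by move=> a v w; apply: hi; rewrite lh !kK.
have hi' : is_triple_hom (@iotaT K charK0 t' \o f).
  exact: hom_comp hf (iota_hom charK0 t').
have mB : right_monoalternative (Utau charK0 t') by exact: Ualg_monoalt.
pose P := psi charK0 hi'.
have PE s : ap P (cls s) = cls (map h s).
  rewrite psiE.
  suff H : @cls K (cT t') \o map h =
    evs (exprho charK0 (@inc_linear K t) (rho_bilin hi')) (bone : Utau charK0 t').
    exact: (congr1 (fun F : seq (cT t) -> Utau charK0 t' => F s) (esym H)).
  apply: flow_uniq => // r.
  rewrite -[LHS]/((size r)%:R *: cls (map h r)) -(size_map h).
  rewrite -[LHS]/(deg (@cls K (cT t')) (map h r)) -(iotaS_cls charK0) /act ins_map.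
  by apply: eq_ins.
pose Q : Lin (Sym (cT t')) (Sym (cT t)) := slift (sml_map lk (@sml_cls K (cT t))).
apply: (@bialg_morph_inv (Utau charK0 t) (Utau charK0 t') (ap P) (ap Q)); first exact: psi_morph.
- apply: (@Sym_ext _ _ _ (fun u => ap Q (ap P u)) id) => [|//|s].
    exact: (comp_lin (apP Q) (apP P)).
  by rewrite PE sliftE /= mapK.
- apply: (@Sym_ext _ _ _ (fun u => ap P (ap Q u)) id) => [|//|s].
    exact: (comp_lin (apP P) (apP Q)).
  by rewrite sliftE /= PE mapK.
Qed.

(** Go up from [tau_inn] to [tau], and down from [tau_inn] to [tau_red]. *)
Lemma c_iso_tred (t : triple K) : bialg_iso (Utau charK0 t) (Utau charK0 (tred t)).
Proof.
apply: (bialg_iso_trans (B := Utau charK0 (tinn t))).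
  exact/bialg_iso_sym/c_iso_bialg_iso/tinn_c_iso.
exact/c_iso_bialg_iso/tquot_c_iso.
Qed.

End Bialgebras.

Theorem theorem3p2 (K : fieldType) (charK0 : [pchar K] =i pred0) :
  exists (U : triple K -> naHopfType K)
         (iota : forall tau : triple K, tau -> triple_of (U tau)),
    (forall tau : triple K,
      [/\ right_monoalternative (U tau), connected (U tau) &
          is_triple_hom (iota tau)] /\
      ({in tc tau &, injective (iota tau)} /\
       forall f : triple_of (U tau), f \in tc (triple_of (U tau)) ->
         exists2 c : tau, c \in tc tau & iota tau c = f) /\
      (forall (U' : bialgType K) (iota' : tau -> triple_of U'),
         right_monoalternative U' -> is_triple_hom iota' ->
         exists! psi : U tau -> U',
           bialg_morph psi /\
           forall c : tau, c \in tc tau ->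
             at1 (iota' c) = psi (at1 (iota tau c))) /\
      triple_equiv tau (triple_of (U tau))) /\
    (forall tau tau' : triple K,
      bialg_iso (U tau) (U tau') <-> triple_equiv tau tau').
Proof.
exists (Utau charK0), (@iotaT K charK0); split=> [tau|tau tau'].
  split; [|split; [|split]].
  - split; [exact: Ualg_monoalt|exact: Ualg_connected|exact: iota_hom].
  - split; [exact: iota_inj|exact: iota_surj].
  - move=> U' iota' mU hi; exists (ap (psi charK0 hi)); split.
      split; [exact: psi_morph|exact: psi_at1].
    by move=> g [mg g1]; exact: psi_unique.
  - exact/c_iso_equiv/iotaT_c_iso.
split=> [/bialg_iso_c_iso[f cf]|/triple_iso_c_iso[f cf]].
  apply: triple_iso_trans (c_iso_equiv (iotaT_c_iso charK0 tau)) _.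
  apply: triple_iso_trans (c_iso_equiv cf) _.
  exact: triple_iso_sym (c_iso_equiv (iotaT_c_iso charK0 tau')).
apply: bialg_iso_trans (c_iso_tred charK0 tau) _.
apply: bialg_iso_trans (c_iso_bialg_iso charK0 cf) _.
exact: bialg_iso_sym (c_iso_tred charK0 tau').
Qed.
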